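(* The complex linear space spanned by the functions $${\rm ch}^{(\pm)}_{H(\Lambda^{[-1,1]})}(\tau,z),\quad \big[{\rm ch}^{(\pm)}_{H(\Lambda^{[-1,0]})}+{\rm ch}^{(\pm)}_{H(\Lambda^{[-1,2]})}\big](\tau,z),\quad {\rm ch}^{(+){\rm tw}(\sigma_\pm)}_{H(\Lambda^{[-1,1]})}(\tau,z)$$ (six functions) is $SL_2(\mathbb{Z})$-invariant, i.e. it is preserved by $f(\tau,z)\mapsto e^{-\frac{\pi iz^2}{\tau}}f(-\frac1\tau,\frac z\tau)$ and by $f(\tau,z)\mapsto f(\tau+1,z)$. Namely, although the space of honest characters (the linear span of ${\rm ch}^{(\pm)}_{H(\Lambda^{[-1,m_2]})}$ and ${\rm ch}^{(+){\rm tw}(\sigma_\pm)}_{H(\Lambda^{[-1,m_2]})}$, $m_2=0,1,2$) is not $SL_2(\mathbb{Z})$-invariant, it contains a non-trivial $SL_2(\mathbb{Z})$-invariant subspace.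
   Context: Notation: $q^a:=e^{2\pi i a\tau}$ with ${\rm Im}\,\tau>0$, $z\in\mathbb{C}$, $\eta(\tau)=q^{1/24}\prod_{n\ge1}(1-q^n)$, and for $a,b\in\{0,1\}$ the Mumford theta functions are $\vartheta_{ab}(\tau,z)=\sum_{n\in\mathbb{Z}}e^{\pi i\tau(n+\frac a2)^2+2\pi i(n+\frac a2)(z+\frac b2)}$. The action of $SL_2(\mathbb{Z})$ on functions is $(f|_\gamma)(\tau,z)=e^{-\frac{\pi i c z^2}{c\tau+d}}f\big(\frac{a\tau+b}{c\tau+d},\frac{z}{c\tau+d}\big)$ for $\gamma=\begin{pmatrix}a&b\\c&d\end{pmatrix}$. For $m\in\frac12\mathbb{N}$, $s\in\frac12\mathbb{Z}$ put $\Phi_1^{[m,s]}(\tau,z_1,z_2,t)=e^{-2\pi imt}\sum_{j\in\mathbb{Z}}\frac{e^{2\pi imj(z_1+z_2)+2\pi isz_1}e^{2\pi i\tau(mj^2+sj)}}{1-e^{2\pi iz_1}e^{2\pi ij\tau}}$, $\Phi_2^{[m,s]}(\tau,z_1,z_2,t)=e^{-2\pi imt}\sum_{j\in\mathbb{Z}}\frac{e^{-2\pi imj(z_1+z_2)-2\pi isz_2}e^{2\pi i\tau(mj^2+sj)}}{1-e^{-2\pi iz_2}e^{2\pi ij\tau}}$, $\Phi^{[m,s]}=\Phi_1^{[m,s]}-\Phi_2^{[m,s]}$. N=3 denominators: $R^{(+)}(\tau,z)=\eta(\frac\tau2)\eta(2\tau)\frac{\vartheta_{11}(\tau,z)}{\vartheta_{00}(\tau,z)}$,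 $R^{(-)}(\tau,z)=\frac{\eta(\tau)^3}{\eta(\frac\tau2)}\frac{\vartheta_{11}(\tau,z)}{\vartheta_{01}(\tau,z)}$, $R^{(+){\rm tw}}(\tau,z)=\frac1{\sqrt2}\frac{\eta(\tau)^3}{\eta(2\tau)}\frac{\vartheta_{11}(\tau,z)}{\vartheta_{10}(\tau,z)}$. For $m_2\in\{0,1,2\}$ let $H(\Lambda^{[-1,m_2]})$ be the N=3 superconformal module obtained by quantum Hamiltonian reduction of the $\widehat{osp}(3|2)$-module of highest weight $-\Lambda_0-\frac{m_2}{2}\alpha_1$. Its honest character, supercharacter and twisted characters, with $s=\frac{m_2+1}{2}$, are the functions of $(\tau,z)$ given by $R^{(+)}{\rm ch}^{(+)}=\Phi^{[1,s]}(2\tau,z+\frac\tau2-\frac12,z-\frac\tau2+\frac12,\frac\tau8)$, $R^{(-)}{\rm ch}^{(-)}=\Phi^{[1,s]}(2\tau,z+\frac\tau2,z-\frac\tau2,\frac\tau8)$, $R^{(+){\rm tw}}{\rm ch}^{(+){\rm tw}(\sigma_+)}=\Phi^{[1,s]}(2\tau,z+\tau-\frac12,z-\tau+\frac12,\frac\tau2)$, $R^{(+){\rm tw}}{\rm ch}^{(+){\rm tw}(\sigma_-)}=\Phi^{[1,s]}(2\tau,z-\frac12,z+\frac12,0)$. *)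

(* Defs.v *)
(* Stdlib reals + Coquelicot's complex numbers. *)
From Stdlib Require Import Reals ZArith List Lra Lia Psatz.
From Coquelicot Require Import Coquelicot.

Local Open Scope R_scope.
Local Open Scope C_scope.

Definition Cexp (w : C) : C := (exp (Re w) * cos (Im w), exp (Re w) * sin (Im w))%R.

(* [e2pi w] is e^{2 pi i w}; thus q^a is [e2pi (a * tau)]. *)
Definition e2pi (w : C) : C := Cexp (2 * PI * Ci * w).

Definition CLim_seq (u : nat -> C) : C :=
  (real (Lim_seq (fun n => Re (u n))), real (Lim_seq (fun n => Im (u n)))).

Definition CSeries (u : nat -> C) : C :=
  (Series (fun n => Re (u n)), Series (fun n => Im (u n))).

(* Sum over all integers (those used below converge absolutely on [dom]). *)
Definition CSumZ (u : Z -> C) : C :=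
  CSeries (fun n => u (Z.of_nat n)) + CSeries (fun n => u (- Z.of_nat (S n))%Z).

Fixpoint Cprod (u : nat -> C) (n : nat) : C :=
  match n with
  | O => 1
  | S k => Cprod u k * u k
  end.

Definition eta (tau : C) : C :=
  e2pi (tau / 24) * CLim_seq (Cprod (fun n => 1 - e2pi (INR (S n) * tau))).

Definition theta (a b : nat) (tau z : C) : C :=
  CSumZ (fun n =>
    let r := (IZR n + INR a / 2)%R in
    Cexp (PI * Ci * tau * r ^ 2 + 2 * PI * Ci * r * (z + INR b / 2))).

Definition Phi1 (m s : R) (tau z1 z2 t : C) : C :=
  e2pi (- (m * t)) *
  CSumZ (fun n => let j := IZR n in
    e2pi (m * j * (z1 + z2) + s * z1) * e2pi (tau * (m * j ^ 2 + s * j))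
    / (1 - e2pi z1 * e2pi (j * tau))).

Definition Phi2 (m s : R) (tau z1 z2 t : C) : C :=
  e2pi (- (m * t)) *
  CSumZ (fun n => let j := IZR n in
    e2pi (- (m * j * (z1 + z2)) - s * z2) * e2pi (tau * (m * j ^ 2 + s * j))
    / (1 - e2pi (- z2) * e2pi (j * tau))).

Definition Phi (m s : R) (tau z1 z2 t : C) : C :=
  Phi1 m s tau z1 z2 t - Phi2 m s tau z1 z2 t.

Definition R_plus (tau z : C) : C :=
  eta (tau / 2) * eta (2 * tau) * (theta 1 1 tau z / theta 0 0 tau z).

Definition R_minus (tau z : C) : C :=
  eta tau ^ 3 / eta (tau / 2) * (theta 1 1 tau z / theta 0 1 tau z).

Definition R_tw (tau z : C) : C :=
  / sqrt 2 * (eta tau ^ 3 / eta (2 * tau)) * (theta 1 1 tau z / theta 1 0 tau z).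

Definition s_of (m2 : nat) : R := ((INR m2 + 1) / 2)%R.

(* The honest (super, twisted) characters of H(Lambda^{[-1,m2]}), m2 = 0, 1, 2,
   given by R * ch = Phi; the denominators do not vanish on [dom] below. *)
Definition ch_plus (m2 : nat) (tau z : C) : C :=
  Phi 1 (s_of m2) (2 * tau) (z + tau / 2 - 1 / 2) (z - tau / 2 + 1 / 2) (tau / 8)
  / R_plus tau z.

Definition ch_minus (m2 : nat) (tau z : C) : C :=
  Phi 1 (s_of m2) (2 * tau) (z + tau / 2) (z - tau / 2) (tau / 8)
  / R_minus tau z.

Definition ch_tw_sigma_plus (m2 : nat) (tau z : C) : C :=
  Phi 1 (s_of m2) (2 * tau) (z + tau - 1 / 2) (z - tau + 1 / 2) (tau / 2)
  / R_tw tau z.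

Definition ch_tw_sigma_minus (m2 : nat) (tau z : C) : C :=
  Phi 1 (s_of m2) (2 * tau) (z - 1 / 2) (z + 1 / 2) 0
  / R_tw tau z.

(* The characters are meromorphic functions on {Im tau > 0} x C, and their poles
   and the zeros of the denominators lie on the divisor z in (Z + Z tau)/2.
   The complement [dom] of this divisor is connected, open, dense and stable
   under SL_2(Z) (lemma [dom_slash]), so such meromorphic functions are
   identified with their restrictions to [dom]; values off [dom] are ignored. *)
Definition dom (tau z : C) : Prop :=
  (0 < Im tau)%R /\ forall k l : Z, z <> IZR k / 2 + IZR l / 2 * tau.

Definition fn := C -> C -> C.

Definition fn_eq (f g : fn) : Prop := forall tau z, dom tau z -> f tau z = g tau z.

Definition fn_zero : fn := fun _ _ => 0.

Definition fn_plus (f g : fn) : fn := fun tau z => f tau z + g tau z.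

Definition fn_scal (c : C) (f : fn) : fn := fun tau z => c * f tau z.

Fixpoint lincomb (cs : list C) (fs : list fn) : fn :=
  match cs, fs with
  | c :: cs', f :: fs' => fn_plus (fn_scal c f) (lincomb cs' fs')
  | _, _ => fn_zero
  end.

Definition span (fs : list fn) (f : fn) : Prop :=
  exists cs : list C, length cs = length fs /\ fn_eq f (lincomb cs fs).

Definition fn_incl (W V : fn -> Prop) : Prop := forall f, W f -> V f.

Definition nontrivial_in (W V : fn -> Prop) : Prop :=
  (exists f, W f /\ ~ fn_eq f fn_zero) /\ (exists f, V f /\ ~ W f).

(* The action of ((a, b), (c, d)) in SL_2(Z); note that f(tau, z) |-> e^{-pi i z^2/tau}
   f(-1/tau, z/tau) is [slash 0 (-1) 1 0] and f(tau, z) |-> f(tau + 1, z)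
   is [slash 1 1 0 1]. *)
Definition slash (a b c d : Z) (f : fn) : fn := fun tau z =>
  let J := IZR c * tau + IZR d in
  Cexp (- (PI * Ci * IZR c * z ^ 2 / J)) * f ((IZR a * tau + IZR b) / J) (z / J).

Definition SL2Z_invariant (W : fn -> Prop) : Prop :=
  forall a b c d : Z, (a * d - b * c = 1)%Z ->
  forall f, W f -> W (slash a b c d f).

Definition six_functions : list fn :=
  ch_plus 1 :: ch_minus 1
  :: fn_plus (ch_plus 0) (ch_plus 2) :: fn_plus (ch_minus 0) (ch_minus 2)
  :: ch_tw_sigma_plus 1 :: ch_tw_sigma_minus 1 :: nil.

Definition honest_characters : list fn :=
  flat_map
    (fun m2 => ch_plus m2 :: ch_minus m2
               :: ch_tw_sigma_plus m2 :: ch_tw_sigma_minus m2 :: nil)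
    (0 :: 1 :: 2 :: nil)%nat.

Lemma J_neq0 (c d : Z) (tau : C) :
  (0 < Im tau)%R -> (c <> 0 \/ d <> 0)%Z -> IZR c * tau + IZR d <> 0.
Proof.
intros Ht Hcd H; destruct tau as [x y]; simpl in Ht.
apply (f_equal Re) in H as Hr; apply (f_equal Im) in H as Hi.
cbn in Hr, Hi.
assert (Hc : (IZR c * y = 0)%R) by lra.
apply Rmult_integral in Hc; destruct Hc as [Hc | Hc]; [| lra].
assert (Hd : IZR d = 0%R) by (rewrite Hc in Hr; lra).
apply eq_IZR in Hc; apply eq_IZR in Hd; lia.
Qed.

Lemma dom_slash (a b c d : Z) (tau z : C) :
  (a * d - b * c = 1)%Z -> dom tau z ->
  dom ((IZR a * tau + IZR b) / (IZR c * tau + IZR d)) (z / (IZR c * tau + IZR d)).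
Proof.
intros Hdet [Ht Hz].
assert (HJ : IZR c * tau + IZR d <> 0) by (apply J_neq0; [exact Ht |];
      destruct (Z.eq_dec c 0); destruct (Z.eq_dec d 0); subst; lia).
split.
- destruct tau as [x y]; simpl in Ht.
  assert (Hn : (0 < (IZR c * x + IZR d) ^ 2 + (IZR c * y) ^ 2)%R).
  { destruct (Rlt_or_le 0 ((IZR c * x + IZR d) ^ 2 + (IZR c * y) ^ 2)) as [H | H];
      [exact H |].
    assert (H1 : (IZR c * x + IZR d = 0)%R) by nra.
    assert (H2 : (IZR c * y = 0)%R) by nra.
    exfalso; apply HJ; apply injective_projections; cbn; lra. }
  assert (HdetR : (IZR a * IZR d - IZR b * IZR c = 1)%R)
    by (rewrite <- !mult_IZR, <- minus_IZR, Hdet; reflexivity).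
  replace (Im _) with (y / ((IZR c * x + IZR d) ^ 2 + (IZR c * y) ^ 2))%R.
  + apply Rdiv_lt_0_compat; assumption.
  + replace y with ((IZR a * IZR d - IZR b * IZR c) * y)%R at 1
      by (rewrite HdetR; ring).
    cbn; field; nra.
- intros k l H; apply (Hz (k * d + l * b)%Z (k * c + l * a)%Z).
  replace z with (z / (IZR c * tau + IZR d) * (IZR c * tau + IZR d))
    by (field; exact HJ).
  rewrite H, !plus_IZR, !mult_IZR, !RtoC_plus, !RtoC_mult.
  field; repeat split; try exact HJ;
  intro E; apply RtoC_inj in E; lra.
Qed.

(* Main.v *)
Require Import Defs.
From Stdlib Require Import Reals ZArith List Lra Lia Psatz.
From Coquelicot Require Import Coquelicot.

Local Open Scope R_scope.
Local Open Scope C_scope.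

(** The functions [Phi 1 1] are theta quotients by the affine sl(2|1) denominator identity,
    which is obtained from the partial fraction expansion of a finite product by dominated
    convergence.  The sum [Phi 1 (1/2) + Phi 1 (3/2)] reduces to the same identity at equal
    arguments.  With a0 = theta_00(2 tau, z), a1 = theta_10(2 tau, z) and eta quotients w1, w2, w3,
    the six functions are thus, up to constants, w1 a0 a1, w1 (a0^2 + a1^2), w3 a0 a1,
    w3 (a0^2 - a1^2), w2 a0^2 and w2 a1^2, and their span is stable under T and, by Poisson
    summation, under S.  Poisson summation itself comes from the finite Fourier transform of
    a periodized Gaussian, and the transformation of eta from its expression as a theta series.

    For [m2 = 0] and [m2 = 2] the difference of the supercharacters telescopes to
    - i w1 theta_01, of weight -1/2.  If its image under S were a combination of honest
    characters, all of which are periodic under tau -> tau + 48, then the weight factor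
    [Gauss], that is, sqrt(- i tau), would have period 48 too; homogeneity turns this into
    period 1 and contradicts the values at i - 1, i and i + 1. *)

(** No integral and no theorem on holomorphic functions enters; every limit is a dominated limit of
    sums over the integers. This is why [Gauss] is a quotient of theta constants and not a square
    root: besides the theta transformation that defines it, only [Gauss (- 1 / tau) * Gauss tau = 1]
    and homogeneity of degree 1/2 under positive real factors are used, both for the weight of eta
    and for the final contradiction.

    For s = 1/2 and s = 3/2 no product formula is established for either function alone. With X the
    variable in the denominator of a term, the two terms add up through [(1 + X) / (1 - X) = (1 -
    X^2) / (1 - X)^2], which is the shape of the denominator identity at equal arguments, and in
    their difference the denominator cancels.

    A count of weights separates the two halves of the theorem. The eta quotients have weight -1 and
    the quadratic forms in [a0], [a1] have weight 1, so no power of [Gauss] survives in the six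
    functions; in the difference of supercharacters a single theta function stands against [w1], and
    one [Gauss] remains. The number 48 is dictated by [eta (tau / 2)], since [e2pi (tau / 48)]
    occurs in it. *)

(** * The complex exponential *)

Lemma C_eq (a b : C) : Re a = Re b -> Im a = Im b -> a = b.
Proof. intros; apply injective_projections; assumption. Qed.

Lemma Cexp_plus (a b : C) : Cexp (a + b) = Cexp a * Cexp b.
Proof.
destruct a as [a1 a2], b as [b1 b2]; unfold Cexp; apply C_eq; cbn;
  rewrite exp_plus, ?cos_plus, ?sin_plus; ring.
Qed.

Lemma Cexp_0 : Cexp 0 = 1.
Proof. unfold Cexp; apply C_eq; cbn; rewrite exp_0, ?cos_0, ?sin_0; ring. Qed.

Lemma Cmod_Cexp (a : C) : Cmod (Cexp a) = exp (Re a).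
Proof.
unfold Cmod, Cexp; cbn [fst snd].
replace (_ + _)%R with (exp (Re a) ^ 2 * (Rsqr (sin (Im a)) + Rsqr (cos (Im a))))%R
  by (unfold Rsqr; ring).
rewrite sin2_cos2, Rmult_1_r, <- Rsqr_pow2, sqrt_Rsqr; [reflexivity |].
left; apply exp_pos.
Qed.

Lemma Cexp_neq0 (a : C) : Cexp a <> 0.
Proof. apply Cmod_gt_0; rewrite Cmod_Cexp; apply exp_pos. Qed.

Lemma Cexp_opp (a : C) : Cexp (- a) = / Cexp a.
Proof.
assert (H := Cexp_plus a (- a)); rewrite Cplus_opp_r, Cexp_0 in H.
replace (Cexp (- a)) with (/ Cexp a * (Cexp a * Cexp (- a)))
  by (field; apply Cexp_neq0).
rewrite <- H; field; apply Cexp_neq0.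
Qed.

Lemma e2pi_plus (a b : C) : e2pi (a + b) = e2pi a * e2pi b.
Proof. unfold e2pi; rewrite <- Cexp_plus; f_equal; ring. Qed.

Lemma e2pi_0 : e2pi 0 = 1.
Proof. unfold e2pi; rewrite <- Cexp_0; f_equal; ring. Qed.

Lemma e2pi_neq0 (a : C) : e2pi a <> 0.
Proof. apply Cexp_neq0. Qed.

Lemma e2pi_opp (a : C) : e2pi (- a) = / e2pi a.
Proof. unfold e2pi; rewrite <- Cexp_opp; f_equal; ring. Qed.

Lemma e2pi_minus (a b : C) : e2pi (a - b) = e2pi a / e2pi b.
Proof. unfold Cminus; rewrite e2pi_plus, e2pi_opp; reflexivity. Qed.

Lemma Cmod_e2pi (a : C) : Cmod (e2pi a) = exp (- (2 * PI * Im a)).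
Proof.
unfold e2pi; rewrite Cmod_Cexp; f_equal; destruct a; cbn; ring.
Qed.

Lemma e2pi_R (x : R) : e2pi x = (cos (2 * PI * x), sin (2 * PI * x)).
Proof.
unfold e2pi, Cexp; apply C_eq; cbn;
  replace (_ - _)%R with 0%R by ring; rewrite exp_0, Rmult_1_l; f_equal; ring.
Qed.

Lemma e2pi_1 : e2pi 1 = 1.
Proof.
rewrite e2pi_R, Rmult_1_r, cos_2PI, sin_2PI; reflexivity.
Qed.

Lemma e2pi_nat (n : nat) : e2pi (INR n) = 1.
Proof.
induction n as [|n IH]; [exact e2pi_0 |].
rewrite S_INR, RtoC_plus, e2pi_plus, IH, e2pi_1; ring.
Qed.

Lemma e2pi_Z (n : Z) : e2pi (IZR n) = 1.
Proof.
destruct n as [|p|p]; [exact e2pi_0 | |].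
- rewrite <- positive_nat_Z, <- INR_IZR_INZ; apply e2pi_nat.
- rewrite <- Pos2Z.opp_pos, opp_IZR, RtoC_opp, e2pi_opp, <- positive_nat_Z,
    <- INR_IZR_INZ, e2pi_nat; field.
Qed.

Lemma e2pi_half : e2pi (1 / 2) = - (1).
Proof.
replace (1 / 2) with (RtoC (1 / 2)) by (rewrite RtoC_div by lra; reflexivity).
rewrite e2pi_R; replace (2 * PI * (1 / 2))%R with PI by field.
rewrite cos_PI, sin_PI; apply C_eq; cbn; ring.
Qed.

Lemma e2pi_quarter : e2pi (1 / 4) = Ci.
Proof.
replace (1 / 4) with (RtoC (1 / 4)) by (rewrite RtoC_div by lra; reflexivity).
rewrite e2pi_R; replace (2 * PI * (1 / 4))%R with (PI / 2)%R by field.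
rewrite cos_PI2, sin_PI2; reflexivity.
Qed.

(** The modulus forces [w] to be real. For the fractional part [f] of [w], [cos (2 pi f) = 1] means
    [sin (pi f) = 0], which is impossible for [0 < f < 1]. *)
Lemma e2pi_eq1 (w : C) : e2pi w = 1 -> exists k : Z, w = IZR k.
Proof.
intros H.
assert (HI : Im w = 0%R).
{ assert (Hm := f_equal Cmod H); rewrite Cmod_e2pi, Cmod_1, <- exp_0 in Hm.
  apply exp_inv in Hm.
  assert (Hp := PI_RGT_0); apply (Rmult_eq_reg_l (2 * PI)); lra. }
assert (Hw : w = Re w) by (apply C_eq; cbn; auto).
set (x := Re w) in *; exists (Int_part x).
assert (Hb := base_fp x).
assert (Hx : (x = IZR (Int_part x) + frac_part x)%R) by (unfold frac_part; ring).
set (f := frac_part x) in *; set (k := Int_part x) in *.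
assert (Hf : e2pi f = 1).
{ rewrite <- H, Hw, Hx, RtoC_plus, e2pi_plus, e2pi_Z; ring. }
rewrite e2pi_R in Hf; apply (f_equal Re) in Hf; cbn in Hf.
replace (2 * PI * f)%R with (2 * (PI * f))%R in Hf by ring.
rewrite cos_2a_sin in Hf.
assert (Hp := PI_RGT_0).
destruct (Req_dec f 0) as [E | E].
- rewrite Hw, Hx, E; f_equal; ring.
- assert (0 < sin (PI * f))%R by (apply sin_gt_0; nra).
  nra.
Qed.

(** * Bounds for the exponential *)

Lemma exp_sub1_bound (x : R) : (Rabs (exp x - 1) <= Rabs x * exp (Rabs x))%R.
Proof.
assert (H1 : forall t, (0 <= t -> Rabs (exp t - 1) <= Rabs t * exp (Rabs t))%R).
{ intros t Ht; assert (H := exp_ineq1_le (- t)); rewrite exp_Ropp in H.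
  assert (Hp := exp_pos t).
  assert (exp t * / exp t = 1)%R by (field; lra).
  assert (H2 := exp_ineq1_le t).
  rewrite !Rabs_pos_eq by lra; nra. }
destruct (Rle_or_lt 0 x) as [Hx | Hx]; [auto |].
assert (H2 := exp_ineq1_le x).
assert (exp x < 1)%R by (rewrite <- exp_0; apply exp_increasing; lra).
rewrite !(Rabs_left x) by lra; rewrite Rabs_left by lra.
assert (H3 := exp_ineq1_le (- x)); nra.
Qed.

Lemma exp_taylor2 (x : R) : (Rabs (exp x - 1 - x) <= x ^ 2 * exp (Rabs x))%R.
Proof.
assert (Hm : exists c, ((exp x - 1 - x = (exp c - 1) * x) /\ Rabs c <= Rabs x)%R).
{ destruct (MVT_gen (fun t => exp t - t)%R 0 x (fun t => exp t - 1)%R) as [c [Hc E]].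
  - intros; auto_derive; [exact I | ring].
  - intros; apply continuity_pt_minus;
    [apply derivable_continuous_pt, derivable_pt_exp | apply derivable_continuous_pt, derivable_pt_id].
  - exists c; rewrite exp_0 in E; split; [lra |].
    unfold Rmin, Rmax in Hc; destruct (Rle_dec 0 x);
    unfold Rabs; destruct (Rcase_abs c), (Rcase_abs x); lra. }
destruct Hm as [c [E Hc]]; rewrite E, Rabs_mult.
assert (H := exp_sub1_bound c).
assert (exp (Rabs c) <= exp (Rabs x))%R
  by (destruct Hc as [Hc | Hc]; [left; apply exp_increasing, Hc | rewrite Hc; lra]).
assert (Hp := exp_pos (Rabs c)).
rewrite <- (pow2_abs x).
assert (0 <= Rabs c)%R by apply Rabs_pos.
assert (Rabs c * exp (Rabs c) <= Rabs x * exp (Rabs x))%R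
  by (apply Rmult_le_compat; lra).
replace (Rabs x ^ 2 * exp (Rabs x))%R with ((Rabs x * exp (Rabs x)) * Rabs x)%R by ring.
apply Rmult_le_compat_r; [apply Rabs_pos | lra].
Qed.

Lemma sin_abs_le (x : R) : (Rabs (sin x) <= Rabs x)%R.
Proof.
destruct (MVT_gen sin 0 x cos) as [c [_ E]].
- intros; apply is_derive_Reals, derivable_pt_lim_sin.
- intros; apply continuity_sin.
- rewrite sin_0, !Rminus_0_r in E; rewrite E, Rabs_mult.
  assert (H := COS_bound c).
  assert (Rabs (cos c) <= 1)%R by (apply Rabs_le; lra).
  assert (0 <= Rabs x)%R by apply Rabs_pos; nra.
Qed.

Lemma cos_sub1_bound (x : R) : (Rabs (cos x - 1) <= x ^ 2)%R.
Proof.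
replace x with (2 * (x / 2))%R at 1 by field; rewrite cos_2a_sin.
replace (1 - 2 * sin (x / 2) * sin (x / 2) - 1)%R with (- (2 * sin (x / 2) ^ 2))%R by ring.
rewrite Rabs_Ropp, Rabs_mult, (Rabs_pos_eq 2), (Rabs_pos_eq (_ ^ 2)) by (try lra; apply pow2_ge_0).
assert (H := sin_abs_le (x / 2)).
rewrite <- (pow2_abs (sin _)).
assert (Rabs (sin (x / 2)) ^ 2 <= Rabs (x / 2) ^ 2)%R
  by (apply pow_incr; split; [apply Rabs_pos | exact H]).
rewrite (pow2_abs (x / 2)) in *; nra.
Qed.

Lemma sin_sub_bound (x : R) : (Rabs (sin x - x) <= x ^ 2)%R.
Proof.
destruct (MVT_gen (fun t => sin t - t)%R 0 x (fun t => cos t - 1)%R) as [c [Hc E]].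
- intros; auto_derive; [exact I | ring].
- intros; apply continuity_pt_minus; [apply continuity_sin | apply derivable_continuous_pt, derivable_pt_id].
- rewrite sin_0, !Rminus_0_r in E; rewrite E, Rabs_mult.
  replace (cos c - 1)%R with (- 2 * sin (c / 2) * sin (c / 2))%R
    by (replace c with (2 * (c / 2))%R at 3 by field; rewrite cos_2a_sin; ring).
  rewrite !Rabs_mult.
  replace (Rabs (-2)) with 2%R by (rewrite Rabs_left; lra).
  assert (H := sin_abs_le (c / 2)).
  assert (Rabs (sin (c / 2)) <= 1)%R by (apply Rabs_le; assert (h := SIN_bound (c / 2)); lra).
  assert (H1 : (Rabs (c / 2) = Rabs c / 2)%R)
    by (unfold Rdiv; rewrite Rabs_mult, (Rabs_pos_eq (/ 2)) by lra; reflexivity).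
  assert (Rabs c <= Rabs x)%R.
  { unfold Rmin, Rmax in Hc; destruct (Rle_dec 0 x);
    unfold Rabs; destruct (Rcase_abs c), (Rcase_abs x); lra. }
  rewrite <- (pow2_abs x).
  assert (0 <= Rabs (sin (c / 2)))%R by apply Rabs_pos.
  assert (0 <= Rabs x)%R by apply Rabs_pos.
  replace (Rabs x ^ 2)%R with (Rabs x * Rabs x)%R by ring.
  apply Rmult_le_compat_r; [assumption |]; nra.
Qed.

Lemma Cmod_le_ReIm (a : C) : (Cmod a <= Rabs (Re a) + Rabs (Im a))%R.
Proof.
destruct a as [x y]; replace (x, y) with (RtoC x + Ci * RtoC y) by (apply C_eq; cbn; ring).
eapply Rle_trans; [apply Cmod_triangle |].
rewrite Cmod_mult, Cmod_Ci, !Cmod_R; cbn.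
replace (x + (0 * y - 1 * 0))%R with x by ring.
replace (0 + (0 * 0 + 1 * y))%R with y by ring.
lra.
Qed.

Lemma im_le_Cmod (a : C) : (Rabs (Im a) <= Cmod a)%R.
Proof. eapply Rle_trans; [| apply Rmax_Cmod]; apply Rmax_r. Qed.

Lemma exp_le (x y : R) : (x <= y)%R -> (exp x <= exp y)%R.
Proof.
intros [H | H]; [left; apply exp_increasing, H | rewrite H; apply Rle_refl].
Qed.

(** The bound holds for all [w], not only small ones: the growth [exp (Cmod w)] is later absorbed by
    Gaussian decay, so the remainder can be summed over all integers. *)
Lemma Cexp_taylor2 (w : C) :
  (Cmod (Cexp w - 1 - w) <= 5 * Cmod w ^ 2 * exp (Cmod w))%R.
Proof.
eapply Rle_trans; [apply Cmod_le_ReIm |].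
destruct w as [x y]; set (r := Cmod (x, y)).
assert (Hx : (Rabs x <= r)%R) by apply (re_le_Cmod (x, y)).
assert (Hy : (Rabs y <= r)%R) by apply (im_le_Cmod (x, y)).
assert (Hr : (0 <= r)%R) by apply Cmod_ge_0.
assert (He : (1 <= exp r)%R) by (assert (h := exp_ineq1_le r); lra).
assert (Hex : (exp x <= exp r)%R)
  by (apply exp_le; eapply Rle_trans; [apply Rle_abs | exact Hx]).
assert (Hexa : (exp (Rabs x) <= exp r)%R) by (apply exp_le, Hx).
assert (H1 := exp_taylor2 x). assert (H2 := cos_sub1_bound y).
assert (H3 := sin_sub_bound y). assert (H4 := exp_sub1_bound x).
assert (Hx2 : (x ^ 2 <= r ^ 2)%R)
  by (rewrite <- (pow2_abs x); apply pow_incr; split; [apply Rabs_pos | exact Hx]).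
assert (Hy2 : (y ^ 2 <= r ^ 2)%R)
  by (rewrite <- (pow2_abs y); apply pow_incr; split; [apply Rabs_pos | exact Hy]).
assert (Hp := exp_pos x). assert (Hpa := exp_pos (Rabs x)).
assert (Hx0 := pow2_ge_0 x). assert (Hy0 := pow2_ge_0 y).
assert (A1 : (Rabs (exp x * (cos y - 1)) <= r ^ 2 * exp r)%R).
{ rewrite Rabs_mult, (Rabs_pos_eq (exp x)), Rmult_comm by lra.
  apply Rmult_le_compat; try lra; apply Rabs_pos. }
assert (A2 : (Rabs (exp x * (sin y - y)) <= r ^ 2 * exp r)%R).
{ rewrite Rabs_mult, (Rabs_pos_eq (exp x)), Rmult_comm by lra.
  apply Rmult_le_compat; try lra; apply Rabs_pos. }
assert (A3 : (Rabs ((exp x - 1) * y) <= r ^ 2 * exp r)%R).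
{ rewrite Rabs_mult.
  replace (r ^ 2 * exp r)%R with ((r * exp r) * r)%R by ring.
  apply Rmult_le_compat; try apply Rabs_pos; [| exact Hy].
  eapply Rle_trans; [exact H4 |].
  apply Rmult_le_compat; try lra; apply Rabs_pos. }
assert (A4 : (Rabs (exp x - 1 - x) <= r ^ 2 * exp r)%R).
{ eapply Rle_trans; [exact H1 |]; apply Rmult_le_compat; lra. }
unfold Cexp; cbn.
replace (exp x * cos y + - (1) + - x)%R with ((exp x - 1 - x) + exp x * (cos y - 1))%R by ring.
replace (exp x * sin y + - 0 + - y)%R with (exp x * (sin y - y) + (exp x - 1) * y)%R by ring.
assert (B1 := Rabs_triang (exp x - 1 - x) (exp x * (cos y - 1))).
assert (B2 := Rabs_triang (exp x * (sin y - y)) ((exp x - 1) * y)).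
assert (0 <= r ^ 2 * exp r)%R by (apply Rmult_le_pos; [apply pow2_ge_0 | lra]).
nra.
Qed.

(** * Convergence of complex sequences *)

(** Convergence is stated through a real sequence tending to 0, so that the squeeze theorem for real
    limits applies directly. [CLim_seq_unique] and [CSeries_cv] connect it with the componentwise
    limits and sums of the definitions. *)
Definition Ccv (u : nat -> C) (l : C) : Prop :=
  is_lim_seq (fun n => Cmod (u n - l)) 0%R.

Lemma Ccv_squeeze (u : nat -> C) (l : C) (v : nat -> R) :
  (forall n, Cmod (u n - l) <= v n)%R -> is_lim_seq v 0%R -> Ccv u l.
Proof.
intros H Hv; apply is_lim_seq_le_le with (fun _ => 0%R) v; auto.
- intros n; split; [apply Cmod_ge_0 | apply H].
- apply is_lim_seq_const.
Qed.

Lemma Ccv_const (l : C) : Ccv (fun _ => l) l.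
Proof.
apply Ccv_squeeze with (fun _ => 0%R); [| apply is_lim_seq_const].
intros _; replace (l - l) with (RtoC 0) by ring; rewrite Cmod_0; lra.
Qed.

Lemma Ccv_ext (u v : nat -> C) (l : C) :
  (forall n, u n = v n) -> Ccv u l -> Ccv v l.
Proof. intros H; apply is_lim_seq_ext; intros n; rewrite H; reflexivity. Qed.

Lemma Ccv_ext_loc (u v : nat -> C) (l : C) (N0 : nat) :
  (forall n, (N0 <= n)%nat -> u n = v n) -> Ccv u l -> Ccv v l.
Proof.
intros H; apply is_lim_seq_ext_loc; exists N0; intros n Hn.
rewrite H; [reflexivity | exact Hn].
Qed.

Lemma Ccv_eps (u : nat -> C) (l : C) : Ccv u l <->
  forall eps : R, (0 < eps)%R ->
  exists N, forall n, (N <= n)%nat -> (Cmod (u n - l) < eps)%R.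
Proof.
unfold Ccv; rewrite <- is_lim_seq_spec; cbn; split; intros H eps.
- intros He; destruct (H (mkposreal eps He)) as [N HN]; exists N; intros n Hn.
  specialize (HN n Hn); cbn in HN.
  rewrite Rminus_0_r, Rabs_pos_eq in HN by apply Cmod_ge_0; exact HN.
- destruct (H eps (cond_pos eps)) as [N HN]; exists N; intros n Hn.
  rewrite Rminus_0_r, Rabs_pos_eq by apply Cmod_ge_0; auto.
Qed.

Lemma Ccv_plus (u v : nat -> C) (l m : C) :
  Ccv u l -> Ccv v m -> Ccv (fun n => u n + v n) (l + m).
Proof.
intros Hu Hv.
apply Ccv_squeeze with (fun n => Cmod (u n - l) + Cmod (v n - m))%R.
- intros n; replace (u n + v n - (l + m)) with ((u n - l) + (v n - m)) by ring.
  apply Cmod_triangle.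
- replace (Finite 0) with (Finite (0 + 0)) by (f_equal; ring).
  apply is_lim_seq_plus'; assumption.
Qed.

Lemma Ccv_mult (u v : nat -> C) (l m : C) :
  Ccv u l -> Ccv v m -> Ccv (fun n => u n * v n) (l * m).
Proof.
intros Hu Hv.
apply Ccv_squeeze with (fun n => Cmod (u n - l) * Cmod (v n - m)
  + Cmod (u n - l) * Cmod m + Cmod l * Cmod (v n - m))%R.
- intros n; replace (u n * v n - l * m) with
    ((u n - l) * (v n - m) + (u n - l) * m + l * (v n - m)) by ring.
  eapply Rle_trans; [apply Cmod_triangle |].
  rewrite !Cmod_mult; apply Rplus_le_compat_r.
  eapply Rle_trans; [apply Cmod_triangle |]; rewrite !Cmod_mult; lra.
- replace (Finite 0) with (Finite (0 * 0 + 0 * Cmod m + Cmod l * 0)) by (f_equal; ring).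
  repeat apply is_lim_seq_plus'; apply is_lim_seq_mult'; auto using is_lim_seq_const.
Qed.

Lemma Ccv_scal (c : C) (u : nat -> C) (l : C) :
  Ccv u l -> Ccv (fun n => c * u n) (c * l).
Proof. intros H; apply Ccv_mult; [apply Ccv_const | exact H]. Qed.

Lemma Ccv_minus (u v : nat -> C) (l m : C) :
  Ccv u l -> Ccv v m -> Ccv (fun n => u n - v n) (l - m).
Proof.
intros Hu Hv; apply Ccv_ext with (fun n => u n + (- (1)) * v n); [intros; ring |].
replace (l - m) with (l + (- (1)) * m) by ring.
apply Ccv_plus, Ccv_scal; assumption.
Qed.

Lemma Ccv_unique (u : nat -> C) (l m : C) : Ccv u l -> Ccv u m -> l = m.
Proof.
intros Hl Hm; assert (H := Ccv_minus _ _ _ _ Hl Hm).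
assert (H0 : is_lim_seq (fun _ : nat => Cmod (l - m)) 0%R).
{ eapply is_lim_seq_ext; [| exact H]; intros n; cbn.
  rewrite <- Cmod_opp; f_equal; ring. }
assert (E := is_lim_seq_unique _ _ H0); rewrite Lim_seq_const in E.
injection E; intros E'; apply Cmod_eq_0 in E'.
replace l with (m + (l - m)) by ring; rewrite E'; ring.
Qed.

Lemma Ccv_Cmod (u : nat -> C) (l : C) : Ccv u l -> is_lim_seq (fun n => Cmod (u n)) (Cmod l).
Proof.
intros H; apply is_lim_seq_le_le with
  (fun n => Cmod l - Cmod (u n - l))%R (fun n => Cmod l + Cmod (u n - l))%R.
- intros n; split.
  + assert (h := Cmod_triangle (u n) (- (u n - l))); rewrite Cmod_opp in h.
    replace (u n + - (u n - l)) with l in h by ring; lra.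
  + replace (u n) with (l + (u n - l)) at 1 by ring; apply Cmod_triangle.
- replace (Finite (Cmod l)) with (Finite (Cmod l - 0)) by (f_equal; ring).
  apply is_lim_seq_minus'; [apply is_lim_seq_const | exact H].
- replace (Finite (Cmod l)) with (Finite (Cmod l + 0)) by (f_equal; ring).
  apply is_lim_seq_plus'; [apply is_lim_seq_const | exact H].
Qed.

Lemma Ccv_inv (u : nat -> C) (l : C) :
  l <> 0 -> Ccv u l -> Ccv (fun n => / u n) (/ l).
Proof.
intros Hl H; assert (Hp : (0 < Cmod l)%R) by (apply Cmod_gt_0, Hl).
apply Ccv_eps; intros eps He.
destruct (proj1 (Ccv_eps u l) H (Rmin (Cmod l / 2) (eps * (Cmod l * Cmod l / 2)))) as [N HN].
{ apply Rmin_glb_lt; [lra |]; repeat apply Rmult_lt_0_compat; lra. }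
exists N; intros n Hn; specialize (HN n Hn).
assert (H1 := Rmin_l (Cmod l / 2) (eps * (Cmod l * Cmod l / 2))).
assert (H2 := Rmin_r (Cmod l / 2) (eps * (Cmod l * Cmod l / 2))).
assert (h := Cmod_triangle (u n) (- (u n - l))); rewrite Cmod_opp in h.
replace (u n + - (u n - l)) with l in h by ring.
assert (Hu : u n <> 0) by (apply Cmod_gt_0; lra).
replace (/ u n - / l) with (- (u n - l) / (u n * l)) by (field; auto).
rewrite Cmod_div, Cmod_opp, Cmod_mult by (apply Cmult_neq_0; auto).
apply Rmult_lt_reg_r with (Cmod (u n) * Cmod l)%R; [apply Rmult_lt_0_compat; lra |].
unfold Rdiv; rewrite Rmult_assoc, Rinv_l, Rmult_1_r by (apply Rgt_not_eq, Rmult_lt_0_compat; lra).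
eapply Rlt_le_trans; [exact HN |]; eapply Rle_trans; [exact H2 |].
apply Rmult_le_compat_l; [lra |]; nra.
Qed.

Lemma Ccv_subseq (u : nat -> C) (l : C) (phi : nat -> nat) :
  (forall n, (n <= phi n)%nat) -> Ccv u l -> Ccv (fun n => u (phi n)) l.
Proof.
intros Hphi H; rewrite Ccv_eps in *; intros eps He.
destruct (H eps He) as [N HN]; exists N; intros n Hn; apply HN.
specialize (Hphi n); lia.
Qed.

Lemma Ccv_bounded (u : nat -> C) (l : C) (B : R) (N0 : nat) :
  (forall n, (N0 <= n)%nat -> (Cmod (u n) <= B)%R) -> Ccv u l -> (Cmod l <= B)%R.
Proof.
intros H Hu; apply Ccv_Cmod in Hu.
apply (is_lim_seq_le_loc (fun n => Cmod (u n)) (fun _ => B) (Cmod l) B);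
  [exists N0; auto | exact Hu | apply is_lim_seq_const].
Qed.

Lemma lim_inv_succ (K : R) : is_lim_seq (fun n => (K / (INR n + 1))%R) 0%R.
Proof.
replace (Finite 0) with (Rbar_mult K 0%R) by (cbn; f_equal; ring).
apply is_lim_seq_scal_l.
replace (Finite 0) with (Rbar_inv p_infty) by reflexivity.
apply is_lim_seq_inv; [| discriminate].
apply is_lim_seq_ext with (fun n => INR (S n)); [intros n; apply S_INR |].
apply (is_lim_seq_incr_1 INR), is_lim_seq_INR.
Qed.

(** * Finite sums *)

Fixpoint csum (f : nat -> C) (n : nat) : C :=
  match n with
  | O => 0
  | S k => csum f k + f k
  end.

Lemma csum_ext (f g : nat -> C) (n : nat) :
  (forall k, (k < n)%nat -> f k = g k) -> csum f n = csum g n.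
Proof.
induction n as [|n IH]; intros H; [reflexivity |]; cbn; rewrite IH, H; auto.
Qed.

Lemma csum_plus (f g : nat -> C) (n : nat) :
  csum (fun k => f k + g k) n = csum f n + csum g n.
Proof. induction n as [|n IH]; cbn; [ring | rewrite IH; ring]. Qed.

Lemma csum_scal (c : C) (f : nat -> C) (n : nat) :
  csum (fun k => c * f k) n = c * csum f n.
Proof. induction n as [|n IH]; cbn; [ring | rewrite IH; ring]. Qed.

Lemma csum_S_l (f : nat -> C) (n : nat) :
  csum f (S n) = f O + csum (fun k => f (S k)) n.
Proof.
induction n as [|n IH]; [cbn; ring |].
change (csum f (S (S n))) with (csum f (S n) + f (S n)); rewrite IH; cbn; ring.
Qed.

Lemma csum_rev (f : nat -> C) (n : nat) :
  csum f n = csum (fun k => f (n - S k)%nat) n.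
Proof.
induction n as [|n IH]; [reflexivity |].
rewrite (csum_S_l (fun k => f (S n - S k)%nat)); cbn [csum]; rewrite IH.
replace (S n - 1)%nat with n by lia; rewrite Cplus_comm.
f_equal; apply csum_ext; intros k Hk; f_equal; lia.
Qed.

Lemma csum_Cmod (f : nat -> C) (B : R) (n : nat) :
  (forall k, (k < n)%nat -> Cmod (f k) <= B)%R -> (Cmod (csum f n) <= INR n * B)%R.
Proof.
induction n as [|n IH]; intros H; [cbn; rewrite Cmod_0; lra |].
rewrite S_INR; cbn [csum]; eapply Rle_trans; [apply Cmod_triangle |].
assert (Cmod (csum f n) <= INR n * B)%R by auto.
assert (Cmod (f n) <= B)%R by auto; lra.
Qed.

Lemma csum_exchange (f : nat -> nat -> C) (n m : nat) :
  csum (fun i => csum (f i) m) n = csum (fun j => csum (fun i => f i j) n) m.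
Proof.
induction n as [|n IH]; cbn.
- induction m as [|m IH]; cbn; [reflexivity | rewrite <- IH; ring].
- rewrite IH, <- csum_plus; reflexivity.
Qed.

(** * Bilateral sums *)

(* The sum of [u n] over [-N <= n < N]. *)
Fixpoint psum (N : nat) (u : Z -> C) : C :=
  match N with
  | O => 0
  | S k => psum k u + (u (Z.of_nat k) + u (- Z.of_nat (S k))%Z)
  end.

(** One class of majorants serves for all bilateral series below: it is kept by linear combinations,
    shifts, reflection and passage to arithmetic progressions, its tails are explicit, and Gaussian
    terms belong to it. *)
Definition bd (K : R) (u : Z -> C) : Prop :=
  forall n, (Cmod (u n) <= K / (1 + IZR n ^ 2))%R.

Lemma psum_ext (N : nat) (u v : Z -> C) :
  (forall n, (- Z.of_nat N <= n < Z.of_nat N)%Z -> u n = v n) -> psum N u = psum N v.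
Proof.
induction N as [|N IH]; intros H; [reflexivity |].
cbn [psum]; rewrite IH, !H; [reflexivity | lia | lia | intros; apply H; lia].
Qed.

Lemma psum_plus (N : nat) (u v : Z -> C) :
  psum N (fun n => u n + v n) = psum N u + psum N v.
Proof. induction N as [|N IH]; cbn [psum]; [ring | rewrite IH; ring]. Qed.

Lemma psum_scal (c : C) (N : nat) (u : Z -> C) :
  psum N (fun n => c * u n) = c * psum N u.
Proof. induction N as [|N IH]; cbn [psum]; [ring | rewrite IH; ring]. Qed.

Lemma psum_csum (N : nat) (u : Z -> C) :
  psum N u = csum (fun k => u (Z.of_nat k - Z.of_nat N)%Z) (2 * N).
Proof.
induction N as [|N IH]; [reflexivity |].
replace (2 * S N)%nat with (S (S (2 * N))) by lia.
rewrite csum_S_l; cbn [csum psum].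
rewrite IH, (csum_ext (fun k => u (Z.of_nat (S k) - Z.of_nat (S N))%Z) (fun k => u (Z.of_nat k - Z.of_nat N)%Z) (2 * N)).
- replace (Z.of_nat (S (2 * N)) - Z.of_nat (S N))%Z with (Z.of_nat N) by lia.
  replace (Z.of_nat 0 - Z.of_nat (S N))%Z with (- Z.of_nat (S N))%Z by lia; ring.
- intros; f_equal; lia.
Qed.

Lemma psum_add (A m : nat) (u : Z -> C) :
  psum (A + m) u = psum A u + csum (fun i => u (Z.of_nat (A + i))) m
    + csum (fun i => u (- Z.of_nat (S (A + i)))%Z) m.
Proof.
induction m as [|m IH]; [rewrite Nat.add_0_r; cbn; ring |].
rewrite Nat.add_succ_r; cbn [psum csum]; rewrite IH; ring.
Qed.

Lemma bound_pos (K : R) (u : Z -> C) (n : Z) :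
  (Cmod (u n) <= K / (1 + IZR n ^ 2))%R -> (0 <= K)%R.
Proof.
intros H; assert (h := Cmod_ge_0 (u n)).
assert (0 <= IZR n ^ 2)%R by apply pow2_ge_0.
destruct (Rle_or_lt 0 K) as [|Hk]; [assumption | exfalso].
assert (K / (1 + IZR n ^ 2) < 0)%R; [| lra].
apply Ropp_lt_cancel; rewrite Ropp_0; unfold Rdiv; rewrite Ropp_mult_distr_l.
apply Rmult_lt_0_compat; [lra | apply Rinv_0_lt_compat; lra].
Qed.

Lemma bd_pos (K : R) (u : Z -> C) : bd K u -> (0 <= K)%R.
Proof. intros H; exact (bound_pos K u 0 (H 0%Z)). Qed.

(** The right side is [3 K / ((x + 1) (x + 2))], and [3 (1 + x^2) - (x + 1) (x + 2) = (2 x - 1) (x -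
    1)]. This is negative between 1/2 and 1, which explains the condition on [x]; natural numbers
    satisfy it. *)
Lemma inv_sq_telescope (K x : R) : (0 <= K)%R -> (x = 0 \/ 1 <= x)%R ->
  (K / (1 + x ^ 2) <= 3 * K / (x + 1) - 3 * K / (x + 1 + 1))%R.
Proof.
intros HK Hx.
replace (3 * K / (x + 1) - 3 * K / (x + 1 + 1))%R
  with (K * (3 / ((x + 1) * (x + 1 + 1))))%R by (field; lra).
unfold Rdiv at 1; apply Rmult_le_compat_l; [exact HK |].
assert (0 < (x + 1) * (x + 1 + 1))%R by (apply Rmult_lt_0_compat; lra).
apply Rmult_le_reg_r with ((1 + x ^ 2) * ((x + 1) * (x + 1 + 1)))%R; [nra |].
replace (/ (1 + x ^ 2) * ((1 + x ^ 2) * ((x + 1) * (x + 1 + 1))))%R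
  with ((x + 1) * (x + 1 + 1))%R by (field; nra).
replace (3 / ((x + 1) * (x + 1 + 1)) * ((1 + x ^ 2) * ((x + 1) * (x + 1 + 1))))%R
  with (3 * (1 + x ^ 2))%R by (field; lra).
nra.
Qed.

(** Each of the two half tails telescopes, whence 6 = 2 x 3. The bound on [u] is required only
    inside the window of length [N], so that the lemma applies to truncations whose terms depend on
    [N]. *)
Lemma psum_tail (K : R) (u : Z -> C) (M N : nat) : (M <= N)%nat ->
  (forall n, (- Z.of_nat N <= n < Z.of_nat N)%Z -> Cmod (u n) <= K / (1 + IZR n ^ 2))%R ->
  (Cmod (psum N u - psum M u) <= 6 * K / (INR M + 1) - 6 * K / (INR N + 1))%R.
Proof.
intros HMN; induction HMN as [|N HMN IH]; intros H.
- replace (psum M u - psum M u) with (RtoC 0) by ring; rewrite Cmod_0; lra.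
- assert (HK : (0 <= K)%R) by (apply (bound_pos K u 0), H; lia).
  cbn [psum].
  replace (psum N u + (u (Z.of_nat N) + u (- Z.of_nat (S N))%Z) - psum M u)
    with ((psum N u - psum M u) + (u (Z.of_nat N) + u (- Z.of_nat (S N))%Z)) by ring.
  eapply Rle_trans; [apply Cmod_triangle |].
  assert (IH' := IH (fun n h => H n ltac:(lia))).
  assert (H1 := H (Z.of_nat N) ltac:(lia)).
  assert (H2 := H (- Z.of_nat (S N))%Z ltac:(lia)).
  rewrite opp_IZR in H2; rewrite <- !INR_IZR_INZ in *.
  assert (H3 := Cmod_triangle (u (Z.of_nat N)) (u (- Z.of_nat (S N))%Z)).
  rewrite S_INR in *.
  assert (Hx : (INR N = 0 \/ 1 <= INR N)%R).
  { destruct N; [left; reflexivity | right; rewrite S_INR; assert (h := pos_INR N); lra]. }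
  assert (H4 := inv_sq_telescope K (INR N) HK Hx).
  assert (H5 : (K / (1 + (- (INR N + 1)) ^ 2) <= K / (1 + INR N ^ 2))%R).
  { unfold Rdiv; apply Rmult_le_compat_l; [exact HK |].
    assert (h := pos_INR N); apply Rinv_le_contravar; nra. }
  replace (6 * K / (INR M + 1))%R with (2 * (3 * K / (INR M + 1)))%R in *
    by (assert (h := pos_INR M); field; lra).
  replace (6 * K / (INR N + 1))%R with (2 * (3 * K / (INR N + 1)))%R in *
    by (assert (h := pos_INR N); field; lra).
  replace (6 * K / (INR N + 1 + 1))%R with (2 * (3 * K / (INR N + 1 + 1)))%R in *
    by (assert (h := pos_INR N); field; lra).
  lra.
Qed.

Lemma div_pos_nonneg (K : R) (n : nat) : (0 <= K)%R -> (0 <= K / (INR n + 1))%R.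
Proof.
intros; apply Rmult_le_pos; [assumption |].
left; apply Rinv_0_lt_compat; assert (h := pos_INR n); lra.
Qed.

Lemma psum_tail_le (K : R) (u : Z -> C) (M N : nat) : (M <= N)%nat -> (0 <= K)%R ->
  (forall n, (- Z.of_nat N <= n < Z.of_nat N)%Z -> Cmod (u n) <= K / (1 + IZR n ^ 2))%R ->
  (Cmod (psum N u - psum M u) <= 6 * K / (INR M + 1))%R.
Proof.
intros HMN HK H; eapply Rle_trans; [apply (psum_tail K u M N); assumption |].
assert (h := div_pos_nonneg (6 * K) N ltac:(lra)); lra.
Qed.

Lemma psum_bound (K : R) (u : Z -> C) (N : nat) : bd K u -> (Cmod (psum N u) <= 6 * K)%R.
Proof.
intros H; assert (HK := bd_pos _ _ H).
replace (psum N u) with (psum N u - psum 0 u) by (cbn; ring).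
eapply Rle_trans; [apply (psum_tail_le K u 0 N); auto; lia | cbn; lra].
Qed.

Lemma csum_Re_Im (f : nat -> C) (n : nat) :
  Re (csum f (S n)) = sum_n (fun k => Re (f k)) n /\
  Im (csum f (S n)) = sum_n (fun k => Im (f k)) n.
Proof.
induction n as [|n [IH1 IH2]].
- rewrite !sum_O; cbn [csum]; rewrite Cplus_0_l; split; reflexivity.
- rewrite !sum_Sn, <- IH1, <- IH2; split; reflexivity.
Qed.

Lemma ex_series_inv_sq (K : R) : (0 <= K)%R ->
  ex_series (fun n => 3 * K / (INR n + 1) - 3 * K / (INR n + 1 + 1))%R.
Proof.
intros HK; exists (3 * K)%R.
change (is_lim_seq (sum_n (fun n => 3 * K / (INR n + 1) - 3 * K / (INR n + 1 + 1))%R) (3 * K)%R).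
apply is_lim_seq_ext with (fun n => 3 * K - 3 * K / (INR (S n) + 1))%R.
- intros n; induction n as [|n IH].
  + rewrite sum_O; cbn; field.
  + rewrite sum_Sn, <- IH; unfold plus; cbn -[INR]; rewrite !S_INR; ring.
- replace (Finite (3 * K)) with (Finite (3 * K - 0)) by (f_equal; ring).
  apply is_lim_seq_minus'; [apply is_lim_seq_const |].
  apply (is_lim_seq_incr_1 (fun n => 3 * K / (INR n + 1))%R), lim_inv_succ.
Qed.

Lemma CSeries_cv (f : nat -> C) (K : R) :
  (forall n, Cmod (f n) <= K / (1 + INR n ^ 2))%R -> Ccv (fun n => csum f n) (CSeries f).
Proof.
intros H.
assert (HK : (0 <= K)%R).
{ assert (h := H O); assert (h' := Cmod_ge_0 (f O)); cbn in h.
  replace (1 + 0 * (0 * 1))%R with 1%R in h by ring; lra. }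
assert (Hb : forall n, (Cmod (f n) <= 3 * K / (INR n + 1) - 3 * K / (INR n + 1 + 1))%R).
{ intros n; eapply Rle_trans; [apply H |]; apply inv_sq_telescope; [exact HK |].
  destruct n; [left; reflexivity | right; rewrite S_INR; assert (h := pos_INR n); lra]. }
assert (E1 : ex_series (fun n => Re (f n))).
{ apply (ex_series_le (K := R_AbsRing) (V := R_CompleteNormedModule) _ _
    (fun n => Rle_trans _ _ _ (re_le_Cmod (f n)) (Hb n))), ex_series_inv_sq, HK. }
assert (E2 : ex_series (fun n => Im (f n))).
{ apply (ex_series_le (K := R_AbsRing) (V := R_CompleteNormedModule) _ _
    (fun n => Rle_trans _ _ _ (im_le_Cmod (f n)) (Hb n))), ex_series_inv_sq, HK. }
apply Series_correct in E1, E2.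
change (is_lim_seq (sum_n (fun n => Re (f n))) (Series (fun n => Re (f n)))) in E1.
change (is_lim_seq (sum_n (fun n => Im (f n))) (Series (fun n => Im (f n)))) in E2.
unfold Ccv; apply is_lim_seq_incr_1.
apply is_lim_seq_le_le with (fun _ => 0%R) (fun n =>
  Rabs (sum_n (fun n => Re (f n)) n - Series (fun n => Re (f n)))
  + Rabs (sum_n (fun n => Im (f n)) n - Series (fun n => Im (f n))))%R.
- intros n; split; [apply Cmod_ge_0 |].
  eapply Rle_trans; [apply Cmod_le_ReIm |].
  destruct (csum_Re_Im f n) as [A B]; rewrite <- A, <- B; apply Rle_refl.
- apply is_lim_seq_const.
- replace (Finite 0) with (Finite (0 + 0)) by (f_equal; ring).
  apply is_lim_seq_plus'; apply -> is_lim_seq_abs_0.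
  + replace (Finite 0) with (Finite (Series (fun n => Re (f n)) - Series (fun n => Re (f n))))
      by (f_equal; ring).
    apply is_lim_seq_minus'; [exact E1 | apply is_lim_seq_const].
  + replace (Finite 0) with (Finite (Series (fun n => Im (f n)) - Series (fun n => Im (f n))))
      by (f_equal; ring).
    apply is_lim_seq_minus'; [exact E2 | apply is_lim_seq_const].
Qed.

Lemma psum_halves (N : nat) (u : Z -> C) :
  psum N u = csum (fun n => u (Z.of_nat n)) N + csum (fun n => u (- Z.of_nat (S n))%Z) N.
Proof. exact (eq_trans (psum_add 0 N u) (f_equal2 Cplus (Cplus_0_l _) eq_refl)). Qed.

Lemma CSumZ_cv (K : R) (u : Z -> C) : bd K u -> Ccv (fun N => psum N u) (CSumZ u).
Proof.
intros H; assert (HK := bd_pos _ _ H).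
apply Ccv_ext with (1 := fun N => eq_sym (psum_halves N u)).
apply Ccv_plus; apply CSeries_cv with K; intros n.
- rewrite (INR_IZR_INZ n); apply H.
- eapply Rle_trans; [apply H |].
  rewrite opp_IZR, <- INR_IZR_INZ, S_INR.
  unfold Rdiv; apply Rmult_le_compat_l; [exact HK |].
  assert (h := pos_INR n); apply Rinv_le_contravar; nra.
Qed.

Lemma CSumZ_unique (K : R) (u : Z -> C) (l : C) :
  bd K u -> Ccv (fun N => psum N u) l -> CSumZ u = l.
Proof. intros H Hl; eapply Ccv_unique; [eapply CSumZ_cv, H | exact Hl]. Qed.

Lemma CSumZ_ext (u v : Z -> C) : (forall n, u n = v n) -> CSumZ u = CSumZ v.
Proof.
intros H; unfold CSumZ, CSeries; f_equal; f_equal; apply Series_ext;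
  intros n; rewrite H; reflexivity.
Qed.

Lemma CSumZ_psum (K : R) (u : Z -> C) (N : nat) :
  bd K u -> (Cmod (CSumZ u - psum N u) <= 6 * K / (INR N + 1))%R.
Proof.
intros H; assert (HK := bd_pos _ _ H).
apply Ccv_bounded with (u := fun n => psum n u - psum N u) (N0 := N).
- intros n Hn; apply psum_tail_le; auto.
- apply Ccv_minus; [apply CSumZ_cv with K, H | apply Ccv_const].
Qed.

Lemma CSumZ_bound (K : R) (u : Z -> C) : bd K u -> (Cmod (CSumZ u) <= 6 * K)%R.
Proof.
intros H; assert (h := CSumZ_psum K u 0 H); cbn in h.
replace (CSumZ u - 0) with (CSumZ u) in h by ring; lra.
Qed.

Lemma bd_plus (K L : R) (u v : Z -> C) : bd K u -> bd L v -> bd (K + L) (fun n => u n + v n).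
Proof.
intros Hu Hv n; eapply Rle_trans; [apply Cmod_triangle |].
unfold Rdiv; rewrite Rmult_plus_distr_r; apply Rplus_le_compat; [apply Hu | apply Hv].
Qed.

Lemma bd_scal (K : R) (c : C) (u : Z -> C) : bd K u -> bd (Cmod c * K) (fun n => c * u n).
Proof.
intros Hu n; rewrite Cmod_mult; unfold Rdiv; rewrite Rmult_assoc.
apply Rmult_le_compat_l; [apply Cmod_ge_0 | apply Hu].
Qed.

Lemma bd_ext (K : R) (u v : Z -> C) : (forall n, u n = v n) -> bd K u -> bd K v.
Proof. intros E H n; rewrite <- E; apply H. Qed.

Lemma CSumZ_plus (K L : R) (u v : Z -> C) : bd K u -> bd L v ->
  CSumZ (fun n => u n + v n) = CSumZ u + CSumZ v.
Proof.
intros Hu Hv; apply CSumZ_unique with (1 := bd_plus _ _ _ _ Hu Hv).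
apply Ccv_ext with (fun N => psum N u + psum N v); [intros; symmetry; apply psum_plus |].
apply Ccv_plus; eapply CSumZ_cv; eassumption.
Qed.

Lemma CSumZ_scal (K : R) (c : C) (u : Z -> C) : bd K u ->
  CSumZ (fun n => c * u n) = c * CSumZ u.
Proof.
intros Hu; apply CSumZ_unique with (1 := bd_scal _ c _ Hu).
apply Ccv_ext with (fun N => c * psum N u); [intros; symmetry; apply psum_scal |].
apply Ccv_scal; eapply CSumZ_cv; eassumption.
Qed.

Lemma CSumZ_minus (K L : R) (u v : Z -> C) : bd K u -> bd L v ->
  CSumZ (fun n => u n - v n) = CSumZ u - CSumZ v.
Proof.
intros Hu Hv.
rewrite (CSumZ_ext _ (fun n => u n + (- (1)) * v n)) by (intros; ring).
rewrite (CSumZ_plus _ _ _ _ Hu (bd_scal _ _ _ Hv)), (CSumZ_scal _ _ _ Hv); ring.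
Qed.

Lemma bd_vanish (K : R) (u : Z -> C) (phi : nat -> Z) :
  (forall n, Z.of_nat n <= Z.abs (phi n))%Z -> bd K u -> Ccv (fun n => u (phi n)) 0.
Proof.
intros Hphi H; assert (HK := bd_pos _ _ H).
apply Ccv_squeeze with (2 := lim_inv_succ (3 * K)).
intros n; replace (u (phi n) - 0) with (u (phi n)) by ring.
eapply Rle_trans; [apply H |].
replace (3 * K / (INR n + 1))%R with (K * (3 / (INR n + 1)))%R
  by (assert (h := pos_INR n); field; lra).
unfold Rdiv at 1; apply Rmult_le_compat_l; [exact HK |].
assert (Hn : (INR n <= Rabs (IZR (phi n)))%R)
  by (rewrite <- abs_IZR, INR_IZR_INZ; apply IZR_le, Hphi).
assert (h := pos_INR n).
assert (INR n ^ 2 <= IZR (phi n) ^ 2)%R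
  by (rewrite <- (pow2_abs (IZR _)); apply pow_incr; lra).
apply Rle_trans with (/ (1 + INR n ^ 2))%R; [apply Rinv_le_contravar; nra |].
apply Rmult_le_reg_r with ((1 + INR n ^ 2) * (INR n + 1))%R; [nra |].
replace (/ (1 + INR n ^ 2) * ((1 + INR n ^ 2) * (INR n + 1)))%R
  with (INR n + 1)%R by (field; nra).
replace (3 / (INR n + 1) * ((1 + INR n ^ 2) * (INR n + 1)))%R
  with (3 * (1 + INR n ^ 2))%R by (field; lra).
nra.
Qed.

(** Writing [n] as plus or minus [(e n + k) - k] gives
    [1 + n^2 <= (2 + 2 k^2) (1 + (e n + k)^2)]. *)
Lemma bd_comp_affine (K : R) (u : Z -> C) (e k : Z) : (e = 1 \/ e = -1)%Z -> bd K u ->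
  bd (K * (2 + 2 * IZR k ^ 2)) (fun n => u (e * n + k)%Z).
Proof.
intros He H n; assert (HK := bd_pos _ _ H).
eapply Rle_trans; [apply H |].
unfold Rdiv; rewrite Rmult_assoc; apply Rmult_le_compat_l; [exact HK |].
rewrite plus_IZR, mult_IZR.
assert (Hx : (IZR e ^ 2 = 1)%R) by (destruct He; subst; cbn; ring).
set (x := IZR n); set (y := IZR k); set (f := IZR e) in *.
assert (0 <= x ^ 2)%R by apply pow2_ge_0; assert (0 <= y ^ 2)%R by apply pow2_ge_0.
assert (0 <= (f * x + y) ^ 2)%R by apply pow2_ge_0.
apply Rmult_le_reg_r with ((1 + (f * x + y) ^ 2) * (1 + x ^ 2))%R; [nra |].
replace (/ (1 + (f * x + y) ^ 2) * ((1 + (f * x + y) ^ 2) * (1 + x ^ 2)))%R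
  with (1 + x ^ 2)%R by (field; nra).
replace ((2 + 2 * y ^ 2) * / (1 + x ^ 2) * ((1 + (f * x + y) ^ 2) * (1 + x ^ 2)))%R
  with ((2 + 2 * y ^ 2) * (1 + (f * x + y) ^ 2))%R by (field; nra).
assert (x ^ 2 = (f * x) ^ 2)%R by (rewrite Rpow_mult_distr, Hx; ring).
assert (0 <= (f * x + 2 * y) ^ 2)%R by apply pow2_ge_0.
assert (0 <= y ^ 2 * (f * x + y) ^ 2)%R by (apply Rmult_le_pos; assumption).
nra.
Qed.

Lemma bd_shift (K : R) (u : Z -> C) (k : Z) : bd K u ->
  bd (K * (2 + 2 * IZR k ^ 2)) (fun n => u (n + k)%Z).
Proof.
intros H; apply bd_ext with (2 := bd_comp_affine K u 1 k (or_introl eq_refl) H).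
intros n; f_equal; lia.
Qed.

Lemma psum_shift1 (N : nat) (u : Z -> C) :
  psum N (fun n => u (n + 1)%Z) = psum N u + (u (Z.of_nat N) - u (- Z.of_nat N)%Z).
Proof.
induction N as [|N IH]; [cbn; ring |].
cbn [psum]; rewrite IH.
replace (Z.of_nat N + 1)%Z with (Z.of_nat (S N)) by lia.
replace (- Z.of_nat (S N) + 1)%Z with (- Z.of_nat N)%Z by lia; ring.
Qed.

Lemma CSumZ_shift1 (K : R) (u : Z -> C) : bd K u -> CSumZ (fun n => u (n + 1)%Z) = CSumZ u.
Proof.
intros H; apply CSumZ_unique with (1 := bd_shift _ _ 1 H).
apply Ccv_ext with (fun N => psum N u + (u (Z.of_nat N) - u (- Z.of_nat N)%Z));
  [intros; symmetry; apply psum_shift1 |].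
replace (CSumZ u) with (CSumZ u + (0 - 0)) by ring.
apply Ccv_plus; [eapply CSumZ_cv, H | apply Ccv_minus];
  eapply bd_vanish; try exact H; lia.
Qed.

Lemma CSumZ_shift (K : R) (u : Z -> C) (k : Z) : bd K u ->
  CSumZ (fun n => u (n + k)%Z) = CSumZ u.
Proof.
revert K u.
assert (Hp : forall k : nat, forall K u, bd K u ->
  CSumZ (fun n => u (n + Z.of_nat k)%Z) = CSumZ u).
{ induction k0 as [|k' IH]; intros K u H.
  - apply CSumZ_ext; intros n; f_equal; lia.
  - rewrite <- (IH K u H), <- (CSumZ_shift1 _ _ (bd_shift _ _ (Z.of_nat k') H)).
    apply CSumZ_ext; intros n; f_equal; lia. }
intros K u H; destruct (Z_le_gt_dec 0 k) as [Hk | Hk].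
- rewrite <- (Z2Nat.id k Hk); eapply Hp, H.
- rewrite <- (Hp (Z.to_nat (- k)) _ _ (bd_shift _ _ k H)).
  apply CSumZ_ext; intros n; f_equal; lia.
Qed.

Lemma bd_opp (K : R) (u : Z -> C) : bd K u -> bd K (fun n => u (- n)%Z).
Proof.
intros H n; replace (IZR n ^ 2)%R with (IZR (- n) ^ 2)%R by (rewrite opp_IZR; ring); apply H.
Qed.

Lemma psum_opp (N : nat) (u : Z -> C) :
  psum N (fun n => u (- n)%Z) = psum N u + (u (Z.of_nat N) - u (- Z.of_nat N)%Z).
Proof.
induction N as [|N IH]; [cbn; ring |].
cbn [psum]; rewrite IH, Z.opp_involutive; ring.
Qed.

Lemma CSumZ_opp (K : R) (u : Z -> C) : bd K u -> CSumZ (fun n => u (- n)%Z) = CSumZ u.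
Proof.
intros H; apply CSumZ_unique with (1 := bd_opp _ _ H).
apply Ccv_ext with (fun N => psum N u + (u (Z.of_nat N) - u (- Z.of_nat N)%Z));
  [intros; symmetry; apply psum_opp |].
replace (CSumZ u) with (CSumZ u + (0 - 0)) by ring.
apply Ccv_plus; [eapply CSumZ_cv, H | apply Ccv_minus];
  eapply bd_vanish; try exact H; lia.
Qed.

Lemma bd_mul (K : R) (u : Z -> C) (m j : nat) : (j < m)%nat -> bd K u ->
  bd (K * (2 + 2 * INR j ^ 2)) (fun n => u (Z.of_nat m * n + Z.of_nat j)%Z).
Proof.
intros Hj H n; assert (HK := bd_pos _ _ H).
eapply Rle_trans; [apply H |].
unfold Rdiv; rewrite Rmult_assoc; apply Rmult_le_compat_l; [exact HK |].
rewrite plus_IZR, mult_IZR, <- !INR_IZR_INZ.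
assert (Hm : (1 <= INR m)%R) by (replace 1%R with (INR 1) by reflexivity; apply le_INR; lia).
set (x := IZR n); set (y := INR j); set (f := INR m) in *.
assert (0 <= x ^ 2)%R by apply pow2_ge_0; assert (0 <= y ^ 2)%R by apply pow2_ge_0.
assert (0 <= (f * x + y) ^ 2)%R by apply pow2_ge_0.
apply Rmult_le_reg_r with ((1 + (f * x + y) ^ 2) * (1 + x ^ 2))%R; [nra |].
replace (/ (1 + (f * x + y) ^ 2) * ((1 + (f * x + y) ^ 2) * (1 + x ^ 2)))%R
  with (1 + x ^ 2)%R by (field; nra).
replace ((2 + 2 * y ^ 2) * / (1 + x ^ 2) * ((1 + (f * x + y) ^ 2) * (1 + x ^ 2)))%R
  with ((2 + 2 * y ^ 2) * (1 + (f * x + y) ^ 2))%R by (field; nra).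
assert (x ^ 2 <= (f * x) ^ 2)%R.
{ rewrite Rpow_mult_distr.
  assert (1 <= f ^ 2)%R by nra; nra. }
assert (0 <= (f * x + 2 * y) ^ 2)%R by apply pow2_ge_0.
assert (0 <= y ^ 2 * (f * x + y) ^ 2)%R by (apply Rmult_le_pos; assumption).
nra.
Qed.

(** The half-open window pays off here: the integers in [[- m N, m N)] are exactly the [m n + j]
    with [- N <= n < N] and [0 <= j < m], without boundary terms. *)
Lemma psum_split (m N : nat) (u : Z -> C) :
  csum (fun j => psum N (fun n => u (Z.of_nat m * n + Z.of_nat j)%Z)) m = psum (m * N) u.
Proof.
induction N as [|N IH].
- rewrite Nat.mul_0_r; cbn [psum].
  induction m as [|m IHm]; [reflexivity | cbn; rewrite IHm; ring].
- replace (m * S N)%nat with (m * N + m)%nat by lia.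
  rewrite psum_add, <- IH, (csum_rev (fun i => u (- _)%Z)), <- !csum_plus.
  apply csum_ext; intros j Hj; cbn [psum].
  rewrite <- Cplus_assoc; f_equal; f_equal; f_equal; lia.
Qed.

Lemma CSumZ_split (K : R) (m : nat) (u : Z -> C) : (0 < m)%nat -> bd K u ->
  CSumZ u = csum (fun j => CSumZ (fun n => u (Z.of_nat m * n + Z.of_nat j)%Z)) m.
Proof.
intros Hm H.
apply Ccv_unique with (u := fun N => psum (m * N) u).
- apply (Ccv_subseq (fun N => psum N u)); [intros; nia | eapply CSumZ_cv, H].
- apply Ccv_ext with (1 := fun N => psum_split m N u).
  assert (Hc : forall k, (k <= m)%nat -> Ccv
    (fun N => csum (fun j => psum N (fun n => u (Z.of_nat m * n + Z.of_nat j)%Z)) k)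
    (csum (fun j => CSumZ (fun n => u (Z.of_nat m * n + Z.of_nat j)%Z)) k)).
  { induction k as [|k IH]; intros Hk; cbn [csum]; [apply Ccv_const |].
    apply Ccv_plus; [apply IH; lia |].
    eapply CSumZ_cv, bd_mul; [lia | exact H]. }
  apply Hc; lia.
Qed.

(* Dominated convergence; the truncations may grow with the index. *)
Lemma psum_tannery (K : R) (v : nat -> Z -> C) (u : Z -> C) :
  (forall N n, (- Z.of_nat N <= n < Z.of_nat N)%Z -> Cmod (v N n) <= K / (1 + IZR n ^ 2))%R ->
  (forall n, Ccv (fun N => v N n) (u n)) ->
  Ccv (fun N => psum N (v N)) (CSumZ u).
Proof.
intros H Hc.
assert (HK : (0 <= K)%R) by (apply (bound_pos K (v 1%nat) 0), H; lia).
assert (Hu : bd K u).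
{ intros n; apply Ccv_bounded with (u := fun N => v N n) (N0 := S (Z.abs_nat n)); auto.
  intros N HN; apply H; lia. }
apply Ccv_eps; intros eps He.
assert (HM : exists M, (6 * K / (INR M + 1) < eps / 3)%R).
{ assert (h := lim_inv_succ (6 * K)); apply is_lim_seq_spec in h.
  destruct (h (mkposreal (eps / 3) ltac:(lra))) as [M HM]; exists M.
  specialize (HM M (Nat.le_refl M)); cbn in HM.
  rewrite Rminus_0_r, Rabs_pos_eq in HM by (apply div_pos_nonneg; lra); exact HM. }
destruct HM as [M HM].
assert (Hf : forall m, Ccv (fun N => psum m (v N)) (psum m u)).
{ induction m as [|m IH]; cbn [psum]; [apply Ccv_const |].
  repeat apply Ccv_plus; auto. }
destruct (proj1 (Ccv_eps _ _) (Hf M) (eps / 3)%R) as [N1 HN1]; [lra |].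
exists (max N1 M); intros N HN.
replace (psum N (v N) - CSumZ u) with
  ((psum N (v N) - psum M (v N)) + ((psum M (v N) - psum M u) + - (CSumZ u - psum M u))) by ring.
eapply Rle_lt_trans; [apply Cmod_triangle |].
assert (h := Cmod_triangle (psum M (v N) - psum M u) (- (CSumZ u - psum M u))).
rewrite Cmod_opp in h.
assert (h1 := psum_tail_le K (v N) M N ltac:(lia) HK (H N)).
assert (h2 := CSumZ_psum K u M Hu).
specialize (HN1 N ltac:(lia)); lra.
Qed.

Lemma CSumZ_tannery (K : R) (v : nat -> Z -> C) (u : Z -> C) :
  (forall N, bd K (v N)) -> (forall n, Ccv (fun N => v N n) (u n)) ->
  Ccv (fun N => CSumZ (v N)) (CSumZ u).
Proof.
intros H Hc.
apply Ccv_ext with (fun N => psum N (v N) + (CSumZ (v N) - psum N (v N))); [intros; ring |].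
replace (CSumZ u) with (CSumZ u + 0) by ring.
apply Ccv_plus; [apply psum_tannery with K; auto; intros; apply H |].
apply Ccv_squeeze with (2 := lim_inv_succ (6 * K)); intros n.
replace (CSumZ (v n) - psum n (v n) - 0) with (CSumZ (v n) - psum n (v n)) by ring.
apply CSumZ_psum, H.
Qed.

(** A finite sum over [d] passes through the outer series by linearity; dominated convergence then
    lets the window in [d] grow. *)
Lemma CSumZ_fubini (K : R) (f : Z -> Z -> C) :
  (forall n d, Cmod (f n d) <= K / (1 + IZR n ^ 2) / (1 + IZR d ^ 2))%R ->
  CSumZ (fun n => CSumZ (f n)) = CSumZ (fun d => CSumZ (fun n => f n d)).
Proof.
intros H.
assert (H1 : forall n, bd (K / (1 + IZR n ^ 2)) (f n)) by (intros n d; apply H).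
assert (HK : (0 <= K)%R).
{ assert (h := bd_pos _ _ (H1 0%Z)); replace (1 + 0 ^ 2)%R with 1%R in h by ring; lra. }
assert (H2 : forall d, bd (K / (1 + IZR d ^ 2)) (fun n => f n d)).
{ intros d n; eapply Rle_trans; [apply H |].
  right; field; split; apply Rgt_not_eq;
    [assert (h := pow2_ge_0 (IZR d)) | assert (h := pow2_ge_0 (IZR n))]; lra. }
assert (HB : bd (6 * K) (fun d => CSumZ (fun n => f n d))).
{ intros d; eapply Rle_trans; [apply CSumZ_bound, H2 |].
  unfold Rdiv; rewrite Rmult_assoc; lra. }
assert (Hps : forall D n, (Cmod (psum D (f n)) <= 6 * K / (1 + IZR n ^ 2))%R).
{ intros D n; eapply Rle_trans; [apply psum_bound, H1 |].
  unfold Rdiv; rewrite Rmult_assoc; lra. }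
assert (H2' : forall d, bd K (fun n => f n d)).
{ intros d n; eapply Rle_trans; [apply H2 |].
  assert (h := pow2_ge_0 (IZR n)); assert (h' := pow2_ge_0 (IZR d)).
  unfold Rdiv; apply Rmult_le_compat_r; [left; apply Rinv_0_lt_compat; lra |].
  rewrite <- (Rmult_1_r K) at 2; apply Rmult_le_compat_l; [exact HK |].
  rewrite <- Rinv_1; apply Rinv_le_contravar; lra. }
eapply Ccv_unique; [| eapply CSumZ_cv, HB].
apply Ccv_ext with (fun D => CSumZ (fun n => psum D (f n))).
- intros D; induction D as [|D IH]; cbn [psum].
  + apply CSumZ_unique with (K := 0%R).
    * intros n; rewrite Cmod_0; unfold Rdiv; rewrite Rmult_0_l; lra.
    * apply Ccv_ext with (fun _ => 0); [| apply Ccv_const].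
      intros n; induction n as [|n IH]; cbn [psum]; [reflexivity | rewrite <- IH; ring].
  + rewrite (CSumZ_plus (6 * K) (K + K)), (CSumZ_plus K K), IH; auto using bd_plus.
    intros n; apply Hps.
- apply CSumZ_tannery with (6 * K)%R; [intros N n; apply Hps |].
  intros n; eapply CSumZ_cv, H1.
Qed.

Ltac push_RtoC :=
  repeat first [rewrite S_INR | rewrite plus_INR | rewrite mult_INR
    | rewrite plus_IZR | rewrite minus_IZR | rewrite mult_IZR | rewrite opp_IZR
    | rewrite RtoC_plus | rewrite RtoC_minus | rewrite RtoC_mult | rewrite RtoC_opp].

(** * Gaussian majorants *)

Lemma exp_ge_quad (t : R) : (0 <= t -> 1 + t ^ 2 / 4 <= exp t)%R.
Proof.
intros Ht; replace t with (t / 2 + t / 2)%R at 2 by field; rewrite exp_plus.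
assert (h := exp_ineq1_le (t / 2)); nra.
Qed.

Lemma quad_le_exp (t : R) : (1 + t ^ 2 <= 4 * exp (Rabs t))%R.
Proof.
assert (h := exp_ge_quad (Rabs t) (Rabs_pos t)); rewrite pow2_abs in h.
assert (0 <= t ^ 2)%R by apply pow2_ge_0; lra.
Qed.

(** Multiplying by [1 + x^2 <= 4 exp |x|] raises the linear coefficient to at most [|B| + 1];
    completing the square then bounds the exponent by [(|B| + 1)^2 / (4 A)]. *)
Lemma gauss_majorant (A B : R) : (0 < A)%R ->
  forall x : R, (exp (- (A * x ^ 2) + B * Rabs x)
    <= 4 * exp ((Rabs B + 1) ^ 2 / (4 * A)) / (1 + x ^ 2))%R.
Proof.
intros HA x; assert (Hx := pow2_ge_0 x).
apply Rmult_le_reg_r with (1 + x ^ 2)%R; [lra |].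
replace (4 * exp ((Rabs B + 1) ^ 2 / (4 * A)) / (1 + x ^ 2) * (1 + x ^ 2))%R
  with (4 * exp ((Rabs B + 1) ^ 2 / (4 * A)))%R by (field; lra).
apply Rle_trans with (exp (- (A * x ^ 2) + B * Rabs x) * (4 * exp (Rabs x)))%R.
- apply Rmult_le_compat_l; [left; apply exp_pos | apply quad_le_exp].
- rewrite (Rmult_comm 4), <- Rmult_assoc, <- exp_plus, Rmult_comm.
  apply Rmult_le_compat_l; [lra |]; apply exp_le.
  assert (h := Rle_abs B); assert (h' := Rabs_pos x); rewrite <- (pow2_abs x).
  set (y := Rabs x) in *; set (b := Rabs B) in *.
  assert (0 <= A * (y - (b + 1) / (2 * A)) ^ 2)%R
    by (apply Rmult_le_pos; [lra | apply pow2_ge_0]).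
  replace ((b + 1) ^ 2 / (4 * A))%R
    with (A * (y - (b + 1) / (2 * A)) ^ 2 - A * y ^ 2 + (b + 1) * y)%R by (field; lra).
  nra.
Qed.

(** The usual way into the class [bd]: to bound a series of exponentials it is enough to write its
    exponent as a quadratic polynomial in [n] with leading coefficient in the upper half-plane. *)
Lemma bd_gauss (T beta gamma : C) (u : Z -> C) : (0 < Im T)%R ->
  (forall n, u n = e2pi (T * IZR n ^ 2 + beta * IZR n + gamma)) -> exists K, bd K u.
Proof.
intros HT Hu; assert (Hp := PI_RGT_0).
exists (exp (- (2 * PI * Im gamma)) * (4 * exp ((Rabs (2 * PI * Im beta) + 1) ^ 2
  / (4 * (2 * PI * Im T)))))%R.
intros n; rewrite Hu, Cmod_e2pi.
assert (HA : (0 < 2 * PI * Im T)%R) by (apply Rmult_lt_0_compat; lra).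
assert (h := gauss_majorant _ (Rabs (2 * PI * Im beta)) HA (IZR n)).
rewrite Rabs_Rabsolu in h.
apply Rmult_le_compat_l with (r := exp (- (2 * PI * Im gamma))) in h; [| left; apply exp_pos].
eapply Rle_trans; [eapply Rle_trans; [| exact h] | right; unfold Rdiv; ring].
rewrite <- exp_plus; apply exp_le.
replace (Im (T * IZR n ^ 2 + beta * IZR n + gamma))
    with (Im T * IZR n ^ 2 + Im beta * IZR n + Im gamma)%R
    by (destruct T, beta, gamma; cbn; ring).
  assert (h' := Rle_abs (- (2 * PI * Im beta * IZR n))).
  rewrite Rabs_Ropp, Rabs_mult in h'; nra.
Qed.

(** * Infinite products *)

Lemma Cprod_ext (f g : nat -> C) (n : nat) :
  (forall k, (k < n)%nat -> f k = g k) -> Cprod f n = Cprod g n.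
Proof.
induction n as [|n IH]; intros H; [reflexivity |]; cbn; rewrite IH, H; auto.
Qed.

Lemma Cprod_mult (f g : nat -> C) (n : nat) :
  Cprod (fun k => f k * g k) n = Cprod f n * Cprod g n.
Proof. induction n as [|n IH]; cbn; [ring | rewrite IH; ring]. Qed.

Lemma Cprod_S_l (f : nat -> C) (n : nat) :
  Cprod f (S n) = f O * Cprod (fun k => f (S k)) n.
Proof.
induction n as [|n IH]; [cbn; ring |].
change (Cprod f (S (S n))) with (Cprod f (S n) * f (S n)); rewrite IH; cbn; ring.
Qed.

Lemma Cprod_add (f : nat -> C) (n m : nat) :
  Cprod f (n + m) = Cprod f n * Cprod (fun k => f (n + k)%nat) m.
Proof.
induction m as [|m IH]; [rewrite Nat.add_0_r; cbn; ring |].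
rewrite Nat.add_succ_r; cbn; rewrite IH; ring.
Qed.

Lemma Cprod_rev (f : nat -> C) (n : nat) :
  Cprod f n = Cprod (fun k => f (n - S k)%nat) n.
Proof.
induction n as [|n IH]; [reflexivity |].
rewrite (Cprod_S_l (fun k => f (S n - S k)%nat)); cbn [Cprod]; rewrite IH.
replace (S n - 1)%nat with n by lia; rewrite Cmult_comm.
f_equal; apply Cprod_ext; intros k Hk; f_equal; lia.
Qed.

Lemma Cprod_neq0 (f : nat -> C) (n : nat) :
  (forall k, (k < n)%nat -> f k <> 0) -> Cprod f n <> 0.
Proof.
induction n as [|n IH]; intros H; cbn; [exact C1_nz |].
apply Cmult_neq_0; auto.
Qed.

(** The finite q-Pochhammer symbol [(x; q)_n]; [poch] below is [(x; q)_infinity]. *)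
Definition pochn (x q : C) (n : nat) : C := Cprod (fun k => 1 - x * q ^ k) n.

Definition poch (x q : C) : C := CLim_seq (pochn x q).

Lemma CLim_seq_unique (u : nat -> C) (l : C) : Ccv u l -> CLim_seq u = l.
Proof.
intros H; unfold CLim_seq; apply C_eq; cbn;
  [rewrite (is_lim_seq_unique _ (Re l)) | rewrite (is_lim_seq_unique _ (Im l))]; try reflexivity.
- apply is_lim_seq_ext with (fun n => (Re (u n) - Re l) + Re l)%R; [intros; ring |].
  replace (Finite (Re l)) with (Finite (0 + Re l)) by (f_equal; ring).
  apply is_lim_seq_plus'; [| apply is_lim_seq_const].
  apply is_lim_seq_abs_0, is_lim_seq_le_le with (fun _ => 0%R) (fun n => Cmod (u n - l));
    [| apply is_lim_seq_const | exact H].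
  intros n; split; [apply Rabs_pos | apply (re_le_Cmod (u n - l))].
- apply is_lim_seq_ext with (fun n => (Im (u n) - Im l) + Im l)%R; [intros; ring |].
  replace (Finite (Im l)) with (Finite (0 + Im l)) by (f_equal; ring).
  apply is_lim_seq_plus'; [| apply is_lim_seq_const].
  apply is_lim_seq_abs_0, is_lim_seq_le_le with (fun _ => 0%R) (fun n => Cmod (u n - l));
    [| apply is_lim_seq_const | exact H].
  intros n; split; [apply Rabs_pos | apply (im_le_Cmod (u n - l))].
Qed.

Lemma pow_majorant (r : R) : (0 <= r < 1)%R ->
  exists K, (0 <= K)%R /\ forall n, (r ^ n <= K / (1 + INR n ^ 2))%R.
Proof.
intros [H0 H1].
(* Since [r] may be 0, the logarithm is taken of a larger ratio that is still below 1. *)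
set (s := Rmax r (1 / 2)).
assert (Hs : (0 < s < 1)%R)
  by (unfold s; split; [eapply Rlt_le_trans; [| apply Rmax_r]; lra | apply Rmax_lub_lt; lra]).
set (A := (- ln s)%R).
assert (HA : (0 < A)%R) by (unfold A; assert (h := ln_increasing s 1 ltac:(lra) ltac:(lra)); rewrite ln_1 in h; lra).
exists (1 + 4 / A ^ 2)%R.
assert (HA2 : (0 < A ^ 2)%R) by (apply pow_lt, HA).
assert (Hq : (0 < 4 / A ^ 2)%R) by (apply Rdiv_lt_0_compat; lra).
split; [lra |]; intros n.
assert (Hn := pos_INR n).
apply Rle_trans with (s ^ n)%R; [apply pow_incr; split; [lra | apply Rmax_l] |].
assert (Hsn : (s ^ n = exp (- (INR n * A)))%R).
{ unfold A; replace (- (INR n * - ln s))%R with (INR n * ln s)%R by ring.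
  rewrite <- ln_pow, exp_ln by (try apply pow_lt; lra); reflexivity. }
rewrite Hsn, exp_Ropp.
assert (h := exp_ge_quad (INR n * A) ltac:(nra)).
apply Rmult_le_reg_r with (exp (INR n * A) * (1 + INR n ^ 2))%R.
{ apply Rmult_lt_0_compat; [apply exp_pos | nra]. }
assert (hp := exp_pos (INR n * A)).
replace (/ exp (INR n * A) * (exp (INR n * A) * (1 + INR n ^ 2)))%R with (1 + INR n ^ 2)%R
  by (field; lra).
replace ((1 + 4 / A ^ 2) / (1 + INR n ^ 2) * (exp (INR n * A) * (1 + INR n ^ 2)))%R
  with ((1 + 4 / A ^ 2) * exp (INR n * A))%R by (field; split; nra).
apply Rle_trans with ((1 + 4 / A ^ 2) * (1 + (INR n * A) ^ 2 / 4))%R; [| nra].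
replace ((1 + 4 / A ^ 2) * (1 + (INR n * A) ^ 2 / 4))%R
  with (1 + INR n ^ 2 + (4 / A ^ 2 + (INR n * A) ^ 2 / 4))%R by (field; lra).
assert (0 <= (INR n * A) ^ 2)%R by apply pow2_ge_0; lra.
Qed.

Lemma Cmod_mult_le (a b : C) (A B : R) :
  (Cmod a <= A)%R -> (Cmod b <= B)%R -> (Cmod (a * b) <= A * B)%R.
Proof.
intros; rewrite Cmod_mult; apply Rmult_le_compat; auto using Cmod_ge_0.
Qed.

Lemma Cmod_1_minus (a : C) : (Cmod (1 - a) <= 1 + Cmod a)%R.
Proof.
unfold Cminus; eapply Rle_trans; [apply Cmod_triangle |]; rewrite Cmod_1, Cmod_opp; lra.
Qed.

Lemma Cmod_1_minus_ge (a : C) : (1 - Cmod a <= Cmod (1 - a))%R.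
Proof.
assert (h := Cmod_triangle (1 - a) a); replace (1 - a + a) with (RtoC 1) in h by ring.
rewrite Cmod_1 in h; lra.
Qed.

(** Each factor is at most [exp (|x| |q|^k)], and the exponents form a geometric series. *)
Lemma pochn_bound (x q : C) (n : nat) : (Cmod q < 1)%R ->
  (Cmod (pochn x q n) <= exp (Cmod x / (1 - Cmod q)))%R.
Proof.
intros Hq; assert (Hq0 := Cmod_ge_0 q); assert (Hx0 := Cmod_ge_0 x).
assert (H : (Cmod (pochn x q n) <= exp (Cmod x * ((1 - Cmod q ^ n) / (1 - Cmod q))))%R).
{ unfold pochn; induction n as [|n IH]; cbn [Cprod].
  - rewrite Cmod_1; cbn; replace (Cmod x * ((1 - 1) / (1 - Cmod q)))%R with 0%R by (field; lra).
    rewrite exp_0; lra.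
  - rewrite Cmod_mult.
    replace (Cmod x * ((1 - Cmod q ^ S n) / (1 - Cmod q)))%R
      with (Cmod x * ((1 - Cmod q ^ n) / (1 - Cmod q)) + Cmod x * Cmod q ^ n)%R by (cbn; field; lra).
    rewrite exp_plus; apply Rmult_le_compat; try apply Cmod_ge_0; [exact IH |].
    eapply Rle_trans; [apply Cmod_1_minus |].
    rewrite Cmod_mult, Cmod_pow; apply exp_ineq1_le. }
eapply Rle_trans; [exact H |]; apply exp_le.
unfold Rdiv at 2; apply Rmult_le_compat_l; [exact Hx0 |].
assert (0 <= Cmod q ^ n)%R by (apply pow_le, Hq0).
unfold Rdiv; rewrite <- (Rmult_1_l (/ (1 - Cmod q))) at 2.
apply Rmult_le_compat_r; [left; apply Rinv_0_lt_compat |]; lra.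
Qed.

(** The product is turned into a series: consecutive partial products differ by [- x q^n (x; q)_n],
    which decays geometrically because the partial products are bounded. *)
Lemma pochn_cv (x q : C) : (Cmod q < 1)%R -> Ccv (pochn x q) (poch x q).
Proof.
intros Hq; assert (Hq0 := Cmod_ge_0 q); assert (Hx0 := Cmod_ge_0 x).
set (d := fun n => - (x * q ^ n) * pochn x q n).
assert (E : forall n, 1 + csum d n = pochn x q n).
{ induction n as [|n IH]; [cbn; ring |].
  cbn [csum]; rewrite Cplus_assoc, IH; unfold d; unfold pochn; cbn [Cprod]; ring. }
destruct (pow_majorant (Cmod q) (conj Hq0 Hq)) as [K [HK Hb]].
set (B := exp (Cmod x / (1 - Cmod q))).
assert (HB : (0 < B)%R) by apply exp_pos.
assert (Hd : forall n, (Cmod (d n) <= (Cmod x * B * K) / (1 + INR n ^ 2))%R).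
{ intros n; unfold d; rewrite Cmod_mult, Cmod_opp, Cmod_mult, Cmod_pow.
  replace (Cmod x * B * K / (1 + INR n ^ 2))%R
    with (Cmod x * (K / (1 + INR n ^ 2)) * B)%R by (field; assert (h := pow2_ge_0 (INR n)); lra).
  apply Rmult_le_compat; [apply Rmult_le_pos; [exact Hx0 | apply pow_le, Hq0] | apply Cmod_ge_0 | |
    apply pochn_bound, Hq].
  apply Rmult_le_compat_l; [exact Hx0 | apply Hb]. }
assert (H : Ccv (pochn x q) (1 + CSeries d)).
{ apply Ccv_ext with (1 := E); apply Ccv_plus; [apply Ccv_const | apply CSeries_cv with (1 := Hd)]. }
unfold poch; rewrite (CLim_seq_unique _ _ H); exact H.
Qed.

Lemma pochn_add (x q : C) (n m : nat) :
  pochn x q (n + m) = pochn x q n * pochn (x * q ^ n) q m.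
Proof.
unfold pochn; rewrite Cprod_add; f_equal; apply Cprod_ext; intros k _.
rewrite Cpow_add_r; ring.
Qed.

(** Weierstrass' inequality: a product of factors [1 - a_k] is at least [1] minus the sum of the
    [a_k], provided that this sum is at most 1. Otherwise the left side is not positive. *)
Lemma pochn_lower (x q : C) (n : nat) : (Cmod q < 1)%R ->
  (1 - Cmod x / (1 - Cmod q) <= Cmod (pochn x q n))%R.
Proof.
intros Hq; assert (Hq0 := Cmod_ge_0 q); assert (Hx0 := Cmod_ge_0 x).
assert (Hg : forall n, (Cmod x * ((1 - Cmod q ^ n) / (1 - Cmod q)) <= Cmod x / (1 - Cmod q))%R).
{ intros k; unfold Rdiv; apply Rmult_le_compat_l; [exact Hx0 |].
  assert (0 <= Cmod q ^ k)%R by (apply pow_le, Hq0).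
  rewrite <- (Rmult_1_l (/ (1 - Cmod q))) at 2.
  apply Rmult_le_compat_r; [left; apply Rinv_0_lt_compat |]; lra. }
destruct (Rle_or_lt 1 (Cmod x / (1 - Cmod q))) as [Hc | Hc].
{ eapply Rle_trans; [| apply Cmod_ge_0]; lra. }
assert (H : (1 - Cmod x * ((1 - Cmod q ^ n) / (1 - Cmod q)) <= Cmod (pochn x q n))%R).
{ unfold pochn; induction n as [|n IH]; cbn [Cprod].
  - rewrite Cmod_1; cbn; replace (Cmod x * ((1 - 1) / (1 - Cmod q)))%R with 0%R by (field; lra); lra.
  - rewrite Cmod_mult.
    assert (Hqn : (0 <= Cmod q ^ n <= 1)%R)
      by (split; [apply pow_le, Hq0 | rewrite <- (pow1 n); apply pow_incr; lra]).
    assert (Hgn := Hg n).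
    set (s := (Cmod x * ((1 - Cmod q ^ n) / (1 - Cmod q)))%R) in *.
    replace (Cmod x * ((1 - Cmod q ^ S n) / (1 - Cmod q)))%R
      with (s + Cmod x * Cmod q ^ n)%R by (unfold s; cbn; field; lra).
    assert (Hs : (0 <= s)%R).
    { unfold s; apply Rmult_le_pos; [exact Hx0 |]; apply Rmult_le_pos;
      [lra | left; apply Rinv_0_lt_compat; lra]. }
    assert (Hl := Cmod_1_minus_ge (x * q ^ n)); rewrite Cmod_mult, Cmod_pow in Hl.
    assert (Hxq : (Cmod x * Cmod q ^ n <= 1)%R).
    { apply Rle_trans with (Cmod x / (1 - Cmod q))%R; [| lra].
      unfold Rdiv; apply Rmult_le_compat_l; [exact Hx0 |].
      apply Rle_trans with 1%R; [lra |]; rewrite <- Rinv_1; apply Rinv_le_contravar; lra. }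
    assert (0 <= Cmod x * Cmod q ^ n)%R by (apply Rmult_le_pos; lra).
    apply Rle_trans with ((1 - s) * (1 - Cmod x * Cmod q ^ n))%R; [nra |].
    apply Rmult_le_compat; lra. }
specialize (Hg n); lra.
Qed.

(** After finitely many nonzero factors have been split off, the remaining products have modulus
    above 1/2, uniformly, by [pochn_lower]; the limit therefore stays away from 0. *)
Lemma poch_neq0 (x q : C) : (Cmod q < 1)%R -> (forall k, x * q ^ k <> 1) -> poch x q <> 0.
Proof.
intros Hq H E.
assert (Hl : is_lim_seq (fun n => Cmod x / (1 - Cmod q) * Cmod q ^ n)%R (Cmod x / (1 - Cmod q) * 0)%R).
{ apply is_lim_seq_mult'; [apply is_lim_seq_const | apply is_lim_seq_geom].
  rewrite Rabs_pos_eq; [exact Hq | apply Cmod_ge_0]. }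
rewrite Rmult_0_r in Hl; apply is_lim_seq_spec in Hl.
destruct (Hl (mkposreal (1 / 2) ltac:(lra))) as [N HN].
specialize (HN N (Nat.le_refl N)); cbn in HN; rewrite Rminus_0_r in HN.
assert (HN' := Rle_lt_trans _ _ _ (Rle_abs _) HN); clear HN.
assert (Hn0 : pochn x q N <> 0).
{ apply Cprod_neq0; intros k _ E'; apply (H k).
  replace (x * q ^ k) with (1 - (1 - x * q ^ k)) by ring; rewrite E'; ring. }
assert (Hc := pochn_cv x q Hq); rewrite E in Hc.
apply Cmod_gt_0 in Hn0.
destruct (proj1 (Ccv_eps _ _) Hc (Cmod (pochn x q N) / 2)%R ltac:(lra)) as [M HM].
specialize (HM (N + M)%nat ltac:(lia)).
replace (pochn x q (N + M) - 0) with (pochn x q (N + M)) in HM by ring.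
rewrite pochn_add, Cmod_mult in HM.
assert (h := pochn_lower (x * q ^ N) q M Hq); rewrite Cmod_mult, Cmod_pow in h.
replace (Cmod x * Cmod q ^ N / (1 - Cmod q))%R
  with (Cmod x / (1 - Cmod q) * Cmod q ^ N)%R in h by (field; lra).
nra.
Qed.

Lemma Ccv_bound (u : nat -> C) (l : C) : Ccv u l ->
  exists B, (0 <= B)%R /\ forall n, (Cmod (u n) <= B)%R.
Proof.
intros H; destruct (proj1 (Ccv_eps _ _) H 1%R ltac:(lra)) as [N HN].
assert (Hf : exists B, (0 <= B)%R /\ forall n, (n < N)%nat -> (Cmod (u n) <= B)%R).
{ clear HN; induction N as [|N [B [HB IH]]]; [exists 0%R; split; [lra | intros; lia] |].
  exists (Rmax B (Cmod (u N))); split; [eapply Rle_trans; [exact HB | apply Rmax_l] |].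
  intros n Hn; destruct (Nat.eq_dec n N) as [-> | Hne]; [apply Rmax_r |].
  eapply Rle_trans; [apply IH; lia | apply Rmax_l]. }
destruct Hf as [B [HB Hf]]; assert (Hl := Cmod_ge_0 l).
exists (B + (Cmod l + 1))%R; split; [lra |]; intros n.
destruct (le_lt_dec N n) as [Hn | Hn]; [| specialize (Hf n Hn); lra].
specialize (HN n Hn); assert (h := Cmod_triangle (u n - l) l).
replace (u n - l + l) with (u n) in h by ring; lra.
Qed.

Lemma pochn_neq0 (x q : C) (n : nat) : (forall k, x * q ^ k <> 1) -> pochn x q n <> 0.
Proof.
intros H; apply Cprod_neq0; intros k _ E'; apply (H k).
replace (x * q ^ k) with (1 - (1 - x * q ^ k)) by ring; rewrite E'; ring.
Qed.

Lemma pochn_inv_bound (x q : C) : (Cmod q < 1)%R -> (forall k, x * q ^ k <> 1) ->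
  exists B, (0 <= B)%R /\ forall n, (Cmod (/ pochn x q n) <= B)%R.
Proof.
intros Hq H; apply Ccv_bound with (/ poch x q), Ccv_inv; [apply poch_neq0 | apply pochn_cv]; auto.
Qed.

Lemma poch_S (x q : C) : (Cmod q < 1)%R -> poch x q = (1 - x) * poch (x * q) q.
Proof.
intros Hq; apply Ccv_unique with (fun n => pochn x q (S n)).
- apply (Ccv_subseq (pochn x q)); [lia | apply pochn_cv, Hq].
- apply Ccv_ext with (fun n => (1 - x) * pochn (x * q) q n).
  + intros n; unfold pochn; rewrite Cprod_S_l; cbn [Cpow]; rewrite Cmult_1_r.
    f_equal; apply Cprod_ext; intros; ring.
  + apply Ccv_scal, pochn_cv, Hq.
Qed.

Lemma Cmod_pow_lt1 (q : C) (n : nat) : (0 < n)%nat -> (Cmod q < 1)%R -> (Cmod (q ^ n) < 1)%R.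
Proof.
intros Hn Hq; rewrite Cmod_pow; destruct n; [lia |].
assert (h := Cmod_ge_0 q); cbn.
assert (Cmod q ^ n <= 1)%R by (rewrite <- (pow1 n); apply pow_incr; lra).
assert (0 <= Cmod q ^ n)%R by (apply pow_le; lra); nra.
Qed.

Lemma poch_split2 (x q : C) : (Cmod q < 1)%R ->
  poch x q = poch x (q ^ 2) * poch (x * q) (q ^ 2).
Proof.
intros Hq; apply Ccv_unique with (fun n => pochn x q (2 * n)).
- apply (Ccv_subseq (pochn x q)); [lia | apply pochn_cv, Hq].
- apply Ccv_ext with (fun n => pochn x (q ^ 2) n * pochn (x * q) (q ^ 2) n).
  + induction n as [|n IH]; [cbn; ring |].
    replace (2 * S n)%nat with (S (S (2 * n))) by lia.
    unfold pochn in *; cbn [Cprod]; rewrite <- IH, <- !Cpow_mult_r, (Cpow_S q (2 * n)); ring.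
  + apply Ccv_mult; apply pochn_cv, Cmod_pow_lt1; auto.
Qed.

Lemma poch_split3 (x q : C) : (Cmod q < 1)%R ->
  poch x q = poch x (q ^ 3) * poch (x * q) (q ^ 3) * poch (x * q ^ 2) (q ^ 3).
Proof.
intros Hq; apply Ccv_unique with (fun n => pochn x q (3 * n)).
- apply (Ccv_subseq (pochn x q)); [lia | apply pochn_cv, Hq].
- apply Ccv_ext with (fun n => pochn x (q ^ 3) n * pochn (x * q) (q ^ 3) n
    * pochn (x * q ^ 2) (q ^ 3) n).
  + induction n as [|n IH]; [cbn; ring |].
    replace (3 * S n)%nat with (S (S (S (3 * n)))) by lia.
    unfold pochn in *; cbn [Cprod]; rewrite <- IH, <- !Cpow_mult_r, (Cpow_S q (S (3 * n))), (Cpow_S q (3 * n)); ring.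
  + repeat apply Ccv_mult; apply pochn_cv, Cmod_pow_lt1; auto; lia.
Qed.

Lemma poch_sqr (x q : C) : (Cmod q < 1)%R ->
  poch (x ^ 2) (q ^ 2) = poch x q * poch (- x) q.
Proof.
intros Hq; apply Ccv_unique with (fun n => pochn (x ^ 2) (q ^ 2) n).
- apply pochn_cv, Cmod_pow_lt1; auto.
- apply Ccv_ext with (fun n => pochn x q n * pochn (- x) q n).
  + intros n; unfold pochn; rewrite <- Cprod_mult; apply Cprod_ext; intros k _.
    rewrite <- Cpow_mult_r, Nat.mul_comm, Cpow_mult_r; ring.
  + apply Ccv_mult; apply pochn_cv; auto.
Qed.

Lemma e2pi_pow (w : C) (n : nat) : e2pi w ^ n = e2pi (INR n * w).
Proof.
induction n as [|n IH]; [cbn [Cpow]; rewrite <- e2pi_0; f_equal; cbn; ring |].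
rewrite Cpow_S, IH, <- e2pi_plus; f_equal; push_RtoC; ring.
Qed.

Lemma Cmod_e2pi_lt1 (T : C) : (0 < Im T)%R -> (Cmod (e2pi T) < 1)%R.
Proof.
intros H; rewrite Cmod_e2pi, <- exp_0; apply exp_increasing.
assert (h := PI_RGT_0); assert (0 < 2 * PI * Im T)%R by (apply Rmult_lt_0_compat; lra); lra.
Qed.

(** Induction on the number of nodes. The induction hypothesis is used twice, at [t] and at the new
    node [s m], because [1 / ((s_k - t) (s_m - s_k))] is [1 / (s_m - t)] times the difference of
    [1 / (s_k - t)] and [1 / (s_k - s_m)]. *)
Lemma partial_fractions (s : nat -> C) (n : nat) : (0 < n)%nat ->
  (forall j k, (j < n)%nat -> (k < n)%nat -> j <> k -> s j <> s k) ->
  forall t, (forall k, (k < n)%nat -> s k <> t) ->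
  csum (fun k => / (s k - t) *
    / Cprod (fun j => if Nat.eqb j k then 1 else s j - s k) n) n
  = / Cprod (fun k => s k - t) n.
Proof.
assert (Hnz : forall a b : C, a <> b -> a - b <> 0).
{ intros a b H E; apply H; replace a with (b + (a - b)) by ring; rewrite E; ring. }
destruct n as [|n]; [lia | intros _]; induction n as [|n IH]; intros Hs t Ht.
- cbn; field; apply Hnz, Ht; lia.
- set (m := S n) in *.
  change (csum ?f (S m)) with (csum f m + f m).
  change (Cprod ?f (S m)) with (Cprod f m * f m).
  assert (Hm := Hnz _ _ (Ht m (Nat.lt_succ_diag_r m))).
  assert (IHt := IH (fun j k hj hk => Hs j k ltac:(lia) ltac:(lia)) t (fun k hk => Ht k ltac:(lia))).
  assert (IHm := IH (fun j k hj hk => Hs j k ltac:(lia) ltac:(lia)) (s m)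
    (fun k hk => Hs k m ltac:(lia) ltac:(lia) ltac:(lia))).
  set (W := fun k => Cprod (fun j => if Nat.eqb j k then 1 else s j - s k) m) in *.
  assert (HW : forall k, (k < m)%nat -> W k <> 0).
  { intros k Hk; apply Cprod_neq0; intros j Hj; destruct (Nat.eqb_spec j k); [exact C1_nz |].
    apply Hnz, Hs; lia. }
  rewrite (csum_ext _ (fun k => / (s m - t) * (/ (s k - t) * / W k)
    + (- (1) * / (s m - t)) * (/ (s k - s m) * / W k))).
  + rewrite csum_plus, !csum_scal.
    change (csum (fun k => / (s k - t) * / W k) m = / Cprod (fun k => s k - t) m) in IHt.
    change (csum (fun k => / (s k - s m) * / W k) m = / Cprod (fun k => s k - s m) m) in IHm.
    rewrite IHt, IHm, Nat.eqb_refl.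
    rewrite (Cprod_ext (fun j => if Nat.eqb j m then 1 else s j - s m) (fun j => s j - s m)).
    2:{ intros j Hj; destruct (Nat.eqb_spec j m); [lia | reflexivity]. }
    assert (Cprod (fun k => s k - s m) m <> 0)
      by (apply Cprod_neq0; intros; apply Hnz, Hs; lia).
    assert (Cprod (fun k => s k - t) m <> 0)
      by (apply Cprod_neq0; intros; apply Hnz, Ht; lia).
    field; auto.
  + intros k Hk; change (Cprod ?f (S m)) with (Cprod f m * f m); cbv beta.
    fold (W k); destruct (Nat.eqb_spec m k); [lia |].
    assert (h1 := Hnz _ _ (Ht k ltac:(lia))).
    assert (h2 := Hnz _ _ (Hs m k ltac:(lia) ltac:(lia) ltac:(lia))).
    assert (h3 := Hnz _ _ (Hs k m ltac:(lia) ltac:(lia) ltac:(lia))).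
    assert (h4 := HW k Hk); field; auto.
Qed.

(** * The Jacobi triple product *)

(** Gaussian binomial coefficients, given by the q-Pascal rule so that no division occurs;
    [gbin_pochn] supplies the quotient form. Where the natural subtraction truncates, the
    coefficient multiplied by it is 0. *)
Fixpoint gbin (q : C) (n k : nat) : C :=
  match n, k with
  | _, O => 1
  | O, S _ => 0
  | S n', S k' => gbin q n' (S k') + q ^ (n' - k') * gbin q n' k'
  end.

Lemma gbin_gt (q : C) (n k : nat) : (n < k)%nat -> gbin q n k = 0.
Proof.
revert k; induction n as [|n IH]; intros [|k] H; try lia; [reflexivity |].
cbn [gbin]; rewrite !IH by lia; ring.
Qed.

Lemma gbin_0 (q : C) (n : nat) : gbin q n 0 = 1.
Proof. destruct n; reflexivity. Qed.

Lemma pochn_S (x q : C) (n : nat) : pochn x q (S n) = pochn x q n * (1 - x * q ^ n).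
Proof. reflexivity. Qed.

Lemma gbin_pochn (q : C) (n k : nat) : (k <= n)%nat ->
  gbin q n k * (pochn q q k * pochn q q (n - k)) = pochn q q n.
Proof.
revert k; induction n as [|n IH]; intros [|k] H; try lia.
- cbn; ring.
- rewrite gbin_0, Nat.sub_0_r; change (pochn q q 0) with (RtoC 1); ring.
- cbn [gbin]; replace (S n - S k)%nat with (n - k)%nat by lia.
  destruct (Nat.eq_dec k n) as [-> | Hk].
  + rewrite gbin_gt, Nat.sub_diag by lia; cbn [Cpow].
    assert (h := IH n (Nat.le_refl n)); rewrite Nat.sub_diag in h.
    change (pochn q q 0) with (RtoC 1) in *; rewrite !pochn_S; rewrite <- h at 2; ring.
  + assert (h1 := IH (S k) ltac:(lia)); assert (h2 := IH k ltac:(lia)).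
    replace (n - k)%nat with (S (n - S k)) in * by lia.
    rewrite !pochn_S in *.
    replace (q ^ n) with (q ^ (n - S k) * q ^ S k)
      by (rewrite <- Cpow_add_r; f_equal; lia).
    rewrite Cmult_plus_distr_r.
    replace (pochn q q n) with (gbin q n (S k) * (pochn q q k * (1 - q * q ^ k) * pochn q q (n - S k))).
    rewrite !Cpow_S in *.
    set (A := gbin q n (S k)) in *; set (B := gbin q n k) in *.
    set (u := pochn q q k) in *; set (v := pochn q q (n - S k)) in *.
    set (x := q ^ (n - S k)) in *; set (y := q ^ k) in *.
    transitivity (A * (u * (1 - q * y) * v) * (1 - q * x)
      + q * x * (B * (u * (v * (1 - q * x)))) * (1 - q * y)); [ring |].
    rewrite h2, h1; ring.
Qed.

(** The q-binomial theorem for [q = e2pi T]. Multiplying by the factor with index [n] reproduces the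
    q-Pascal rule once the powers of [q] are collected in one exponent. *)
Lemma q_binomial (T v : C) (n : nat) :
  Cprod (fun k => 1 + e2pi (v + INR k * T)) n =
  csum (fun k => gbin (e2pi T) n k * e2pi (INR k * v + T * (INR k * (INR k - 1) / 2))) (S n).
Proof.
induction n as [|n IH].
- cbn; replace (0 * v + T * (0 * (0 - 1) / 2)) with (RtoC 0) by field.
  rewrite e2pi_0; ring.
- cbn [Cprod]; rewrite IH.
  set (t := fun k => e2pi (INR k * v + T * (INR k * (INR k - 1) / 2))).
  change (csum (fun k => gbin (e2pi T) n k * t k) (S n) * (1 + e2pi (v + INR n * T))
    = csum (fun k => gbin (e2pi T) (S n) k * t k) (S (S n))).
  rewrite (csum_S_l _ (S n)), gbin_0.
  rewrite (csum_ext (fun k => gbin (e2pi T) (S n) (S k) * t (S k))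
    (fun k => gbin (e2pi T) n (S k) * t (S k)
      + e2pi (v + INR n * T) * (gbin (e2pi T) n k * t k)) (S n)).
  + rewrite csum_plus, csum_scal.
    assert (h := csum_S_l (fun k => gbin (e2pi T) n k * t k) (S n)).
    change (csum ?f (S (S n))) with (csum f (S n) + f (S n)) in h; cbv beta in h.
    rewrite (gbin_gt _ n (S n)) in h by lia; rewrite gbin_0 in h.
    rewrite Cmult_plus_distr_l, Cmult_1_r, Cplus_assoc, <- h; ring.
  + intros k Hk; cbn [gbin]; rewrite Cmult_plus_distr_r; f_equal.
    rewrite e2pi_pow; unfold t.
    rewrite <- Cmult_assoc, (Cmult_comm (gbin _ _ _)), Cmult_assoc, <- e2pi_plus.
    rewrite (Cmult_comm (gbin _ _ _)), Cmult_assoc, <- e2pi_plus.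
    f_equal; f_equal; rewrite minus_INR by lia; push_RtoC; field.
Qed.

(** From each factor with a negative power of [q] the monomial [- e2pi (x - i T)] is pulled out. The
    sign [(-1)^n] is kept as [e2pi (n / 2)], so that a whole prefactor is one exponential and
    comparing prefactors is comparing exponents. *)
Lemma Cprod_neg (T x : C) (n : nat) :
  Cprod (fun i => 1 - e2pi (x - INR (S i) * T)) n =
  e2pi (INR n / 2 + INR n * x - T * (INR n * (INR n + 1) / 2)) * pochn (e2pi (T - x)) (e2pi T) n.
Proof.
induction n as [|n IH].
- cbn; replace (0 / 2 + 0 * x - T * (0 * (0 + 1) / 2)) with (RtoC 0) by field.
  rewrite e2pi_0; ring.
- cbn [Cprod]; rewrite IH, pochn_S, e2pi_pow, <- e2pi_plus.
  replace (T - x + INR n * T) with (- (x - INR (S n) * T)) by (push_RtoC; ring).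
  set (w := x - INR (S n) * T).
  replace (e2pi (INR (S n) / 2 + INR (S n) * x - T * (INR (S n) * (INR (S n) + 1) / 2)))
    with (- (e2pi w * e2pi (INR n / 2 + INR n * x - T * (INR n * (INR n + 1) / 2)))).
  + rewrite e2pi_opp; field; apply e2pi_neq0.
  + rewrite <- e2pi_plus; replace (- e2pi (w + _)) with (e2pi (1 / 2) * e2pi (w +
      (INR n / 2 + INR n * x - T * (INR n * (INR n + 1) / 2)))) by (rewrite e2pi_half; ring).
    rewrite <- e2pi_plus; f_equal; unfold w; push_RtoC; field.
Qed.

Lemma pochn_e2pi (x T : C) (n : nat) :
  pochn (e2pi x) (e2pi T) n = Cprod (fun i => 1 - e2pi (x + INR i * T)) n.
Proof.
apply Cprod_ext; intros k _; rewrite e2pi_pow, <- e2pi_plus; reflexivity.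
Qed.

Lemma e2pi_pow_neq1 (T : C) (k : nat) : (0 < Im T)%R -> e2pi T * e2pi T ^ k <> 1.
Proof.
intros HT E; apply (f_equal Cmod) in E; revert E; rewrite <- Cpow_S, Cmod_1.
assert (h := Cmod_pow_lt1 (e2pi T) (S k) ltac:(lia) (Cmod_e2pi_lt1 T HT)); lra.
Qed.

Lemma poch_e2pi_self_neq0 (T : C) : (0 < Im T)%R -> poch (e2pi T) (e2pi T) <> 0.
Proof.
intros HT; apply poch_neq0; [apply Cmod_e2pi_lt1, HT | intros; apply e2pi_pow_neq1, HT].
Qed.

Lemma triple_product_finite (T u : C) (N : nat) : (0 < Im T)%R ->
  pochn (e2pi u) (e2pi T) N * pochn (e2pi (T - u)) (e2pi T) (S N) =
  psum (S N) (fun n => gbin (e2pi T) (2 * N + 1) (Z.to_nat (n + Z.of_nat (S N)))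
    * e2pi (IZR n / 2 + IZR n * u + T * (IZR n * (IZR n - 1) / 2))).
Proof.
intros HT; rewrite psum_csum; set (M := S N).
assert (H := q_binomial T (u - INR M * T + 1 / 2) (2 * N + 1)).
replace (2 * M)%nat with (S (2 * N + 1)) by lia.
assert (HL : Cprod (fun k => 1 + e2pi (u - INR M * T + 1 / 2 + INR k * T)) (2 * N + 1)
  = Cprod (fun i => 1 - e2pi (u - INR (S i) * T)) M * pochn (e2pi u) (e2pi T) N).
{ replace (2 * N + 1)%nat with (M + N)%nat by lia.
  rewrite Cprod_add, Cprod_rev, pochn_e2pi; f_equal; apply Cprod_ext; intros k Hk.
  - rewrite minus_INR by lia.
    replace (u - INR M * T + 1 / 2 + (INR M - INR (S k))%R * T)
      with (1 / 2 + (u - INR (S k) * T)) by (push_RtoC; ring).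
    rewrite e2pi_plus, e2pi_half; ring.
  - replace (u - INR M * T + 1 / 2 + INR (M + k) * T)
      with (1 / 2 + (u + INR k * T)) by (push_RtoC; ring).
    rewrite e2pi_plus, e2pi_half; ring. }
rewrite HL, Cprod_neg in H.
set (c := e2pi (INR M / 2 + INR M * u - T * (INR M * (INR M + 1) / 2))) in *.
assert (Hc : c <> 0) by apply e2pi_neq0.
transitivity (/ c * (c * pochn (e2pi (T - u)) (e2pi T) M * pochn (e2pi u) (e2pi T) N)).
{ field; exact Hc. }
rewrite H, <- csum_scal; apply csum_ext; intros k Hk.
replace (Z.to_nat _) with k by lia.
rewrite minus_IZR, <- !INR_IZR_INZ.
unfold c; rewrite <- e2pi_opp, Cmult_assoc, (Cmult_comm (e2pi (- _))), <- Cmult_assoc, <- e2pi_plus.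
f_equal; f_equal; push_RtoC; field.
Qed.

(** Dominated convergence in the finite identity: the Gaussian binomials are quotients of Pochhammer
    symbols, hence uniformly bounded, and each tends to [/ poch q q]. *)
Lemma triple_product (T u : C) : (0 < Im T)%R ->
  CSumZ (fun n => e2pi (IZR n / 2 + IZR n * u + T * (IZR n * (IZR n - 1) / 2))) =
  poch (e2pi T) (e2pi T) * (poch (e2pi u) (e2pi T) * poch (e2pi (T - u)) (e2pi T)).
Proof.
intros HT; assert (Hq := Cmod_e2pi_lt1 T HT); set (q := e2pi T) in *.
set (f := fun n => e2pi (IZR n / 2 + IZR n * u + T * (IZR n * (IZR n - 1) / 2))).
assert (Hq0 := poch_e2pi_self_neq0 T HT); fold q in Hq0.
assert (Hqn : forall n, pochn q q n <> 0)
  by (intros; apply pochn_neq0; intros; apply e2pi_pow_neq1, HT).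
destruct (bd_gauss (T / 2) (1 / 2 + u - T / 2) 0 f) as [K HK].
{ replace (Im (T / 2)) with (Im T / 2)%R by (destruct T; cbn; field); lra. }
{ intros n; unfold f; f_equal; field. }
set (g := fun N n => gbin q (2 * N + 1) (Z.to_nat (n + Z.of_nat (S N)))).
assert (Hg : forall N n, (- Z.of_nat (S N) <= n < Z.of_nat (S N))%Z ->
  g N n = pochn q q (2 * N + 1) * (/ pochn q q (Z.to_nat (n + Z.of_nat (S N)))
    * / pochn q q (Z.to_nat (Z.of_nat N - n)))).
{ intros N n Hn; unfold g.
  rewrite <- (gbin_pochn q (2 * N + 1) (Z.to_nat (n + Z.of_nat (S N)))) by lia.
  replace (2 * N + 1 - Z.to_nat (n + Z.of_nat (S N)))%nat with (Z.to_nat (Z.of_nat N - n)) by lia.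
  field; auto. }
destruct (Ccv_bound _ _ (pochn_cv q q Hq)) as [B1 [HB1 H1]].
destruct (pochn_inv_bound q q Hq) as [B2 [HB2 H2]].
{ intros; apply e2pi_pow_neq1, HT. }
(* The index is moved by one because the finite identity for [N] lives on the window of length
   [N + 1]; the value at 0 is a placeholder on an empty window. *)
set (v := fun N n => match N with O => RtoC 0 | S N' => g N' n * f n end).
assert (Hcv : Ccv (fun N => psum N (v N)) (CSumZ (fun n => / poch q q * f n))).
{ apply psum_tannery with (B1 * (B2 * B2) * K)%R.
  - intros [|N] n Hn; [lia |]; cbn [v]; rewrite Hg by lia.
    assert (HKn := HK n); unfold Rdiv; rewrite Rmult_assoc.
    apply Cmod_mult_le; [| exact HKn].
    repeat apply Cmod_mult_le; auto.
  - intros n.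
    apply Ccv_ext_loc with (N0 := S (Z.abs_nat n)) (u := fun N =>
      pochn q q (2 * (N - 1) + 1) * (/ pochn q q (Z.to_nat (n + Z.of_nat N))
      * / pochn q q (Z.to_nat (Z.of_nat N - 1 - n))) * f n).
    { intros [|N] HN; [lia |]; cbn [v]; rewrite Hg by lia.
      replace (S N - 1)%nat with N by lia.
      replace (Z.of_nat (S N) - 1 - n)%Z with (Z.of_nat N - n)%Z by lia; reflexivity. }
    apply Ccv_mult; [| apply Ccv_const].
    replace (/ poch q q) with (poch q q * (/ poch q q * / poch q q)) by (field; exact Hq0).
    assert (Hsub : forall phi : nat -> nat, (exists m, forall N, (N <= phi N + m)%nat) ->
      Ccv (fun N => pochn q q (phi N)) (poch q q)).
    { intros phi [m Hphi]; apply Ccv_eps; intros eps He.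
      destruct (proj1 (Ccv_eps _ _) (pochn_cv q q Hq) eps He) as [N0 HN0].
      exists (N0 + m)%nat; intros N HN; apply HN0; specialize (Hphi N); lia. }
    apply Ccv_mult; [apply Hsub; exists 1%nat; lia |].
    apply Ccv_mult; apply Ccv_inv; try exact Hq0; apply Hsub;
      [exists (Z.abs_nat n) | exists (1 + Z.abs_nat n)%nat]; lia. }
assert (Hcv2 : Ccv (fun N => psum N (v N)) (poch (e2pi u) q * poch (e2pi (T - u)) q)).
{ apply Ccv_ext_loc with (N0 := 1%nat) (u := fun N =>
    pochn (e2pi u) q (N - 1) * pochn (e2pi (T - u)) q N).
  - intros [|N] HN; [lia |]; replace (S N - 1)%nat with N by lia.
    exact (triple_product_finite T u N HT).
  - apply Ccv_mult; [| apply pochn_cv, Hq].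
    apply Ccv_eps; intros eps He.
    destruct (proj1 (Ccv_eps _ _) (pochn_cv (e2pi u) q Hq) eps He) as [N0 HN0].
    exists (S N0); intros N HN; apply HN0; lia. }
rewrite (CSumZ_scal K _ _ HK) in Hcv.
rewrite (Ccv_unique _ _ _ Hcv2 Hcv); field; exact Hq0.
Qed.

(** * The denominator identity *)

Lemma C1_minus_neq0 (a : C) : a <> 1 -> 1 - a <> 0.
Proof. intros H E; apply H; replace a with (1 - (1 - a)) by ring; rewrite E; ring. Qed.

Lemma Cinv_neq0 (a : C) : a <> 0 -> / a <> 0.
Proof. intros H E; apply C1_nz; rewrite <- (Cinv_r a H), E; ring. Qed.

Lemma Cdiv_neq0 (a b : C) : a <> 0 -> b <> 0 -> a / b <> 0.
Proof. intros; apply Cmult_neq_0; auto using Cinv_neq0. Qed.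

Ltac one_minus_e2pi :=
  cbv beta; match goal with |- Cminus _ (e2pi ?a) = Cminus _ (e2pi ?b) => cut (a = b); [intros ->; reflexivity | push_RtoC; ring] end.

Lemma Cprod_center (f : Z -> C) (M k : nat) : (k <= M)%nat ->
  Cprod (fun j => f (Z.of_nat j - Z.of_nat k)%Z) M =
  Cprod (fun i => f (- Z.of_nat (S i))%Z) k * Cprod (fun i => f (Z.of_nat i)) (M - k).
Proof.
intros Hk; replace M with (k + (M - k))%nat at 1 by lia; rewrite Cprod_add, Cprod_rev; f_equal;
  apply Cprod_ext; intros i Hi; f_equal; lia.
Qed.

Lemma Cprod_skip (F : nat -> C) (M k : nat) : (k < M)%nat ->
  Cprod (fun j => if Nat.eqb j k then 1 else F j) M * F k = Cprod F M.
Proof.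
induction M as [|M IH]; intros Hk; [lia |]; cbn [Cprod].
destruct (Nat.eqb_spec M k) as [E | E].
- rewrite (Cprod_ext _ F); [rewrite E; ring |].
  intros j Hj; destruct (Nat.eqb_spec j k); [lia | reflexivity].
- rewrite <- IH by lia; ring.
Qed.

(* The [n]-th term of [Phi1 1 1] minus the [- n]-th term of [Phi2 1 1], without the factor in [t]. *)
Definition appell_term (T al be : C) (n : Z) : C :=
  e2pi (IZR n * (al + be) + T * IZR n ^ 2) * (1 - e2pi (al + be + 2 * IZR n * T))
  / ((1 - e2pi (al + IZR n * T)) * (1 - e2pi (be + IZR n * T))).

(** By [e2pi_eq1] this says that [u] lies off the lattice [Z + Z T], where the theta function [J T]
    below has its zeros. *)
Definition generic (T u : C) : Prop := forall n : Z, e2pi (u + IZR n * T) <> 1.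

Lemma e2pi_self_neq1 (T : C) (n : Z) : (0 < Im T)%R -> (n <> 0)%Z -> e2pi (IZR n * T) <> 1.
Proof.
intros HT Hn E; apply (f_equal Cmod) in E; rewrite Cmod_e2pi, Cmod_1, <- exp_0 in E.
apply exp_inv in E; assert (h := PI_RGT_0).
replace (Im (IZR n * T)) with (IZR n * Im T)%R in E by (destruct T; cbn; ring).
assert (Hz : (IZR n * (PI * Im T) = 0)%R) by lra.
apply Rmult_integral in Hz; destruct Hz as [Hz | Hz].
- apply Hn, eq_IZR, Hz.
- apply Rmult_integral in Hz; destruct Hz; lra.
Qed.

(** Put [q = e2pi T], [a = e2pi al], [b = e2pi be]. Partial fractions are taken at [t = a + b] with
    nodes [s_n = q^(-n) + a b q^n], for which everything factors:
    [s_n - t = q^(-n) (1 - a q^n) (1 - b q^n)] and [s_j - s_k = q^(-j) (1 - q^(j - k)) (1 - a b q^(j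
    + k))]. All products over the nodes are then Pochhammer symbols up to monomials. *)
Lemma appell_finite (T al be : C) (N : nat) :
  (0 < Im T)%R -> generic T al -> generic T be -> generic T (al + be) ->
  psum (S N) (fun n => appell_term T al be n *
    / (pochn (e2pi T) (e2pi T) (Z.to_nat (n + Z.of_nat (S N))) *
       pochn (e2pi T) (e2pi T) (Z.to_nat (Z.of_nat N - n)) *
       pochn (e2pi (T - (al + be))) (e2pi T) (Z.to_nat (Z.of_nat (S N) - n)) *
       pochn (e2pi (al + be)) (e2pi T) (Z.to_nat (n + Z.of_nat (S N))))) =
  / (pochn (e2pi al) (e2pi T) (S N) * pochn (e2pi (T - al)) (e2pi T) (S N) *
     pochn (e2pi be) (e2pi T) (S N) * pochn (e2pi (T - be)) (e2pi T) (S N)).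
Proof.
intros HT Ha Hb Hc; set (M := S N); set (ga := al + be) in *.
set (nd := fun k : nat => (Z.of_nat k - Z.of_nat M)%Z).
set (s := fun k => e2pi (- (IZR (nd k) * T)) + e2pi (ga + IZR (nd k) * T)).
set (X := fun k => (1 - e2pi (al + IZR (nd k) * T)) * (1 - e2pi (be + IZR (nd k) * T))).
assert (HX : forall k, X k <> 0).
{ intros k; apply Cmult_neq_0; apply C1_minus_neq0; [apply Ha | apply Hb]. }
assert (Hst : forall k, s k - (e2pi al + e2pi be) = e2pi (- (IZR (nd k) * T)) * X k).
{ intros k; unfold s, X, ga; rewrite e2pi_opp, !e2pi_plus; field; apply e2pi_neq0. }
(* The value 1 at [m = 0] stands for the factor [j = k] that partial fractions leave out. *)
set (A := fun m : Z => if Z.eqb m 0 then RtoC 1 else 1 - e2pi (IZR m * T)).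
assert (HA : forall m, A m <> 0).
{ intros m; unfold A; destruct (Z.eqb_spec m 0); [exact C1_nz |].
  apply C1_minus_neq0, e2pi_self_neq1; assumption. }
set (B := fun m : Z => 1 - e2pi (ga + IZR m * T)).
assert (HB : forall m, B m <> 0) by (intros m; apply C1_minus_neq0, Hc).
assert (Hss : forall j k, j <> k ->
  s j - s k = e2pi (- (IZR (nd j) * T)) * A (nd j - nd k)%Z * B (nd j + nd k)%Z).
{ intros j k Hjk; unfold A; destruct (Z.eqb_spec (nd j - nd k) 0) as [E | E]; [unfold nd in E; lia |].
  unfold s, B; rewrite minus_IZR, plus_IZR, RtoC_minus, RtoC_plus.
  replace ((IZR (nd j) - IZR (nd k)) * T) with (IZR (nd j) * T + - (IZR (nd k) * T)) by ring.
  replace ((IZR (nd j) + IZR (nd k)) * T) with (IZR (nd j) * T + IZR (nd k) * T) by ring.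
  rewrite !e2pi_plus, !e2pi_opp; field; split; apply e2pi_neq0. }
assert (Hnz : forall a b : C, a - b <> 0 -> a <> b) by (intros a b H E; apply H; rewrite E; ring).
assert (L := partial_fractions s (2 * M) ltac:(lia)
  (fun j k _ _ hjk => Hnz _ _ ltac:(rewrite Hss by exact hjk;
     repeat apply Cmult_neq_0; auto using e2pi_neq0))
  (e2pi al + e2pi be) (fun k _ => Hnz _ _ ltac:(rewrite Hst; apply Cmult_neq_0; auto using e2pi_neq0))).
set (D := Cprod (fun j => e2pi (- (IZR (nd j) * T))) (2 * M)).
assert (HD : D <> 0) by (apply Cprod_neq0; intros; apply e2pi_neq0).
assert (HR : Cprod (fun k => s k - (e2pi al + e2pi be)) (2 * M)
  = D * (e2pi (INR M * ga - T * (INR M * (INR M + 1))) *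
   (pochn (e2pi al) (e2pi T) M * pochn (e2pi (T - al)) (e2pi T) M *
     pochn (e2pi be) (e2pi T) M * pochn (e2pi (T - be)) (e2pi T) M))).
{ rewrite (Cprod_ext _ _ _ (fun k _ => Hst k)), Cprod_mult; fold D; f_equal.
  unfold X; rewrite Cprod_mult.
  assert (Hx : forall x, Cprod (fun k => 1 - e2pi (x + IZR (nd k) * T)) (2 * M)
    = e2pi (INR M / 2 + INR M * x - T * (INR M * (INR M + 1) / 2))
      * pochn (e2pi (T - x)) (e2pi T) M * pochn (e2pi x) (e2pi T) M).
  { intros x; unfold nd; rewrite (Cprod_center (fun m => 1 - e2pi (x + IZR m * T)) (2 * M) M) by lia.
    replace (2 * M - M)%nat with M by lia.
    rewrite <- Cprod_neg, pochn_e2pi; f_equal; apply Cprod_ext; intros i _.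
    - rewrite opp_IZR, <- INR_IZR_INZ; one_minus_e2pi.
    - rewrite <- INR_IZR_INZ; reflexivity. }
  rewrite !Hx.
  replace (e2pi (INR M * ga - T * (INR M * (INR M + 1)))) with
    (e2pi (INR M / 2 + INR M * al - T * (INR M * (INR M + 1) / 2)) *
     e2pi (INR M / 2 + INR M * be - T * (INR M * (INR M + 1) / 2))).
  - ring.
  - rewrite <- e2pi_plus, <- (Cmult_1_l (e2pi (INR M * ga - _))), <- (e2pi_nat M), <- e2pi_plus.
    f_equal; unfold ga; field. }
rewrite HR in L.
set (cst := e2pi (INR M * ga - T * (INR M * (INR M + 1)))) in *.
assert (Hcst : cst <> 0) by apply e2pi_neq0.
set (P := pochn (e2pi al) (e2pi T) M * pochn (e2pi (T - al)) (e2pi T) M *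
     pochn (e2pi be) (e2pi T) M * pochn (e2pi (T - be)) (e2pi T) M) in *.
assert (HP : P <> 0).
{ assert (hg : forall x, generic T x -> pochn (e2pi x) (e2pi T) M <> 0 /\
    pochn (e2pi (T - x)) (e2pi T) M <> 0).
  { intros x Hx; split; apply pochn_neq0; intros k; rewrite e2pi_pow, <- e2pi_plus.
    - rewrite INR_IZR_INZ; apply Hx.
    - intros E; apply (Hx (- (Z.of_nat k + 1))%Z).
      replace (x + _) with (- (T - x + INR k * T))
        by (rewrite opp_IZR, plus_IZR, <- INR_IZR_INZ; push_RtoC; ring).
      rewrite e2pi_opp, E; field. }
  destruct (hg al Ha), (hg be Hb); apply Cmult_neq_0; [apply Cmult_neq_0; [apply Cmult_neq_0 |] |]; assumption. }
transitivity (D * cst * / (D * (cst * P))); [| field; auto].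
rewrite <- L, <- csum_scal, psum_csum.
apply csum_ext; intros k Hk.
replace (Z.of_nat k - Z.of_nat M)%Z with (nd k) by reflexivity.
rewrite Hst.
replace (Z.to_nat (nd k + Z.of_nat M)) with k by (unfold nd; lia).
replace (Z.to_nat (Z.of_nat N - nd k)) with (2 * M - k - 1)%nat by (unfold nd, M; lia).
replace (Z.to_nat (Z.of_nat M - nd k)) with (2 * M - k)%nat by (unfold nd; lia).
rewrite (Cprod_ext _ (fun j =>
  (if Nat.eqb j k then 1 else e2pi (- (IZR (nd j) * T))) *
  (A (Z.of_nat j - Z.of_nat k)%Z * (if Nat.eqb j k then 1 else B (nd j + nd k)%Z)))).
2:{ intros j Hj; destruct (Nat.eqb_spec j k) as [-> | E].
  - rewrite Z.sub_diag; cbn; ring.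
  - rewrite Hss by exact E; replace (nd j - nd k)%Z with (Z.of_nat j - Z.of_nat k)%Z
      by (unfold nd; lia); ring. }
rewrite !Cprod_mult.
assert (E1 := Cprod_skip (fun j => e2pi (- (IZR (nd j) * T))) (2 * M) k Hk); fold D in E1.
(* The product over all [j] is a pair of Pochhammer symbols; the factor [j = k] added to complete
   it, [1 - a b q^(2 n)], becomes the second factor in the numerator of [appell_term]. *)
assert (E2 := Cprod_skip (fun j => B (nd j + nd k)%Z) (2 * M) k Hk).
set (D' := Cprod (fun j => if Nat.eqb j k then 1 else e2pi (- (IZR (nd j) * T))) (2 * M)) in *.
set (B' := Cprod (fun j => if Nat.eqb j k then 1 else B (nd j + nd k)%Z) (2 * M)) in *.
assert (E3 : Cprod (fun j => A (Z.of_nat j - Z.of_nat k)%Z) (2 * M) =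
  e2pi (INR k / 2 - T * (INR k * (INR k + 1) / 2)) * pochn (e2pi T) (e2pi T) k
  * pochn (e2pi T) (e2pi T) (2 * M - k - 1)).
{ rewrite (Cprod_center A) by lia; f_equal.
  - assert (h := Cprod_neg T 0 k); rewrite Cmult_0_r, Cplus_0_r in h.
    unfold Cminus at 4 in h; rewrite Copp_0, Cplus_0_r in h; rewrite <- h.
    apply Cprod_ext; intros i _; unfold A.
    destruct (Z.eqb_spec (- Z.of_nat (S i)) 0); [lia |].
    rewrite opp_IZR, <- INR_IZR_INZ; one_minus_e2pi.
  - replace (2 * M - k)%nat with (S (2 * M - k - 1)) by lia.
    rewrite Cprod_S_l, pochn_e2pi; change (A (Z.of_nat 0)) with (RtoC 1); rewrite Cmult_1_l.
    replace (S (2 * M - k - 1) - 1)%nat with (2 * M - k - 1)%nat by lia.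
    apply Cprod_ext; intros i _; unfold A.
    destruct (Z.eqb_spec (Z.of_nat (S i)) 0); [lia |].
    rewrite <- INR_IZR_INZ; one_minus_e2pi. }
assert (E4 : Cprod (fun j => B (nd j + nd k)%Z) (2 * M) =
  e2pi (INR (2 * M - k) / 2 + INR (2 * M - k) * ga
    - T * (INR (2 * M - k) * (INR (2 * M - k) + 1) / 2))
  * pochn (e2pi (T - ga)) (e2pi T) (2 * M - k) * pochn (e2pi ga) (e2pi T) k).
{ rewrite (Cprod_ext _ (fun j => B (Z.of_nat j - Z.of_nat (2 * M - k))%Z))
    by (intros; f_equal; unfold nd; lia).
  rewrite Cprod_center, <- Cprod_neg, pochn_e2pi by lia.
  replace (2 * M - (2 * M - k))%nat with k by lia.
  f_equal; apply Cprod_ext; intros i _; unfold B.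
  - rewrite opp_IZR, <- INR_IZR_INZ; one_minus_e2pi.
  - rewrite <- INR_IZR_INZ; reflexivity. }
assert (HBk := HB (nd k + nd k)%Z).
assert (HB'0 : B' <> 0).
{ intros E; apply (Cprod_neq0 (fun j => B (nd j + nd k)%Z) (2 * M) (fun j _ => HB _)).
  rewrite <- E2, E; ring. }
assert (HD'0 : D' <> 0) by (intros E; apply HD; rewrite <- E1, E; ring).
assert (HA0 : Cprod (fun j => A (Z.of_nat j - Z.of_nat k)%Z) (2 * M) <> 0)
  by (apply Cprod_neq0; intros; apply HA).
assert (HE0 := e2pi_neq0 (- (IZR (nd k) * T))).
rewrite <- E1.
rewrite E4 in E2.
assert (EB : B' = e2pi (INR (2 * M - k) / 2 + INR (2 * M - k) * ga
    - T * (INR (2 * M - k) * (INR (2 * M - k) + 1) / 2))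
  * pochn (e2pi (T - ga)) (e2pi T) (2 * M - k) * pochn (e2pi ga) (e2pi T) k / B (nd k + nd k)%Z)
  by (rewrite <- E2; field; exact HBk).
(* The signs [e2pi (k / 2)] and [e2pi ((2 M - k) / 2)] multiply to [e2pi M = 1], which is inserted
   on the left so that the exponents agree. *)
assert (Hpre : cst = e2pi (IZR (nd k) * ga + T * IZR (nd k) ^ 2) *
  (e2pi (INR k / 2 - T * (INR k * (INR k + 1) / 2)) *
   e2pi (INR (2 * M - k) / 2 + INR (2 * M - k) * ga
    - T * (INR (2 * M - k) * (INR (2 * M - k) + 1) / 2)))).
{ unfold cst; rewrite <- !e2pi_plus, <- (Cmult_1_l (e2pi (INR M * ga - _))), <- (e2pi_nat M), <- e2pi_plus.
  f_equal; unfold nd; rewrite minus_INR, mult_INR by lia; rewrite minus_IZR, <- !INR_IZR_INZ.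
  change (INR 2) with 2%R; push_RtoC; field. }
rewrite E3, EB, Hpre.
rewrite E3 in HA0; rewrite EB in HB'0.
unfold appell_term; change (al + be) with ga.
replace (1 - e2pi (ga + 2 * IZR (nd k) * T)) with (B (nd k + nd k)%Z)
  by (unfold B; one_minus_e2pi).
assert (HXk := HX k); unfold X in HXk.
assert (h1 := e2pi_neq0 (INR k / 2 - T * (INR k * (INR k + 1) / 2))).
assert (h2 := e2pi_neq0 (INR (2 * M - k) / 2 + INR (2 * M - k) * ga
    - T * (INR (2 * M - k) * (INR (2 * M - k) + 1) / 2))).
unfold X.
set (x1 := pochn (e2pi T) (e2pi T) k) in *.
set (x2 := pochn (e2pi T) (e2pi T) (2 * M - k - 1)) in *.
set (x3 := pochn (e2pi (T - ga)) (e2pi T) (2 * M - k)) in *.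
set (x4 := pochn (e2pi ga) (e2pi T) k) in *.
assert (hx1 : x1 <> 0) by (intros E; apply HA0; rewrite E; ring).
assert (hx2 : x2 <> 0) by (intros E; apply HA0; rewrite E; ring).
assert (hx3 : x3 <> 0) by (intros E; apply HB'0; rewrite E; unfold Cdiv; ring).
assert (hx4 : x4 <> 0) by (intros E; apply HB'0; rewrite E; unfold Cdiv; ring).
assert (hX1 : 1 - e2pi (al + IZR (nd k) * T) <> 0) by (intros E; apply HXk; rewrite E; ring).
assert (hX2 : 1 - e2pi (be + IZR (nd k) * T) <> 0) by (intros E; apply HXk; rewrite E; ring).
field; repeat split; assumption.
Qed.

Lemma generic_opp (T u : C) : generic T u -> generic T (- u).
Proof.
intros H n E; apply (H (- n)%Z).
replace (u + IZR (- n) * T) with (- (- u + IZR n * T)) by (push_RtoC; ring).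
rewrite e2pi_opp, E; field.
Qed.

Lemma generic_shift (T u : C) (k : Z) : generic T u -> generic T (u + IZR k * T).
Proof.
intros H n; replace (u + IZR k * T + IZR n * T) with (u + IZR (k + n) * T) by (push_RtoC; ring).
apply H.
Qed.

Lemma generic_pow (T u : C) : generic T u -> forall k, e2pi u * e2pi T ^ k <> 1.
Proof. intros H k; rewrite e2pi_pow, <- e2pi_plus, INR_IZR_INZ; apply H. Qed.

Lemma generic_pow' (T u : C) : generic T u -> forall k, e2pi (T - u) * e2pi T ^ k <> 1.
Proof.
intros H; apply generic_pow; replace (T - u) with (- u + IZR 1 * T) by ring.
apply generic_shift, generic_opp, H.
Qed.

Lemma generic_inv_bound_nat (T u : C) : (0 < Im T)%R -> generic T u ->
  exists B, (0 <= B)%R /\ forall k, (Cmod (/ (1 - e2pi (u + INR k * T))) <= B)%R.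
Proof.
intros HT H; apply Ccv_bound with (/ (1 - 0)).
apply Ccv_inv; [replace (1 - 0) with (RtoC 1) by ring; exact C1_nz |].
apply Ccv_minus; [apply Ccv_const |].
apply Ccv_ext with (fun k => e2pi u * e2pi T ^ k).
{ intros k; rewrite e2pi_pow, <- e2pi_plus; reflexivity. }
replace (RtoC 0) with (e2pi u * 0) by ring; apply Ccv_scal.
apply Ccv_squeeze with (fun n => Cmod (e2pi T) ^ n)%R.
- intros n; replace (e2pi T ^ n - 0) with (e2pi T ^ n) by ring; rewrite Cmod_pow; lra.
- apply is_lim_seq_geom; rewrite Rabs_pos_eq by apply Cmod_ge_0; apply Cmod_e2pi_lt1, HT.
Qed.

(** For positive [n] the quotients converge. For negative [n], where the exponential grows,
    [1 / (1 - w) = 1 - 1 / (1 - 1 / w)] leads back to the point [- u]. *)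
Lemma generic_inv_bound (T u : C) : (0 < Im T)%R -> generic T u ->
  exists B, (0 <= B)%R /\ forall n : Z, (Cmod (/ (1 - e2pi (u + IZR n * T))) <= B)%R.
Proof.
intros HT H.
destruct (generic_inv_bound_nat T u HT H) as [B1 [HB1 H1]].
destruct (generic_inv_bound_nat T (- u) HT (generic_opp _ _ H)) as [B2 [HB2 H2]].
exists (B1 + (B2 + 1))%R; split; [lra |]; intros n.
destruct (Z_le_gt_dec 0 n) as [Hn | Hn].
- rewrite <- (Z2Nat.id n Hn), <- INR_IZR_INZ; specialize (H1 (Z.to_nat n)); lra.
- specialize (H2 (Z.to_nat (- n))).
  rewrite (INR_IZR_INZ (Z.to_nat (- n))), (Z2Nat.id (- n)) in H2 by lia.
  assert (Hg := generic_opp _ _ H (- n)%Z).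
  replace (- u + IZR (- n) * T) with (- (u + IZR n * T)) in * by (push_RtoC; ring).
  set (w := u + IZR n * T) in *.
  assert (Hw : e2pi w <> 1) by apply H.
  replace (/ (1 - e2pi w)) with (1 - / (1 - e2pi (- w))).
  + eapply Rle_trans; [apply Cmod_1_minus |]; lra.
  + assert (Hw1 := C1_minus_neq0 _ Hw).
    assert (Hw2 : e2pi w - 1 <> 0).
    { replace (e2pi w - 1) with (- (1) * (1 - e2pi w)) by ring.
      apply Cmult_neq_0; [| exact Hw1].
      intros E; apply (f_equal Re) in E; cbn in E; lra. }
    rewrite e2pi_opp; field; repeat split; auto using e2pi_neq0.
Qed.

Lemma bd_mul_le (K B : R) (u v : Z -> C) : (0 <= B)%R ->
  bd K u -> (forall n, Cmod (v n) <= B)%R -> bd (B * K) (fun n => u n * v n).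
Proof.
intros HB Hu Hv n; rewrite Cmult_comm; unfold Rdiv; rewrite Rmult_assoc.
apply Cmod_mult_le; [apply Hv | apply Hu].
Qed.

Lemma bd_appell (T al be : C) : (0 < Im T)%R -> generic T al -> generic T be ->
  exists K, bd K (appell_term T al be).
Proof.
intros HT Ha Hb.
destruct (generic_inv_bound T al HT Ha) as [B1 [HB1 H1]].
destruct (generic_inv_bound T be HT Hb) as [B2 [HB2 H2]].
destruct (bd_gauss T (al + be) 0 (fun n => e2pi (IZR n * (al + be) + T * IZR n ^ 2)) HT)
  as [K1 HK1]; [intros; f_equal; ring |].
destruct (bd_gauss T (al + be + 2 * T) (al + be)
  (fun n => e2pi (IZR n * (al + be) + T * IZR n ^ 2) * e2pi (al + be + 2 * IZR n * T)) HT)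
  as [K2 HK2]; [intros; rewrite <- e2pi_plus; f_equal; ring |].
eexists; eapply bd_ext with (u := fun n => (e2pi (IZR n * (al + be) + T * IZR n ^ 2)
  + (- (1)) * (e2pi (IZR n * (al + be) + T * IZR n ^ 2) * e2pi (al + be + 2 * IZR n * T)))
  * (/ (1 - e2pi (al + IZR n * T)) * / (1 - e2pi (be + IZR n * T)))).
- intros n; unfold appell_term; field; split; apply C1_minus_neq0; [apply Hb | apply Ha].
- apply bd_mul_le with (B := (B1 * B2)%R); [apply Rmult_le_pos; assumption | |].
  + apply bd_plus; [exact HK1 | apply bd_scal, HK2].
  + intros n; apply Cmod_mult_le; auto.
Qed.

(* The affine [sl(2|1)] denominator identity. *)
Lemma appell_product (T al be : C) : (0 < Im T)%R ->
  generic T al -> generic T be -> generic T (al + be) ->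
  CSumZ (appell_term T al be) =
  poch (e2pi T) (e2pi T) ^ 2 *
    (poch (e2pi (al + be)) (e2pi T) * poch (e2pi (T - (al + be))) (e2pi T)) /
  (poch (e2pi al) (e2pi T) * poch (e2pi (T - al)) (e2pi T) *
   poch (e2pi be) (e2pi T) * poch (e2pi (T - be)) (e2pi T)).
Proof.
intros HT Ha Hb Hc; assert (Hq := Cmod_e2pi_lt1 T HT); set (q := e2pi T) in *; set (ga := al + be) in *.
assert (Hqq : forall k, q * q ^ k <> 1) by (intros; apply e2pi_pow_neq1, HT).
assert (Hc1 := generic_pow _ _ Hc); assert (Hc2 := generic_pow' _ _ Hc); fold q in Hc1, Hc2.
assert (N1 := poch_neq0 q q Hq Hqq).
assert (N2 := poch_neq0 _ q Hq Hc1). assert (N3 := poch_neq0 _ q Hq Hc2).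
destruct (bd_appell T al be HT Ha Hb) as [K HK].
destruct (pochn_inv_bound q q Hq Hqq) as [B1 [HB1 H1]].
destruct (pochn_inv_bound _ q Hq Hc1) as [B2 [HB2 H2]].
destruct (pochn_inv_bound _ q Hq Hc2) as [B3 [HB3 H3]].
set (w := fun M n => / (pochn q q (Z.to_nat (n + Z.of_nat M)) *
       pochn q q (Z.to_nat (Z.of_nat M - 1 - n)) *
       pochn (e2pi (T - ga)) q (Z.to_nat (Z.of_nat M - n)) *
       pochn (e2pi ga) q (Z.to_nat (n + Z.of_nat M)))).
assert (Hsub : forall x (phi : nat -> nat), (exists m, forall N, (N <= phi N + m)%nat) ->
  Ccv (fun N => pochn x q (phi N)) (poch x q)).
{ intros x phi [m Hphi]; apply Ccv_eps; intros eps He.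
  destruct (proj1 (Ccv_eps _ _) (pochn_cv x q Hq) eps He) as [N0 HN0].
  exists (N0 + m)%nat; intros N HN; apply HN0; specialize (Hphi N); lia. }
(* For fixed [n] all four lengths in the weight [w M n] tend to infinity, so the limit of the
   weights does not depend on [n] and comes out of the sum. *)
assert (Hcv : Ccv (fun M => psum M (fun n => w M n * appell_term T al be n))
  (CSumZ (fun n => / (poch q q * poch q q * poch (e2pi (T - ga)) q * poch (e2pi ga) q)
    * appell_term T al be n))).
{ apply psum_tannery with (B1 * B1 * B3 * B2 * K)%R.
  - intros M n _; unfold Rdiv; rewrite Rmult_assoc; apply Cmod_mult_le; [| apply HK].
    unfold w.
    set (y1 := pochn q q _); set (y2 := pochn q q (Z.to_nat (Z.of_nat M - 1 - n)));
    set (y3 := pochn (e2pi (T - ga)) _ _); set (y4 := pochn (e2pi ga) _ _).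
    replace (/ (y1 * y2 * y3 * y4)) with (/ y1 * / y2 * / y3 * / y4).
    + repeat apply Cmod_mult_le; [apply H1 | apply H1 | apply H3 | apply H2].
    + field; repeat split; apply pochn_neq0; auto.
  - intros n; apply Ccv_mult; [| apply Ccv_const].
    apply Ccv_inv; [repeat apply Cmult_neq_0; assumption |].
    repeat apply Ccv_mult; apply Hsub; [exists (Z.abs_nat n) | exists (1 + Z.abs_nat n)%nat
      | exists (Z.abs_nat n) | exists (Z.abs_nat n)]; lia. }
rewrite (CSumZ_scal _ _ _ HK) in Hcv.
assert (A1 := poch_neq0 _ q Hq (generic_pow _ _ Ha)).
assert (A2 := poch_neq0 _ q Hq (generic_pow' _ _ Ha)).
assert (A3 := poch_neq0 _ q Hq (generic_pow _ _ Hb)).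
assert (A4 := poch_neq0 _ q Hq (generic_pow' _ _ Hb)).
assert (Hcv2 : Ccv (fun M => psum M (fun n => w M n * appell_term T al be n))
  (/ (poch (e2pi al) q * poch (e2pi (T - al)) q * poch (e2pi be) q * poch (e2pi (T - be)) q))).
{ apply Ccv_ext_loc with (N0 := 1%nat) (u := fun M =>
    / (pochn (e2pi al) q M * pochn (e2pi (T - al)) q M * pochn (e2pi be) q M * pochn (e2pi (T - be)) q M)).
  - intros [|N] HN; [lia |].
    unfold q; rewrite <- (appell_finite T al be N HT Ha Hb Hc); apply psum_ext; intros n Hn.
    unfold w; fold q ga; replace (Z.of_nat (S N) - 1 - n)%Z with (Z.of_nat N - n)%Z by lia; ring.
  - apply Ccv_inv; [repeat apply Cmult_neq_0; assumption |].
    repeat apply Ccv_mult; apply pochn_cv, Hq. }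
assert (E := Ccv_unique _ _ _ Hcv Hcv2).
transitivity ((poch q q * poch q q * poch (e2pi (T - ga)) q * poch (e2pi ga) q) *
  (/ (poch q q * poch q q * poch (e2pi (T - ga)) q * poch (e2pi ga) q) * CSumZ (appell_term T al be))).
- field; auto.
- rewrite E; field; auto.
Qed.

(** * Theta functions as products *)

Definition Q (T : C) : C := poch (e2pi T) (e2pi T).

(** The theta function in multiplicative form, [(q; q) (x; q) (q / x; q)] with [x = e2pi u]. The
    four Mumford functions are [J] at half-period shifts times an exponential, so product identities
    need proof for [J] only. *)
Definition J (T u : C) : C := Q T * (poch (e2pi u) (e2pi T) * poch (e2pi (T - u)) (e2pi T)).

Lemma Q_neq0 (T : C) : (0 < Im T)%R -> Q T <> 0.
Proof. apply poch_e2pi_self_neq0. Qed.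

Lemma J_neq0' (T u : C) : (0 < Im T)%R -> generic T u -> J T u <> 0.
Proof.
intros HT H; assert (Hq := Cmod_e2pi_lt1 T HT).
repeat apply Cmult_neq_0; [apply Q_neq0, HT | |]; apply poch_neq0; auto.
- apply generic_pow, H.
- apply generic_pow', H.
Qed.

Lemma appell_J (T al be : C) : (0 < Im T)%R ->
  generic T al -> generic T be -> generic T (al + be) ->
  CSumZ (appell_term T al be) = Q T ^ 3 * J T (al + be) / (J T al * J T be).
Proof.
intros HT Ha Hb Hc; rewrite appell_product by assumption.
assert (h1 := J_neq0' T al HT Ha); assert (h2 := J_neq0' T be HT Hb); assert (h3 := Q_neq0 T HT).
unfold J, Q in *; field; repeat split; try assumption;
  intros E; first [apply h1; rewrite E; ring | apply h2; rewrite E; ring].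
Qed.

Lemma J_core (T u : C) : (0 < Im T)%R ->
  J T u = Q T * (1 - e2pi u) * (poch (e2pi (T + u)) (e2pi T) * poch (e2pi (T - u)) (e2pi T)).
Proof.
intros HT; unfold J; rewrite (poch_S (e2pi u)) by (apply Cmod_e2pi_lt1, HT).
rewrite <- e2pi_plus, (Cplus_comm u); ring.
Qed.

Lemma J_opp (T u : C) : (0 < Im T)%R -> J T (- u) = - e2pi (- u) * J T u.
Proof.
intros HT; rewrite !J_core by exact HT.
replace (T - - u) with (T + u) by ring; replace (T + - u) with (T - u) by ring.
rewrite e2pi_opp; field; apply e2pi_neq0.
Qed.

Lemma J_shift (T u : C) : (0 < Im T)%R -> J T (u + T) = - e2pi (- u) * J T u.
Proof.
intros HT; rewrite <- J_opp by exact HT; unfold J.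
replace (T - (u + T)) with (- u) by ring; replace (T - - u) with (u + T) by ring; ring.
Qed.

Lemma J_add1 (T u : C) : J T (u + 1) = J T u.
Proof.
unfold J; replace (T - (u + 1)) with (T - u - 1) by ring.
rewrite e2pi_plus, (e2pi_minus (T - u)), e2pi_1; do 3 f_equal; field.
Qed.

Lemma Im_double (T : C) : (0 < Im T)%R -> (0 < Im (2 * T))%R.
Proof. destruct T as [x y]; cbn; lra. Qed.

Lemma e2pi_double (T : C) : e2pi (2 * T) = e2pi T ^ 2.
Proof. rewrite e2pi_pow; f_equal; cbn; ring. Qed.

(** Each Pochhammer symbol in [q] splits into two in [q^2] according to the parity of the
    exponent. *)
Lemma J_dup (T u : C) : (0 < Im T)%R ->
  J T u * Q (2 * T) ^ 2 = Q T * (J (2 * T) u * J (2 * T) (u + T)).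
Proof.
intros HT; assert (Hq := Cmod_e2pi_lt1 T HT); unfold J.
rewrite (poch_split2 (e2pi u)), (poch_split2 (e2pi (T - u))) by exact Hq.
rewrite <- !e2pi_plus, <- !e2pi_double.
replace (T - u + T) with (2 * T - u) by ring.
replace (2 * T - (u + T)) with (T - u) by ring; ring.
Qed.

(** From [1 - x^2 q^(2 k) = (1 - x q^k) (1 + x q^k)]; the change of sign of [x] is the shift of [u]
    by 1/2. *)
Lemma J_sqr (T u : C) : (0 < Im T)%R ->
  J (2 * T) (2 * u) * Q T ^ 2 = Q (2 * T) * (J T u * J T (u + 1 / 2)).
Proof.
intros HT; assert (Hq := Cmod_e2pi_lt1 T HT); unfold J.
replace (2 * T - 2 * u) with (2 * (T - u)) by ring.
replace (T - (u + 1 / 2)) with (T - u + 1 / 2 - 1) by field.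
rewrite (e2pi_minus _ 1), e2pi_1, !(e2pi_plus _ (1 / 2)), e2pi_half.
rewrite (e2pi_double u), (e2pi_double (T - u)), (e2pi_double T).
rewrite !poch_sqr by exact Hq.
replace (e2pi u * - (1)) with (- e2pi u) by ring.
replace (e2pi (T - u) * - (1) / 1) with (- e2pi (T - u)) by field; ring.
Qed.

(** * The Mumford theta functions *)

Lemma theta_e2pi (a b : nat) (tau z : C) : theta a b tau z =
  CSumZ (fun n => e2pi (tau * (IZR n + INR a / 2) ^ 2 / 2 + (IZR n + INR a / 2) * (z + INR b / 2))).
Proof.
unfold theta, e2pi; apply CSumZ_ext; intros n; f_equal.
rewrite RtoC_plus, RtoC_div by lra; field.
Qed.

Lemma theta00_e2pi (tau z : C) :
  theta 0 0 tau z = CSumZ (fun n => e2pi (tau * IZR n ^ 2 / 2 + IZR n * z)).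
Proof.
rewrite theta_e2pi; apply CSumZ_ext; intros n; f_equal; cbn [INR]; field.
Qed.

Lemma theta00_bd (tau z : C) : (0 < Im tau)%R ->
  exists K, bd K (fun n => e2pi (tau * IZR n ^ 2 / 2 + IZR n * z)).
Proof.
intros H; apply (bd_gauss (tau / 2) z 0).
- replace (Im (tau / 2)) with (Im tau / 2)%R by (destruct tau; cbn; field); lra.
- intros; f_equal; field.
Qed.

Lemma theta01_00 (tau z : C) : theta 0 1 tau z = theta 0 0 tau (z + 1 / 2).
Proof. rewrite !theta_e2pi; apply CSumZ_ext; intros n; f_equal; cbn [INR]; field. Qed.

Lemma theta10_00 (tau z : C) : (0 < Im tau)%R ->
  theta 1 0 tau z = e2pi (tau / 8 + z / 2) * theta 0 0 tau (z + tau / 2).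
Proof.
intros H; rewrite theta00_e2pi, theta_e2pi.
destruct (theta00_bd tau (z + tau / 2) H) as [K HK]; rewrite <- (CSumZ_scal _ _ _ HK).
apply CSumZ_ext; intros n; rewrite <- e2pi_plus; f_equal; cbn [INR]; field.
Qed.

Lemma theta11_10 (tau z : C) : theta 1 1 tau z = theta 1 0 tau (z + 1 / 2).
Proof. rewrite !theta_e2pi; apply CSumZ_ext; intros n; f_equal; cbn [INR]; field. Qed.

Lemma theta00_J (tau z : C) : (0 < Im tau)%R -> theta 0 0 tau z = J tau (z + tau / 2 + 1 / 2).
Proof.
intros H; unfold J, Q; rewrite <- triple_product, theta00_e2pi by exact H.
apply CSumZ_ext; intros n.
transitivity (e2pi (tau * IZR n ^ 2 / 2 + IZR n * z) * e2pi (IZR n)); [rewrite e2pi_Z; ring |].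
rewrite <- e2pi_plus; f_equal; field.
Qed.

Lemma theta01_J (tau z : C) : (0 < Im tau)%R -> theta 0 1 tau z = J tau (z + tau / 2).
Proof.
intros H; rewrite theta01_00, theta00_J, <- (J_add1 tau (z + tau / 2)) by exact H; f_equal; field.
Qed.

Lemma theta10_J (tau z : C) : (0 < Im tau)%R ->
  theta 1 0 tau z = e2pi (tau / 8 - z / 2) * J tau (z + 1 / 2).
Proof.
intros H; rewrite theta10_00, theta00_J by exact H.
replace (z + tau / 2 + tau / 2 + 1 / 2) with (z + 1 / 2 + tau) by field.
rewrite J_shift by exact H.
replace (tau / 8 - z / 2) with (tau / 8 + z / 2 + (- (z + 1 / 2)) + 1 / 2) by field.
rewrite !(e2pi_plus _ (1 / 2)), !(e2pi_plus _ (- _)), e2pi_half; ring.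
Qed.

Lemma theta11_J (tau z : C) : (0 < Im tau)%R ->
  theta 1 1 tau z = e2pi (tau / 8 - z / 2 - 1 / 4) * J tau z.
Proof.
intros H; rewrite theta11_10, theta10_J, <- (J_add1 tau z) by exact H.
f_equal; f_equal; field.
Qed.

Lemma eta_Q (T : C) : (0 < Im T)%R -> eta T = e2pi (T / 24) * Q T.
Proof.
intros H; unfold eta; f_equal; apply CLim_seq_unique.
eapply Ccv_ext; [| apply pochn_cv, Cmod_e2pi_lt1, H].
intros n; apply Cprod_ext; intros k _.
rewrite e2pi_pow, <- e2pi_plus; do 2 f_equal; push_RtoC; ring.
Qed.

Lemma theta10_e2pi (tau z : C) : theta 1 0 tau z =
  CSumZ (fun n => e2pi (tau * (IZR n + 1 / 2) ^ 2 / 2 + (IZR n + 1 / 2) * z)).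
Proof. rewrite theta_e2pi; apply CSumZ_ext; intros n; f_equal; cbn [INR]; field. Qed.

Lemma theta10_bd (tau z : C) : (0 < Im tau)%R ->
  exists K, bd K (fun n => e2pi (tau * (IZR n + 1 / 2) ^ 2 / 2 + (IZR n + 1 / 2) * z)).
Proof.
intros H; apply (bd_gauss (tau / 2) (z + tau / 2) (tau / 8 + z / 2)).
- replace (Im (tau / 2)) with (Im tau / 2)%R by (destruct tau; cbn; field); lra.
- intros; f_equal; field.
Qed.

Lemma CSumZ_prod (K L : R) (a b : Z -> C) : bd K a -> bd L b ->
  CSumZ (fun l => CSumZ (fun n => a n * b l)) = CSumZ a * CSumZ b.
Proof.
intros Ha Hb; rewrite <- (CSumZ_scal _ _ _ Hb); apply CSumZ_ext; intros l.
rewrite (CSumZ_ext _ (fun n => b l * a n)) by (intros; ring).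
rewrite (CSumZ_scal _ _ _ Ha); ring.
Qed.

Lemma gauss2_bound (tau a b : C) : (0 < Im tau)%R -> exists K, forall n d : Z,
  (Cmod (e2pi (tau * (IZR n ^ 2 + (IZR n + IZR d) ^ 2) / 2 + IZR n * a + IZR d * b))
   <= K / (1 + IZR n ^ 2) / (1 + IZR d ^ 2))%R.
Proof.
intros HT; assert (Hp := PI_RGT_0).
(* The third is allowed because [3 (x^2 + (x + y)^2) >= x^2 + y^2]. *)
set (A := (PI * Im tau / 3)%R).
assert (HA : (0 < A)%R) by (unfold A; assert (0 < PI * Im tau)%R by (apply Rmult_lt_0_compat; lra); lra).
set (B1 := Rabs (2 * PI * Im a)). set (B2 := Rabs (2 * PI * Im b)).
exists (4 * exp ((Rabs B1 + 1) ^ 2 / (4 * A)) * (4 * exp ((Rabs B2 + 1) ^ 2 / (4 * A))))%R.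
intros n d; assert (h1 := gauss_majorant A B1 HA (IZR n)); assert (h2 := gauss_majorant A B2 HA (IZR d)).
set (k1 := (4 * exp ((Rabs B1 + 1) ^ 2 / (4 * A)))%R) in *.
set (k2 := (4 * exp ((Rabs B2 + 1) ^ 2 / (4 * A)))%R) in *.
replace (k1 * k2 / (1 + IZR n ^ 2) / (1 + IZR d ^ 2))%R
  with (k1 / (1 + IZR n ^ 2) * (k2 / (1 + IZR d ^ 2)))%R by (unfold Rdiv; ring).
eapply Rle_trans; [| apply Rmult_le_compat; [left; apply exp_pos | left; apply exp_pos | exact h1 | exact h2]].
rewrite <- exp_plus, Cmod_e2pi; apply exp_le.
replace (Im _) with (Im tau * (IZR n ^ 2 + (IZR n + IZR d) ^ 2) / 2 + IZR n * Im a + IZR d * Im b)%R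
  by (destruct tau, a, b; cbn; field).
set (x := IZR n); set (y := IZR d).
assert (e1 := Rle_abs (- (2 * PI * Im a * x))); rewrite Rabs_Ropp, Rabs_mult in e1; fold B1 in e1.
assert (e2 := Rle_abs (- (2 * PI * Im b * y))); rewrite Rabs_Ropp, Rabs_mult in e2; fold B2 in e2.
assert (Hq : (0 <= 3 * (x ^ 2 + (x + y) ^ 2) - (x ^ 2 + y ^ 2))%R).
{ replace (3 * (x ^ 2 + (x + y) ^ 2) - (x ^ 2 + y ^ 2))%R
    with ((5 * x + 3 * y) ^ 2 / 5 + y ^ 2 / 5)%R by field.
  assert (h3 := pow2_ge_0 (5 * x + 3 * y)); assert (h4 := pow2_ge_0 y); lra. }
apply Rmult_le_compat_l with (r := A) in Hq; [| lra].
assert (E : (PI * Im tau = 3 * A)%R) by (unfold A; field).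
replace (- (2 * PI * (Im tau * (x ^ 2 + (x + y) ^ 2) / 2 + x * Im a + y * Im b)))%R
  with (- ((PI * Im tau) * (x ^ 2 + (x + y) ^ 2)) - 2 * PI * Im a * x - 2 * PI * Im b * y)%R by field.
rewrite E; lra.
Qed.

(** The double series is arranged by the difference [d] of the two indices and split by the parity
    of [d]. The recentring [n - l] diagonalizes the quadratic form; for [d = 2 l] it gives
    [(n - l)^2 + (n + l)^2 = 2 n^2 + 2 l^2], and odd [d] gives the half-integral indices of
    [theta 1 0]. *)
Lemma theta00_addition (tau u v : C) : (0 < Im tau)%R ->
  theta 0 0 tau u * theta 0 0 tau v =
  theta 0 0 (2 * tau) (u + v) * theta 0 0 (2 * tau) (u - v)
  + theta 1 0 (2 * tau) (u + v) * theta 1 0 (2 * tau) (u - v).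
Proof.
intros HT; assert (HT2 := Im_double tau HT).
rewrite !theta00_e2pi, !theta10_e2pi.
destruct (theta00_bd tau u HT) as [Ku HKu]; destruct (theta00_bd tau v HT) as [Kv HKv].
set (F := fun n d : Z => e2pi (tau * (IZR n ^ 2 + (IZR n + IZR d) ^ 2) / 2
  + IZR n * (u + v) + IZR d * u)).
destruct (gauss2_bound tau (u + v) u HT) as [K HK].
assert (HF : CSumZ (fun n => e2pi (tau * IZR n ^ 2 / 2 + IZR n * u)) *
  CSumZ (fun n => e2pi (tau * IZR n ^ 2 / 2 + IZR n * v)) = CSumZ (fun n => CSumZ (F n))).
{ rewrite <- (CSumZ_scal _ _ _ HKv); apply CSumZ_ext; intros n.
  rewrite <- (CSumZ_shift _ _ n HKu), Cmult_comm, <- (CSumZ_scal _ _ _ (bd_shift _ _ n HKu)).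
  apply CSumZ_ext; intros d; unfold F; rewrite <- e2pi_plus; f_equal; push_RtoC; field. }
rewrite HF, (CSumZ_fubini K F HK).
assert (HB : bd (6 * K) (fun d => CSumZ (fun n => F n d))).
{ intros d; eapply Rle_trans; [apply (CSumZ_bound (K / (1 + IZR d ^ 2))) |].
  - intros n; eapply Rle_trans; [apply HK |]; right; field.
    assert (h1 := pow2_ge_0 (IZR n)); assert (h2 := pow2_ge_0 (IZR d)); lra.
  - right; field; assert (h2 := pow2_ge_0 (IZR d)); lra. }
assert (HFd : forall d, bd K (fun n => F n d)).
{ intros d n; eapply Rle_trans; [apply HK |].
  assert (Hk := CSumZ_bound _ _ HB).
  assert (h1 := pow2_ge_0 (IZR n)); assert (h2 := pow2_ge_0 (IZR d)).
  assert (HK0 := bd_pos _ _ HB).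
  assert (0 <= K / (1 + IZR n ^ 2))%R
    by (apply Rmult_le_pos; [lra | left; apply Rinv_0_lt_compat; lra]).
  unfold Rdiv at 1; rewrite <- (Rmult_1_r (K / (1 + IZR n ^ 2))) at 2.
  apply Rmult_le_compat_l; [assumption |].
  rewrite <- Rinv_1; apply Rinv_le_contravar; lra. }
rewrite (CSumZ_split _ 2 _ ltac:(lia) HB); cbn [csum]; rewrite Cplus_0_l; f_equal.
- destruct (theta00_bd (2 * tau) (u + v) HT2) as [K1 H1].
  destruct (theta00_bd (2 * tau) (u - v) HT2) as [K2 H2].
  rewrite <- (CSumZ_prod _ _ _ _ H1 H2); apply CSumZ_ext; intros l.
  rewrite <- (CSumZ_shift _ _ (- l) (HFd (Z.of_nat 2 * l + Z.of_nat 0)%Z)).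
  apply CSumZ_ext; intros n; unfold F; rewrite <- e2pi_plus; f_equal.
  replace (Z.of_nat 2 * l + Z.of_nat 0)%Z with (2 * l)%Z by lia; push_RtoC; field.
- destruct (theta10_bd (2 * tau) (u + v) HT2) as [K1 H1].
  destruct (theta10_bd (2 * tau) (u - v) HT2) as [K2 H2].
  rewrite <- (CSumZ_prod _ _ _ _ H1 H2); apply CSumZ_ext; intros l.
  rewrite <- (CSumZ_shift _ _ (- l) (HFd (Z.of_nat 2 * l + Z.of_nat 1)%Z)).
  apply CSumZ_ext; intros n; unfold F; rewrite <- e2pi_plus; f_equal.
  replace (Z.of_nat 2 * l + Z.of_nat 1)%Z with (2 * l + 1)%Z by lia; push_RtoC; field.
Qed.

(** * The functions [Phi] of level one *)

(** The literal factor 1 is the level [m = 1]; it is retained so that [Phi_terms] holds by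
    conversion up to distributivity. *)
Definition phi1_term (s : R) (T z1 z2 : C) (n : Z) : C :=
  e2pi (1 * IZR n * (z1 + z2) + s * z1) * e2pi (T * (1 * IZR n ^ 2 + s * IZR n))
    / (1 - e2pi z1 * e2pi (IZR n * T)).

Definition phi2_term (s : R) (T z1 z2 : C) (n : Z) : C :=
  e2pi (- (1 * IZR n * (z1 + z2)) - s * z2) * e2pi (T * (1 * IZR n ^ 2 + s * IZR n))
    / (1 - e2pi (- z2) * e2pi (IZR n * T)).

Lemma Phi_terms (s : R) (T z1 z2 t : C) : Phi 1 s T z1 z2 t =
  e2pi (- t) * (CSumZ (phi1_term s T z1 z2) - CSumZ (phi2_term s T z1 z2)).
Proof.
unfold Phi, Phi1, Phi2; rewrite Cmult_1_l.
change (e2pi (- t) * CSumZ (phi1_term s T z1 z2) - e2pi (- t) * CSumZ (phi2_term s T z1 z2) =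
  e2pi (- t) * (CSumZ (phi1_term s T z1 z2) - CSumZ (phi2_term s T z1 z2))).
ring.
Qed.

Lemma bd_phi1 (s : R) (T z1 z2 : C) : (0 < Im T)%R -> generic T z1 ->
  exists K, bd K (phi1_term s T z1 z2).
Proof.
intros HT H1; destruct (generic_inv_bound T z1 HT H1) as [B [HB HBn]].
destruct (bd_gauss T (z1 + z2 + s * T) (s * z1) (fun n =>
  e2pi (1 * IZR n * (z1 + z2) + s * z1) * e2pi (T * (1 * IZR n ^ 2 + s * IZR n))) HT) as [K HK].
{ intros n; rewrite <- e2pi_plus; f_equal; ring. }
exists (B * K)%R; apply bd_mul_le; [exact HB | exact HK |].
intros n; rewrite <- e2pi_plus; apply HBn.
Qed.

Lemma bd_phi2 (s : R) (T z1 z2 : C) : (0 < Im T)%R -> generic T z2 ->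
  exists K, bd K (phi2_term s T z1 z2).
Proof.
intros HT H1; destruct (generic_inv_bound T (- z2) HT (generic_opp _ _ H1)) as [B [HB HBn]].
destruct (bd_gauss T (- (z1 + z2) + s * T) (- s * z2) (fun n =>
  e2pi (- (1 * IZR n * (z1 + z2)) - s * z2) * e2pi (T * (1 * IZR n ^ 2 + s * IZR n))) HT) as [K HK].
{ intros n; rewrite <- e2pi_plus; f_equal; ring. }
exists (B * K)%R; apply bd_mul_le; [exact HB | exact HK |].
intros n; rewrite <- e2pi_plus; apply HBn.
Qed.

(** After [n] is replaced by [- n] in the second series, the terms combine: with
    [X = e2pi (z1 + n T)] and [Y = e2pi (z2 + n T)], [X / (1 - X) - Y^(-1) / (1 - Y^(-1)) = (1 - X
    Y) / ((1 - X) (1 - Y))]. *)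
Lemma Phi_one (T z1 z2 t : C) : (0 < Im T)%R ->
  generic T z1 -> generic T z2 -> generic T (z1 + z2) ->
  Phi 1 1 T z1 z2 t = e2pi (- t) * (Q T ^ 3 * J T (z1 + z2) / (J T z1 * J T z2)).
Proof.
intros HT H1 H2 H12; rewrite Phi_terms, <- appell_J by assumption; f_equal.
destruct (bd_phi1 1 T z1 z2 HT H1) as [K1 B1]; destruct (bd_phi2 1 T z1 z2 HT H2) as [K2 B2].
rewrite <- (CSumZ_opp _ _ B2), <- (CSumZ_minus _ _ _ _ B1 (bd_opp _ _ B2)).
apply CSumZ_ext; intros n; unfold appell_term, phi1_term, phi2_term.
assert (h1 := C1_minus_neq0 _ (H1 n)); assert (h2 := C1_minus_neq0 _ (H2 n)).
rewrite <- !e2pi_plus.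
replace (- z2 + IZR (- n) * T) with (- (z2 + IZR n * T)) by (push_RtoC; ring).
replace (1 * IZR n * (z1 + z2) + 1 * z1 + T * (1 * IZR n ^ 2 + 1 * IZR n))
  with (IZR n * (z1 + z2) + T * IZR n ^ 2 + (z1 + IZR n * T)) by ring.
replace (- (1 * IZR (- n) * (z1 + z2)) - 1 * z2 + T * (1 * IZR (- n) ^ 2 + 1 * IZR (- n)))
  with (IZR n * (z1 + z2) + T * IZR n ^ 2 - (z2 + IZR n * T)) by (push_RtoC; ring).
replace (z1 + z2 + 2 * IZR n * T) with ((z1 + IZR n * T) + (z2 + IZR n * T)) by ring.
set (x := z1 + IZR n * T) in *; set (y := z2 + IZR n * T) in *.
rewrite e2pi_minus, !(e2pi_plus _ x), (e2pi_plus x y), e2pi_opp.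
assert (h3 : e2pi y - 1 <> 0).
{ replace (e2pi y - 1) with (- (1 - e2pi y)) by ring; intros E; apply h2.
  replace (1 - e2pi y) with (- - (1 - e2pi y)) by ring; rewrite E; ring. }
field; repeat split; auto using e2pi_neq0.
Qed.

(** Here the two series are summed separately, each by the denominator identity at equal arguments.
    The condition on [z1 - z2] turns [n (z1 + z2) + n T / 2] into [2 n z1] up to the integer [n k],
    and likewise for [- z2] in the second series. *)
Lemma Phi_half_sum (T z1 z2 t : C) (k : Z) : (0 < Im T)%R -> z1 - z2 = T / 2 + IZR k ->
  generic T z1 -> generic T z2 -> generic T (2 * z1) -> generic T (2 * z2) ->
  Phi 1 (1 / 2) T z1 z2 t + Phi 1 (3 / 2) T z1 z2 t =
  e2pi (- t) * (e2pi (z1 / 2) * (Q T ^ 3 * J T (2 * z1) / J T z1 ^ 2)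
    - e2pi (- z2 / 2) * (Q T ^ 3 * J T (- (2 * z2)) / J T (- z2) ^ 2)).
Proof.
intros HT Hk H1 H2 H1' H2'; rewrite !Phi_terms.
assert (Hd : forall u, generic T u -> generic T (2 * u) ->
  CSumZ (appell_term T u u) = Q T ^ 3 * J T (2 * u) / J T u ^ 2).
{ intros u Hu Hu2; rewrite appell_J; try assumption;
  replace (u + u) with (2 * u) by ring; [f_equal; f_equal; ring | exact Hu2]. }
assert (E1 : CSumZ (phi1_term (1 / 2) T z1 z2) + CSumZ (phi1_term (3 / 2) T z1 z2)
  = e2pi (z1 / 2) * CSumZ (appell_term T z1 z1)).
{ destruct (bd_phi1 (1 / 2) T z1 z2 HT H1) as [K1 B1]; destruct (bd_phi1 (3 / 2) T z1 z2 HT H1) as [K2 B2].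
  destruct (bd_appell T z1 z1 HT H1 H1) as [K3 B3].
  rewrite <- (CSumZ_plus _ _ _ _ B1 B2), <- (CSumZ_scal _ _ _ B3).
  apply CSumZ_ext; intros n; unfold appell_term, phi1_term.
  assert (h1 := C1_minus_neq0 _ (H1 n)).
  rewrite <- !e2pi_plus, !RtoC_div by lra.
  replace (1 * IZR n * (z1 + z2) + 3 / 2 * z1 + T * (1 * IZR n ^ 2 + 3 / 2 * IZR n))
    with (1 * IZR n * (z1 + z2) + 1 / 2 * z1 + T * (1 * IZR n ^ 2 + 1 / 2 * IZR n) + (z1 + IZR n * T))
    by field.
  replace (1 * IZR n * (z1 + z2) + 1 / 2 * z1 + T * (1 * IZR n ^ 2 + 1 / 2 * IZR n))
    with (z1 / 2 + (IZR n * (z1 + z1) + T * IZR n ^ 2) + IZR (- (n * k))).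
  2:{ replace z2 with (z1 - (z1 - z2)) by ring; rewrite Hk; push_RtoC; field. }
  replace (z1 + z1 + 2 * IZR n * T) with ((z1 + IZR n * T) + (z1 + IZR n * T)) by ring.
  rewrite (e2pi_plus _ (z1 + IZR n * T)), (e2pi_plus _ (IZR (- (n * k)))), e2pi_Z,
    (e2pi_plus (z1 / 2)), (e2pi_plus (z1 + IZR n * T)).
  field; exact h1. }
assert (E2 : CSumZ (phi2_term (1 / 2) T z1 z2) + CSumZ (phi2_term (3 / 2) T z1 z2)
  = e2pi (- z2 / 2) * CSumZ (appell_term T (- z2) (- z2))).
{ destruct (bd_phi2 (1 / 2) T z1 z2 HT H2) as [K1 B1]; destruct (bd_phi2 (3 / 2) T z1 z2 HT H2) as [K2 B2].
  assert (H3 := generic_opp _ _ H2).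
  destruct (bd_appell T (- z2) (- z2) HT H3 H3) as [K3 B3].
  rewrite <- (CSumZ_plus _ _ _ _ B1 B2), <- (CSumZ_scal _ _ _ B3).
  apply CSumZ_ext; intros n; unfold appell_term, phi2_term.
  assert (h1 := C1_minus_neq0 _ (H3 n)).
  rewrite <- !e2pi_plus, !RtoC_div by lra.
  replace (- (1 * IZR n * (z1 + z2)) - 3 / 2 * z2 + T * (1 * IZR n ^ 2 + 3 / 2 * IZR n))
    with (- (1 * IZR n * (z1 + z2)) - 1 / 2 * z2 + T * (1 * IZR n ^ 2 + 1 / 2 * IZR n)
      + (- z2 + IZR n * T)) by field.
  replace (- (1 * IZR n * (z1 + z2)) - 1 / 2 * z2 + T * (1 * IZR n ^ 2 + 1 / 2 * IZR n))
    with (- z2 / 2 + (IZR n * (- z2 + - z2) + T * IZR n ^ 2) + IZR (- (n * k))).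
  2:{ replace z1 with (z2 + (z1 - z2)) by ring; rewrite Hk; push_RtoC; field. }
  replace (- z2 + - z2 + 2 * IZR n * T) with ((- z2 + IZR n * T) + (- z2 + IZR n * T)) by ring.
  rewrite (e2pi_plus _ (- z2 + IZR n * T)), (e2pi_plus _ (IZR (- (n * k)))), e2pi_Z,
    (e2pi_plus (- z2 / 2)), (e2pi_plus (- z2 + IZR n * T)).
  field; exact h1. }
replace (- (2 * z2)) with (2 * - z2) by ring.
rewrite <- !Hd; try assumption; try apply generic_opp; try assumption.
2:{ replace (2 * - z2) with (- (2 * z2)) by ring; apply generic_opp, H2'. }
rewrite <- E1, <- E2; ring.
Qed.

(** * The characters *)

Lemma dom_generic (tau z : C) (a b : Z) : dom tau z ->
  generic tau (z + IZR a / 2 + IZR b / 2 * tau).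
Proof.
intros [_ H] n E; destruct (e2pi_eq1 _ E) as [k Hk].
apply (H (2 * k - a)%Z (- b - 2 * n)%Z).
replace z with ((z + IZR a / 2 + IZR b / 2 * tau + IZR n * tau)
  - (IZR a / 2 + IZR b / 2 * tau + IZR n * tau)) by ring.
rewrite Hk; push_RtoC; field.
Qed.

Lemma dom_generic2 (tau z : C) (a b : Z) : dom tau z ->
  generic (2 * tau) (z + IZR a / 2 + IZR b / 2 * tau).
Proof.
intros H n; replace (IZR n * (2 * tau)) with (IZR (2 * n) * tau) by (push_RtoC; ring).
apply dom_generic, H.
Qed.

Lemma dom_generic2' (tau z : C) (a b : Z) : dom tau z ->
  generic (2 * tau) (2 * z + IZR a + IZR b * tau).
Proof.
intros [_ H] n E; destruct (e2pi_eq1 _ E) as [k Hk].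
apply (H (k - a)%Z (- b - 2 * n)%Z).
replace z with (((2 * z + IZR a + IZR b * tau + IZR n * (2 * tau))
  - (IZR a + IZR b * tau + IZR n * (2 * tau))) / 2) by field.
rewrite Hk; push_RtoC; field.
Qed.

Definition a0 (tau z : C) : C := theta 0 0 (2 * tau) z.
Definition a1 (tau z : C) : C := theta 1 0 (2 * tau) z.

Definition w1 (tau : C) : C := eta (tau / 2) / eta tau ^ 3.
Definition w2 (tau : C) : C := eta (2 * tau) / eta tau ^ 3.
Definition w3 (tau : C) : C := / (eta (tau / 2) * eta (2 * tau)).

Lemma Im_half (T : C) : (0 < Im T)%R -> (0 < Im (T / 2))%R.
Proof. intros; replace (Im (T / 2)) with (Im T / 2)%R by (destruct T; cbn; field); lra. Qed.

Lemma eta_neq0 (T : C) : (0 < Im T)%R -> eta T <> 0.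
Proof.
intros H; rewrite eta_Q by exact H; apply Cmult_neq_0; [apply e2pi_neq0 | apply Q_neq0, H].
Qed.

Lemma theta_dom_neq0 (tau z : C) : dom tau z ->
  theta 0 0 tau z <> 0 /\ theta 0 1 tau z <> 0 /\ theta 1 0 tau z <> 0 /\ theta 1 1 tau z <> 0
  /\ a0 tau z <> 0 /\ a1 tau z <> 0.
Proof.
intros H; assert (HT := proj1 H); assert (HT2 := Im_double tau HT); unfold a0, a1.
rewrite !theta00_J, theta01_J, !theta10_J, theta11_J by assumption.
repeat split; repeat (apply Cmult_neq_0; [apply e2pi_neq0 |]); apply J_neq0'; try assumption.
- replace (z + tau / 2 + 1 / 2) with (z + IZR 1 / 2 + IZR 1 / 2 * tau) by field; apply dom_generic, H.
- replace (z + tau / 2) with (z + IZR 0 / 2 + IZR 1 / 2 * tau) by field; apply dom_generic, H.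
- replace (z + 1 / 2) with (z + IZR 1 / 2 + IZR 0 / 2 * tau) by field; apply dom_generic, H.
- replace z with (z + IZR 0 / 2 + IZR 0 / 2 * tau) by field; apply dom_generic, H.
- replace (z + 2 * tau / 2 + 1 / 2) with (z + IZR 1 / 2 + IZR 2 / 2 * tau) by field; apply dom_generic2, H.
- replace (z + 1 / 2) with (z + IZR 1 / 2 + IZR 0 / 2 * tau) by field; apply dom_generic2, H.
Qed.

(** Duplication at [u = z + 1 / 2]: the two functions of modulus [2 tau] in [J_dup] are [theta 1 0]
    and [theta 0 0], up to an exponential. *)
Lemma a0_a1 (tau z : C) : (0 < Im tau)%R ->
  a0 tau z * a1 tau z = e2pi (tau / 8) * Q (2 * tau) ^ 2 / Q tau * theta 1 0 tau z.
Proof.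
intros HT; assert (HT2 := Im_double tau HT); unfold a0, a1.
rewrite theta00_J, !theta10_J by assumption.
replace (z + 2 * tau / 2 + 1 / 2) with (z + 1 / 2 + tau) by field.
replace (2 * tau / 8 - z / 2) with (tau / 8 + (tau / 8 - z / 2)) by field.
rewrite (e2pi_plus (tau / 8)).
assert (h := J_dup tau (z + 1 / 2) HT); assert (hq := Q_neq0 tau HT).
transitivity (e2pi (tau / 8) * e2pi (tau / 8 - z / 2) *
  (Q tau * (J (2 * tau) (z + 1 / 2) * J (2 * tau) (z + 1 / 2 + tau))) / Q tau); [field; exact hq |].
rewrite <- h; field; exact hq.
Qed.

Lemma sqr_sum (tau z : C) : (0 < Im tau)%R ->
  a0 tau z ^ 2 + a1 tau z ^ 2 = theta 0 0 tau 0 * theta 0 0 tau z.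
Proof.
intros HT; rewrite Cmult_comm, theta00_addition by exact HT.
replace (z + 0) with z by ring; replace (z - 0) with z by ring; unfold a0, a1; ring.
Qed.

Lemma theta_add1 (T z : C) : (0 < Im T)%R ->
  theta 0 0 T (z + 1) = theta 0 0 T z /\ theta 1 0 T (z + 1) = - theta 1 0 T z.
Proof.
intros HT; split.
- rewrite !theta00_J by exact HT; rewrite <- (J_add1 T (z + T / 2 + 1 / 2)); f_equal; ring.
- rewrite !theta10_J, <- (J_add1 T (z + 1 / 2)) by exact HT.
  replace (T / 8 - (z + 1) / 2) with (T / 8 - z / 2 + 1 / 2 - 1) by field.
  rewrite e2pi_minus, e2pi_1, (e2pi_plus _ (1 / 2)), e2pi_half.
  replace (z + 1 + 1 / 2) with (z + 1 / 2 + 1) by ring; field.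
Qed.

Lemma sqr_diff (tau z : C) : (0 < Im tau)%R ->
  a0 tau z ^ 2 - a1 tau z ^ 2 = theta 0 1 tau 0 * theta 0 1 tau z.
Proof.
intros HT; assert (HT2 := Im_double tau HT); rewrite !theta01_00, Cmult_comm, theta00_addition by exact HT.
replace (z + 1 / 2 + (0 + 1 / 2)) with (z + 1) by field.
replace (z + 1 / 2 - (0 + 1 / 2)) with z by field.
destruct (theta_add1 (2 * tau) z HT2) as [-> ->]; unfold a0, a1; ring.
Qed.

Lemma J_swap (T u : C) : J T (T - u) = J T u.
Proof. unfold J; replace (T - (T - u)) with u by ring; ring. Qed.

(** Provides the numerator in [Phi_one], since [z1 + z2 = 2 z] for each of the four characters. *)
Lemma J_2z (tau z : C) : (0 < Im tau)%R ->
  J (2 * tau) (2 * z) = Q (2 * tau) / Q tau ^ 2 * (e2pi (z - tau / 4 + 1 / 4)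
    * theta 1 1 tau z * theta 1 0 tau z).
Proof.
intros HT; assert (hq := Q_neq0 tau HT); rewrite theta11_J, theta10_J by exact HT.
transitivity (J (2 * tau) (2 * z) * Q tau ^ 2 / Q tau ^ 2); [field; exact hq |].
rewrite J_sqr by exact HT.
replace (z - tau / 4 + 1 / 4) with (- (tau / 8 - z / 2 - 1 / 4) - (tau / 8 - z / 2)) by field.
rewrite e2pi_minus, e2pi_opp; field; auto using e2pi_neq0.
Qed.

Lemma s_of_1 : s_of 1 = 1%R.
Proof. unfold s_of; cbn; field. Qed.
Lemma s_of_0 : s_of 0 = (1 / 2)%R.
Proof. unfold s_of; cbn; field. Qed.
Lemma s_of_2 : s_of 2 = (3 / 2)%R.
Proof. unfold s_of; cbn; field. Qed.

Lemma e2pi_3quarter : e2pi (3 / 4) = - Ci.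
Proof.
replace (3 / 4) with (1 / 2 + 1 / 4) by field.
rewrite e2pi_plus, e2pi_half, e2pi_quarter; ring.
Qed.

Lemma J_shift_down (T u : C) : (0 < Im T)%R -> J T u = - e2pi u * J T (u + T).
Proof. intros HT; rewrite J_shift, e2pi_opp by exact HT; field; apply e2pi_neq0. Qed.

(** The quasi-period [2 tau] carries [z - tau / 2] to [(z + tau / 2) + tau], so the two denominators
    of [Phi_one] are the pair which [J_dup] recombines into [theta 0 1]. *)
Lemma Phi_minus_1 (tau z : C) : dom tau z ->
  Phi 1 1 (2 * tau) (z + tau / 2) (z - tau / 2) (tau / 8)
  = - Ci * (a0 tau z * a1 tau z) * theta 1 1 tau z / theta 0 1 tau z.
Proof.
intros H; assert (HT := proj1 H); assert (HT2 := Im_double tau HT).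
destruct (theta_dom_neq0 tau z H) as [t00 [t01 [t10 [t11 [ha0 ha1]]]]].
assert (g1 : generic (2 * tau) (z + tau / 2)).
{ replace (z + tau / 2) with (z + IZR 0 / 2 + IZR 1 / 2 * tau) by field; apply dom_generic2, H. }
assert (g2 : generic (2 * tau) (z - tau / 2)).
{ replace (z - tau / 2) with (z + IZR 0 / 2 + IZR (-1) / 2 * tau) by field; apply dom_generic2, H. }
assert (g3 : generic (2 * tau) (z + tau / 2 + (z - tau / 2))).
{ replace (z + tau / 2 + (z - tau / 2)) with (2 * z + IZR 0 + IZR 0 * tau) by field; apply dom_generic2', H. }
rewrite Phi_one by assumption.
replace (z + tau / 2 + (z - tau / 2)) with (2 * z) by field.
rewrite J_2z, a0_a1, (J_shift_down (2 * tau) (z - tau / 2)) by assumption.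
replace (z - tau / 2 + 2 * tau) with (z + tau / 2 + tau) by field.
assert (hd := J_dup tau (z + tau / 2) HT); rewrite <- theta01_J in hd by exact HT.
assert (hq := Q_neq0 tau HT); assert (hq2 := Q_neq0 _ HT2).
assert (hj : J (2 * tau) (z + tau / 2) * J (2 * tau) (z + tau / 2 + tau)
  = theta 0 1 tau z * Q (2 * tau) ^ 2 / Q tau) by (rewrite hd; field; exact hq).
replace (J (2 * tau) (z + tau / 2) * (- e2pi (z - tau / 2) * J (2 * tau) (z + tau / 2 + tau)))
  with (- e2pi (z - tau / 2) * (J (2 * tau) (z + tau / 2) * J (2 * tau) (z + tau / 2 + tau))) by ring.
rewrite hj.
replace (z - tau / 4 + 1 / 4) with (z - tau / 2 + tau / 8 + tau / 8 + 1 / 4) by field.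
rewrite !(e2pi_plus _ (1 / 4)), !(e2pi_plus _ (tau / 8)), e2pi_opp, e2pi_quarter.
field; repeat split; auto using e2pi_neq0.
Qed.

Lemma Phi_plus_1 (tau z : C) : dom tau z ->
  Phi 1 1 (2 * tau) (z + tau / 2 - 1 / 2) (z - tau / 2 + 1 / 2) (tau / 8)
  = Ci * (a0 tau z * a1 tau z) * theta 1 1 tau z / theta 0 0 tau z.
Proof.
intros H; assert (HT := proj1 H); assert (HT2 := Im_double tau HT).
destruct (theta_dom_neq0 tau z H) as [t00 [t01 [t10 [t11 [ha0 ha1]]]]].
assert (g1 : generic (2 * tau) (z + tau / 2 - 1 / 2)).
{ replace (z + tau / 2 - 1 / 2) with (z + IZR (-1) / 2 + IZR 1 / 2 * tau) by field; apply dom_generic2, H. }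
assert (g2 : generic (2 * tau) (z - tau / 2 + 1 / 2)).
{ replace (z - tau / 2 + 1 / 2) with (z + IZR 1 / 2 + IZR (-1) / 2 * tau) by field; apply dom_generic2, H. }
assert (E : z + tau / 2 - 1 / 2 + (z - tau / 2 + 1 / 2) = 2 * z) by field.
assert (g3 : generic (2 * tau) (z + tau / 2 - 1 / 2 + (z - tau / 2 + 1 / 2))).
{ rewrite E; replace (2 * z) with (2 * z + IZR 0 + IZR 0 * tau) by field; apply dom_generic2', H. }
rewrite Phi_one, E by assumption.
rewrite J_2z, a0_a1, (J_shift_down (2 * tau) (z - tau / 2 + 1 / 2)) by assumption.
rewrite <- (J_add1 _ (z + tau / 2 - 1 / 2)).
replace (z + tau / 2 - 1 / 2 + 1) with (z + tau / 2 + 1 / 2) by field.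
replace (z - tau / 2 + 1 / 2 + 2 * tau) with (z + tau / 2 + 1 / 2 + tau) by field.
assert (hd := J_dup tau (z + tau / 2 + 1 / 2) HT); rewrite <- theta00_J in hd by exact HT.
assert (hq := Q_neq0 tau HT); assert (hq2 := Q_neq0 _ HT2).
assert (hj : J (2 * tau) (z + tau / 2 + 1 / 2) * J (2 * tau) (z + tau / 2 + 1 / 2 + tau)
  = theta 0 0 tau z * Q (2 * tau) ^ 2 / Q tau) by (rewrite hd; field; exact hq).
rewrite (e2pi_plus _ (1 / 2)), e2pi_half.
replace (J (2 * tau) (z + tau / 2 + 1 / 2) * (- (e2pi (z - tau / 2) * - (1)) * J (2 * tau) (z + tau / 2 + 1 / 2 + tau)))
  with (e2pi (z - tau / 2) * (J (2 * tau) (z + tau / 2 + 1 / 2) * J (2 * tau) (z + tau / 2 + 1 / 2 + tau))) by ring.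
rewrite hj.
replace (z - tau / 4 + 1 / 4) with (z - tau / 2 + tau / 8 + tau / 8 + 1 / 4) by field.
rewrite !(e2pi_plus _ (1 / 4)), !(e2pi_plus _ (tau / 8)), e2pi_opp, e2pi_quarter.
field; repeat split; auto using e2pi_neq0.
Qed.

(** In the twisted sectors the two denominators agree up to periods. Here they give [a0^2], and
    [a0_a1] trades its inverse for [a1^2] over a square of [theta 1 0]; in the other sector the
    roles of [a0] and [a1] are exchanged. *)
Lemma Phi_tw_plus_1 (tau z : C) : dom tau z ->
  Phi 1 1 (2 * tau) (z + tau - 1 / 2) (z - tau + 1 / 2) (tau / 2)
  = Ci * a1 tau z ^ 2 * theta 1 1 tau z / theta 1 0 tau z.
Proof.
intros H; assert (HT := proj1 H); assert (HT2 := Im_double tau HT).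
destruct (theta_dom_neq0 tau z H) as [t00 [t01 [t10 [t11 [ha0 ha1]]]]].
assert (g1 : generic (2 * tau) (z + tau - 1 / 2)).
{ replace (z + tau - 1 / 2) with (z + IZR (-1) / 2 + IZR 2 / 2 * tau) by field; apply dom_generic2, H. }
assert (g2 : generic (2 * tau) (z - tau + 1 / 2)).
{ replace (z - tau + 1 / 2) with (z + IZR 1 / 2 + IZR (-2) / 2 * tau) by field; apply dom_generic2, H. }
assert (E : z + tau - 1 / 2 + (z - tau + 1 / 2) = 2 * z) by field.
assert (g3 : generic (2 * tau) (z + tau - 1 / 2 + (z - tau + 1 / 2))).
{ rewrite E; replace (2 * z) with (2 * z + IZR 0 + IZR 0 * tau) by field; apply dom_generic2', H. }
rewrite Phi_one, E by assumption.
rewrite J_2z, (J_shift_down (2 * tau) (z - tau + 1 / 2)) by assumption.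
rewrite <- (J_add1 _ (z + tau - 1 / 2)).
replace (z + tau - 1 / 2 + 1) with (z + 2 * tau / 2 + 1 / 2) by field.
replace (z - tau + 1 / 2 + 2 * tau) with (z + 2 * tau / 2 + 1 / 2) by field.
rewrite <- theta00_J by exact HT2; fold (a0 tau z).
assert (hq := Q_neq0 tau HT); assert (hq2 := Q_neq0 _ HT2).
assert (hz := a0_a1 tau z HT).
replace (a1 tau z) with (e2pi (tau / 8) * Q (2 * tau) ^ 2 / Q tau * theta 1 0 tau z / a0 tau z)
  by (rewrite <- hz; field; exact ha0).
replace (z - tau / 4 + 1 / 4) with ((z - tau) + (tau / 2) + tau / 8 + tau / 8 + 1 / 4) by field.
rewrite !(e2pi_plus _ (1 / 4)), !(e2pi_plus _ (tau / 8)), !(e2pi_plus _ (1 / 2)),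
  !(e2pi_plus _ (tau / 2)), e2pi_opp, e2pi_quarter, e2pi_half.
field; repeat split; auto using e2pi_neq0.
Qed.

Lemma Phi_tw_minus_1 (tau z : C) : dom tau z ->
  Phi 1 1 (2 * tau) (z - 1 / 2) (z + 1 / 2) 0
  = Ci * a0 tau z ^ 2 * theta 1 1 tau z / theta 1 0 tau z.
Proof.
intros H; assert (HT := proj1 H); assert (HT2 := Im_double tau HT).
destruct (theta_dom_neq0 tau z H) as [t00 [t01 [t10 [t11 [ha0 ha1]]]]].
assert (g1 : generic (2 * tau) (z - 1 / 2)).
{ replace (z - 1 / 2) with (z + IZR (-1) / 2 + IZR 0 / 2 * tau) by field; apply dom_generic2, H. }
assert (g2 : generic (2 * tau) (z + 1 / 2)).
{ replace (z + 1 / 2) with (z + IZR 1 / 2 + IZR 0 / 2 * tau) by field; apply dom_generic2, H. }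
assert (E : z - 1 / 2 + (z + 1 / 2) = 2 * z) by field.
assert (g3 : generic (2 * tau) (z - 1 / 2 + (z + 1 / 2))).
{ rewrite E; replace (2 * z) with (2 * z + IZR 0 + IZR 0 * tau) by field; apply dom_generic2', H. }
rewrite Phi_one, E by assumption.
rewrite J_2z by assumption.
rewrite <- (J_add1 _ (z - 1 / 2)).
replace (z - 1 / 2 + 1) with (z + 1 / 2) by field.
assert (hq := Q_neq0 tau HT); assert (hq2 := Q_neq0 _ HT2).
assert (hz := a0_a1 tau z HT).
replace (a0 tau z) with (e2pi (tau / 8) * Q (2 * tau) ^ 2 / Q tau * theta 1 0 tau z / a1 tau z)
  by (rewrite <- hz; field; exact ha1).
assert (hj : J (2 * tau) (z + 1 / 2) = e2pi (- (2 * tau / 8 - z / 2)) * a1 tau z).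
{ unfold a1; rewrite theta10_J, e2pi_opp by exact HT2; field; apply e2pi_neq0. }
rewrite hj.
replace (z - tau / 4 + 1 / 4) with (- (2 * tau / 8 - z / 2) + - (2 * tau / 8 - z / 2) + tau / 8 + tau / 8 + 1 / 4) by field.
replace (- 0) with (RtoC 0) by ring.
rewrite !(e2pi_plus _ (1 / 4)), !(e2pi_plus _ (tau / 8)),
  !(e2pi_plus _ (- (2 * tau / 8 - z / 2))), e2pi_0, e2pi_quarter.
field; repeat split; auto using e2pi_neq0.
Qed.

Lemma J_2z_half (tau z : C) : (0 < Im tau)%R ->
  J (2 * tau) (2 * z + tau) = Q (2 * tau) / Q tau ^ 2 * (theta 0 1 tau z * theta 0 0 tau z).
Proof.
intros HT; assert (hq := Q_neq0 tau HT); rewrite theta01_J, theta00_J by exact HT.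
rewrite <- (J_add1 tau (z + tau / 2)).
replace (2 * z + tau) with (2 * (z + tau / 2)) by field.
transitivity (J (2 * tau) (2 * (z + tau / 2)) * Q tau ^ 2 / Q tau ^ 2); [field; exact hq |].
rewrite J_sqr, J_add1 by exact HT; field; exact hq.
Qed.

(** With [X] and [Y] the two theta functions in the denominators, the bracket in [Phi_half_sum] has
    numerator [X^2 - e2pi (- z) Y^2] over [(X Y)^2]. The product [X Y] is a multiple of [theta 0 1]
    by duplication; the numerator is evaluated by a second use of [sqr_sum]. *)
Lemma Phi_minus_02 (tau z : C) : dom tau z ->
  Phi 1 (1 / 2) (2 * tau) (z + tau / 2) (z - tau / 2) (tau / 8)
  + Phi 1 (3 / 2) (2 * tau) (z + tau / 2) (z - tau / 2) (tau / 8)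
  = - Ci * (a0 tau z ^ 2 + a1 tau z ^ 2) * theta 1 1 tau z / theta 0 1 tau z.
Proof.
intros H; assert (HT := proj1 H); assert (HT2 := Im_double tau HT).
destruct (theta_dom_neq0 tau z H) as [t00 [t01 [t10 [t11 [ha0 ha1]]]]].
rewrite (Phi_half_sum _ _ _ _ 0); try assumption.
2:{ field. }
2:{ replace (z + tau / 2) with (z + IZR 0 / 2 + IZR 1 / 2 * tau) by field; apply dom_generic2, H. }
2:{ replace (z - tau / 2) with (z + IZR 0 / 2 + IZR (-1) / 2 * tau) by field; apply dom_generic2, H. }
2:{ replace (2 * (z + tau / 2)) with (2 * z + IZR 0 + IZR 1 * tau) by field; apply dom_generic2', H. }
2:{ replace (2 * (z - tau / 2)) with (2 * z + IZR 0 + IZR (-1) * tau) by field; apply dom_generic2', H. }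
replace (2 * (z + tau / 2)) with (2 * z + tau) by field.
replace (- (2 * (z - tau / 2))) with (2 * tau - (2 * z + tau)) by field.
rewrite J_swap, J_2z_half by exact HT.
set (X := J (2 * tau) (- (z - tau / 2))); set (Y := J (2 * tau) (z + tau / 2)).
assert (hq := Q_neq0 tau HT); assert (hq2 := Q_neq0 _ HT2).
assert (HXY : X * Y = Q (2 * tau) ^ 2 / Q tau * theta 0 1 tau z).
{ unfold X; rewrite <- J_swap; replace (2 * tau - - (z - tau / 2)) with (z + tau / 2 + tau) by field.
  assert (hd := J_dup tau (z + tau / 2) HT); fold Y in hd.
  rewrite theta01_J by exact HT.
  transitivity (Q tau * (Y * J (2 * tau) (z + tau / 2 + tau)) / Q tau); [field; exact hq |].
  rewrite <- hd; field; exact hq. }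
assert (HXY0 : X * Y <> 0).
{ rewrite HXY; apply Cmult_neq_0; [| exact t01].
  apply Cdiv_neq0; [apply Cpow_nz, hq2 | exact hq]. }
assert (hX : X <> 0) by (intros E; apply HXY0; rewrite E; ring).
assert (hY : Y <> 0) by (intros E; apply HXY0; rewrite E; ring).
(* At this point [a0] equals [X] and [a1^2] equals [- e2pi (- z) Y^2], so [sqr_sum] turns the
   numerator into a theta constant times [J tau (- z)], that is, [theta 1 1] at [z] up to an
   exponential. *)
set (w := - z - tau / 2 - 1 / 2).
assert (Hw0 : a0 tau w = X).
{ unfold a0, X, w; rewrite theta00_J by exact HT2; f_equal; field. }
assert (Hw1 : a1 tau w ^ 2 = - e2pi (- z) * Y ^ 2).
{ unfold a1; rewrite theta10_J by exact HT2.
  replace (w + 1 / 2) with (- (z + tau / 2)) by (unfold w; field).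
  rewrite J_opp by exact HT2; fold Y.
  transitivity ((e2pi (2 * tau / 8 - w / 2) * e2pi (- (z + tau / 2))) ^ 2 * Y ^ 2); [ring |].
  rewrite <- e2pi_plus, <- e2pi_double.
  replace (2 * (2 * tau / 8 - w / 2 + - (z + tau / 2))) with (1 / 2 + - z) by (unfold w; field).
  rewrite e2pi_plus, e2pi_half; ring. }
assert (Hs := sqr_sum tau w HT); rewrite Hw0, Hw1, (theta00_J tau w) in Hs by exact HT.
replace (w + tau / 2 + 1 / 2) with (- z) in Hs by (unfold w; field).
rewrite J_opp in Hs by exact HT.
rewrite sqr_sum by exact HT.
replace (e2pi (- (z - tau / 2) / 2)) with (e2pi ((z + tau / 2) / 2) * e2pi (- z))
  by (rewrite <- e2pi_plus; f_equal; field).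
transitivity (e2pi (- (tau / 8)) * e2pi ((z + tau / 2) / 2) * Q (2 * tau) ^ 3 *
  (Q (2 * tau) / Q tau ^ 2 * (theta 0 1 tau z * theta 0 0 tau z)) *
  (X ^ 2 + - e2pi (- z) * Y ^ 2) / (X * Y) ^ 2).
{ field; repeat split; assumption. }
rewrite Hs, HXY, theta11_J by exact HT.
replace (e2pi ((z + tau / 2) / 2)) with (e2pi (tau / 8 - z / 2 - 1 / 4) * e2pi (tau / 8) * e2pi z * e2pi (1 / 4))
  by (rewrite <- !e2pi_plus; f_equal; field).
rewrite !e2pi_opp, e2pi_quarter.
field; repeat split; auto using e2pi_neq0.
Qed.

(** The shift by 1/2 interchanges [theta 0 0] and [theta 0 1]. The auxiliary point becomes
    [- z - tau / 2], where [a1^2] carries the opposite sign, and [sqr_diff] replaces [sqr_sum]. *)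
Lemma Phi_plus_02 (tau z : C) : dom tau z ->
  Phi 1 (1 / 2) (2 * tau) (z + tau / 2 - 1 / 2) (z - tau / 2 + 1 / 2) (tau / 8)
  + Phi 1 (3 / 2) (2 * tau) (z + tau / 2 - 1 / 2) (z - tau / 2 + 1 / 2) (tau / 8)
  = - (a0 tau z ^ 2 - a1 tau z ^ 2) * theta 1 1 tau z / theta 0 0 tau z.
Proof.
intros H; assert (HT := proj1 H); assert (HT2 := Im_double tau HT).
destruct (theta_dom_neq0 tau z H) as [t00 [t01 [t10 [t11 [ha0 ha1]]]]].
rewrite (Phi_half_sum _ _ _ _ (-1)); try assumption.
2:{ field. }
2:{ replace (z + tau / 2 - 1 / 2) with (z + IZR (-1) / 2 + IZR 1 / 2 * tau) by field; apply dom_generic2, H. }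
2:{ replace (z - tau / 2 + 1 / 2) with (z + IZR 1 / 2 + IZR (-1) / 2 * tau) by field; apply dom_generic2, H. }
2:{ replace (2 * (z + tau / 2 - 1 / 2)) with (2 * z + IZR (-1) + IZR 1 * tau) by field; apply dom_generic2', H. }
2:{ replace (2 * (z - tau / 2 + 1 / 2)) with (2 * z + IZR 1 + IZR (-1) * tau) by field; apply dom_generic2', H. }
rewrite <- (J_add1 _ (2 * (z + tau / 2 - 1 / 2))), <- (J_add1 _ (- (2 * (z - tau / 2 + 1 / 2)))).
replace (2 * (z + tau / 2 - 1 / 2) + 1) with (2 * z + tau) by field.
replace (- (2 * (z - tau / 2 + 1 / 2)) + 1) with (2 * tau - (2 * z + tau)) by field.
rewrite J_swap, J_2z_half by exact HT.
set (X := J (2 * tau) (- (z - tau / 2 + 1 / 2))); set (Y := J (2 * tau) (z + tau / 2 - 1 / 2)).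
assert (hq := Q_neq0 tau HT); assert (hq2 := Q_neq0 _ HT2).
assert (HXY : X * Y = Q (2 * tau) ^ 2 / Q tau * theta 0 0 tau z).
{ unfold X; rewrite <- J_add1, <- J_swap.
  replace (2 * tau - (- (z - tau / 2 + 1 / 2) + 1)) with (z + tau / 2 - 1 / 2 + tau) by field.
  assert (hd := J_dup tau (z + tau / 2 - 1 / 2) HT); fold Y in hd.
  rewrite theta00_J by exact HT.
  replace (z + tau / 2 + 1 / 2) with (z + tau / 2 - 1 / 2 + 1) by field; rewrite J_add1.
  transitivity (Q tau * (Y * J (2 * tau) (z + tau / 2 - 1 / 2 + tau)) / Q tau); [field; exact hq |].
  rewrite <- hd; field; exact hq. }
assert (HXY0 : X * Y <> 0).
{ rewrite HXY; apply Cmult_neq_0; [| exact t00].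
  apply Cdiv_neq0; [apply Cpow_nz, hq2 | exact hq]. }
assert (hX : X <> 0) by (intros E; apply HXY0; rewrite E; ring).
assert (hY : Y <> 0) by (intros E; apply HXY0; rewrite E; ring).
set (w := - z - tau / 2).
assert (Hw0 : a0 tau w = X).
{ unfold a0, X, w; rewrite theta00_J, <- (J_add1 _ (- (z - tau / 2 + 1 / 2))) by exact HT2; f_equal; field. }
assert (Hw1 : a1 tau w ^ 2 = e2pi (- z) * Y ^ 2).
{ unfold a1; rewrite theta10_J by exact HT2.
  replace (w + 1 / 2) with (- (z + tau / 2 - 1 / 2)) by (unfold w; field).
  rewrite J_opp by exact HT2; fold Y.
  transitivity ((e2pi (2 * tau / 8 - w / 2) * e2pi (- (z + tau / 2 - 1 / 2))) ^ 2 * Y ^ 2); [ring |].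
  rewrite <- e2pi_plus, <- e2pi_double.
  replace (2 * (2 * tau / 8 - w / 2 + - (z + tau / 2 - 1 / 2))) with (1 + - z) by (unfold w; field).
  rewrite e2pi_plus, e2pi_1; ring. }
assert (Hs := sqr_diff tau w HT); rewrite Hw0, Hw1, (theta01_J tau w) in Hs by exact HT.
replace (w + tau / 2) with (- z) in Hs by (unfold w; field).
rewrite J_opp in Hs by exact HT.
rewrite sqr_diff by exact HT.
replace (e2pi (- (z - tau / 2 + 1 / 2) / 2)) with (e2pi ((z + tau / 2 - 1 / 2) / 2) * e2pi (- z))
  by (rewrite <- e2pi_plus; f_equal; field).
transitivity (e2pi (- (tau / 8)) * e2pi ((z + tau / 2 - 1 / 2) / 2) * Q (2 * tau) ^ 3 *
  (Q (2 * tau) / Q tau ^ 2 * (theta 0 1 tau z * theta 0 0 tau z)) *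
  (X ^ 2 - e2pi (- z) * Y ^ 2) / (X * Y) ^ 2).
{ field; repeat split; assumption. }
rewrite Hs, HXY, theta11_J by exact HT.
replace (e2pi ((z + tau / 2 - 1 / 2) / 2)) with (e2pi (tau / 8 - z / 2 - 1 / 4) * e2pi (tau / 8) * e2pi z)
  by (rewrite <- !e2pi_plus; f_equal; field).
rewrite !e2pi_opp.
field; repeat split; auto using e2pi_neq0.
Qed.

(** In each term the second summand is the first times [X], where [1 - X] is the denominator; the
    difference cancels it and leaves purely Gaussian series. These are the even and the odd part of
    the series of [theta 1 1]. *)
Lemma Phi_minus_diff (tau z : C) : dom tau z ->
  Phi 1 (1 / 2) (2 * tau) (z + tau / 2) (z - tau / 2) (tau / 8)
  - Phi 1 (3 / 2) (2 * tau) (z + tau / 2) (z - tau / 2) (tau / 8)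
  = - Ci * theta 1 1 tau z.
Proof.
intros H; assert (HT := proj1 H); assert (HT2 := Im_double tau HT).
assert (g1 : generic (2 * tau) (z + tau / 2)).
{ replace (z + tau / 2) with (z + IZR 0 / 2 + IZR 1 / 2 * tau) by field; apply dom_generic2, H. }
assert (g2 : generic (2 * tau) (z - tau / 2)).
{ replace (z - tau / 2) with (z + IZR 0 / 2 + IZR (-1) / 2 * tau) by field; apply dom_generic2, H. }
rewrite !Phi_terms.
set (g := fun (x : C) (n : Z) => e2pi (tau * (2 * IZR n + 1 / 2) ^ 2 / 2 + (2 * IZR n + 1 / 2) * x)).
assert (Hg : forall x, exists K, bd K (g x)).
{ intros x; apply (bd_gauss (2 * tau) (tau + 2 * x) (tau / 8 + x / 2)); [exact HT2 |].
  intros n; unfold g; f_equal; field. }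
destruct (Hg z) as [Kp Bp]; destruct (Hg (- z)) as [Km Bm].
assert (E1 : CSumZ (phi1_term (1 / 2) (2 * tau) (z + tau / 2) (z - tau / 2))
  - CSumZ (phi1_term (3 / 2) (2 * tau) (z + tau / 2) (z - tau / 2)) = e2pi (tau / 8) * CSumZ (g z)).
{ destruct (bd_phi1 (1 / 2) _ (z + tau / 2) (z - tau / 2) HT2 g1) as [K1 B1].
  destruct (bd_phi1 (3 / 2) _ (z + tau / 2) (z - tau / 2) HT2 g1) as [K2 B2].
  rewrite <- (CSumZ_minus _ _ _ _ B1 B2), <- (CSumZ_scal _ _ _ Bp).
  apply CSumZ_ext; intros n; unfold phi1_term, g.
  assert (h1 := C1_minus_neq0 _ (g1 n)).
  rewrite <- !e2pi_plus, !RtoC_div by lra.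
  set (x := z + tau / 2 + IZR n * (2 * tau)) in *.
  match goal with |- e2pi ?A / _ - e2pi ?B / _ = _ => replace B with (A + x) by (unfold x; field) end.
  rewrite (e2pi_plus _ x).
  match goal with |- e2pi ?A / _ - _ = e2pi ?B => replace B with A by field end.
  field; exact h1. }
assert (E2 : CSumZ (phi2_term (1 / 2) (2 * tau) (z + tau / 2) (z - tau / 2))
  - CSumZ (phi2_term (3 / 2) (2 * tau) (z + tau / 2) (z - tau / 2)) = e2pi (tau / 8) * CSumZ (g (- z))).
{ destruct (bd_phi2 (1 / 2) _ (z + tau / 2) (z - tau / 2) HT2 g2) as [K1 B1].
  destruct (bd_phi2 (3 / 2) _ (z + tau / 2) (z - tau / 2) HT2 g2) as [K2 B2].
  rewrite <- (CSumZ_minus _ _ _ _ B1 B2), <- (CSumZ_scal _ _ _ Bm).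
  apply CSumZ_ext; intros n; unfold phi2_term, g.
  assert (h1 := C1_minus_neq0 _ (generic_opp _ _ g2 n)).
  rewrite <- !e2pi_plus, !RtoC_div by lra.
  set (x := - (z - tau / 2) + IZR n * (2 * tau)) in *.
  match goal with |- e2pi ?A / _ - e2pi ?B / _ = _ => replace B with (A + x) by (unfold x; field) end.
  rewrite (e2pi_plus _ x).
  match goal with |- e2pi ?A / _ - _ = e2pi ?B => replace B with A by field end.
  field; exact h1. }
transitivity (CSumZ (g z) - CSumZ (g (- z))).
{ transitivity (e2pi (- (tau / 8)) *
   ((CSumZ (phi1_term (1 / 2) (2 * tau) (z + tau / 2) (z - tau / 2))
  - CSumZ (phi1_term (3 / 2) (2 * tau) (z + tau / 2) (z - tau / 2))) -
   (CSumZ (phi2_term (1 / 2) (2 * tau) (z + tau / 2) (z - tau / 2))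
  - CSumZ (phi2_term (3 / 2) (2 * tau) (z + tau / 2) (z - tau / 2))))); [ring |].
  rewrite E1, E2, e2pi_opp; field; apply e2pi_neq0. }
rewrite theta11_10, theta10_e2pi.
destruct (theta10_bd tau (z + 1 / 2) HT) as [K HK].
rewrite (CSumZ_split _ 2 _ ltac:(lia) HK); cbn [csum].
rewrite (CSumZ_ext (fun n => e2pi (tau * (IZR (Z.of_nat 2 * n + Z.of_nat 0) + 1 / 2) ^ 2 / 2 +
  (IZR (Z.of_nat 2 * n + Z.of_nat 0) + 1 / 2) * (z + 1 / 2))) (fun n => Ci * g z n)).
2:{ intros n; unfold g; rewrite <- e2pi_quarter, <- e2pi_plus.
  replace (Z.of_nat 2 * n + Z.of_nat 0)%Z with (2 * n)%Z by lia.
  transitivity (e2pi (1 / 4 + (tau * (2 * IZR n + 1 / 2) ^ 2 / 2 + (2 * IZR n + 1 / 2) * z)) * e2pi (IZR n)).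
  - rewrite <- e2pi_plus; f_equal; push_RtoC; field.
  - rewrite e2pi_Z; ring. }
assert (HK1 := bd_mul _ _ 2 1 ltac:(lia) HK).
(* The substitution of [- (n + 1)] for [n] takes the half-integer [2 n + 3 / 2] to
   [- (2 n + 1 / 2)], which is the even part at [- z]. *)
rewrite <- (CSumZ_opp _ _ HK1), <- (CSumZ_shift _ _ 1 (bd_opp _ _ HK1)).
rewrite (CSumZ_ext (fun n => e2pi (tau * (IZR (Z.of_nat 2 * - (n + 1) + Z.of_nat 1) + 1 / 2) ^ 2 / 2 +
  (IZR (Z.of_nat 2 * - (n + 1) + Z.of_nat 1) + 1 / 2) * (z + 1 / 2))) (fun n => - Ci * g (- z) n)).
2:{ intros n; unfold g; rewrite <- e2pi_3quarter, <- e2pi_plus.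
  replace (Z.of_nat 2 * - (n + 1) + Z.of_nat 1)%Z with (- (2 * n + 1))%Z by lia.
  transitivity (e2pi (3 / 4 + (tau * (2 * IZR n + 1 / 2) ^ 2 / 2 + (2 * IZR n + 1 / 2) * - z)) * e2pi (IZR (- (n + 1)))).
  - rewrite <- e2pi_plus; f_equal; push_RtoC; field.
  - rewrite e2pi_Z; ring. }
rewrite (CSumZ_scal _ _ _ Bp), (CSumZ_scal _ _ _ Bm).
assert (Hi : Ci * Ci = - (1)) by (apply C_eq; cbn; ring).
transitivity (- (Ci * Ci) * (CSumZ (g z) - CSumZ (g (- z)))); [rewrite Hi; ring | ring].
Qed.

Lemma RtoC_neq0 (x : R) : x <> 0%R -> RtoC x <> 0.
Proof. intros H E; apply H, RtoC_inj, E. Qed.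

Lemma sqrt2_neq0 : RtoC (sqrt 2) <> 0.
Proof. apply RtoC_neq0, Rgt_not_eq, sqrt_lt_R0; lra. Qed.

Lemma eta_triple_neq0 (tau : C) : (0 < Im tau)%R ->
  eta tau <> 0 /\ eta (tau / 2) <> 0 /\ eta (2 * tau) <> 0.
Proof.
intros H; repeat split; apply eta_neq0; [exact H | apply Im_half, H | apply Im_double, H].
Qed.

Ltac ch_tac H :=
  let HT := fresh in assert (HT := proj1 H);
  let e := fresh in let e2 := fresh in let e3 := fresh in
  destruct (eta_triple_neq0 _ HT) as [e [e2 e3]];
  let t0 := fresh in let t1 := fresh in let t2 := fresh in let t3 := fresh in
  destruct (theta_dom_neq0 _ _ H) as [t0 [t1 [t2 [t3 _]]]];
  unfold R_plus, R_minus, R_tw, w1, w2, w3; field; repeat split; auto using sqrt2_neq0.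

Lemma ch_minus_1 (tau z : C) : dom tau z ->
  ch_minus 1 tau z = - Ci * (w1 tau * (a0 tau z * a1 tau z)).
Proof. intros H; unfold ch_minus; rewrite s_of_1, Phi_minus_1 by exact H; ch_tac H. Qed.

Lemma ch_plus_1 (tau z : C) : dom tau z ->
  ch_plus 1 tau z = Ci * (w3 tau * (a0 tau z * a1 tau z)).
Proof. intros H; unfold ch_plus; rewrite s_of_1, Phi_plus_1 by exact H; ch_tac H. Qed.

Lemma ch_tw_plus_1 (tau z : C) : dom tau z ->
  ch_tw_sigma_plus 1 tau z = Ci * sqrt 2 * (w2 tau * a1 tau z ^ 2).
Proof. intros H; unfold ch_tw_sigma_plus; rewrite s_of_1, Phi_tw_plus_1 by exact H; ch_tac H. Qed.

Lemma ch_tw_minus_1 (tau z : C) : dom tau z ->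
  ch_tw_sigma_minus 1 tau z = Ci * sqrt 2 * (w2 tau * a0 tau z ^ 2).
Proof. intros H; unfold ch_tw_sigma_minus; rewrite s_of_1, Phi_tw_minus_1 by exact H; ch_tac H. Qed.

Lemma ch_minus_02 (tau z : C) : dom tau z ->
  ch_minus 0 tau z + ch_minus 2 tau z = - Ci * (w1 tau * (a0 tau z ^ 2 + a1 tau z ^ 2)).
Proof.
intros H; unfold ch_minus; rewrite s_of_0, s_of_2; unfold Cdiv; rewrite <- Cmult_plus_distr_r.
rewrite Phi_minus_02 by exact H; ch_tac H.
Qed.

Lemma ch_plus_02 (tau z : C) : dom tau z ->
  ch_plus 0 tau z + ch_plus 2 tau z = - (1) * (w3 tau * (a0 tau z ^ 2 - a1 tau z ^ 2)).
Proof.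
intros H; unfold ch_plus; rewrite s_of_0, s_of_2; unfold Cdiv; rewrite <- Cmult_plus_distr_r.
rewrite Phi_plus_02 by exact H; ch_tac H.
Qed.

Lemma ch_minus_diff (tau z : C) : dom tau z ->
  ch_minus 0 tau z - ch_minus 2 tau z = - Ci * (w1 tau * theta 0 1 tau z).
Proof.
intros H; unfold ch_minus; rewrite s_of_0, s_of_2; unfold Cdiv.
match goal with |- ?a * ?c - ?b * ?c = _ => transitivity ((a - b) * c); [ring |] end.
rewrite Phi_minus_diff by exact H; ch_tac H.
Qed.

(** * Poisson summation *)

Definition gs (sg x : C) : C := e2pi (sg * x ^ 2 / 2).

(** The periodization of [exp (pi i sg x^2)], at complex [z]: besides the period 1 it has the
    quasi-period [- 1 / sg], on which the argument rests. *)
Definition gsum (sg z : C) : C := CSumZ (fun n => gs sg (z - IZR n)).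

Lemma Cmod_gs (sg x : C) : Cmod (gs sg x) = exp (- (PI * Im (sg * x ^ 2))).
Proof.
unfold gs; rewrite Cmod_e2pi; f_equal.
replace (Im (sg * x ^ 2 / 2)) with (Im (sg * x ^ 2) / 2)%R; [field |].
destruct (sg * x ^ 2); cbn; field.
Qed.

Lemma exp_abs_majorant (A B : R) : (0 < A)%R -> exists K, (0 < K)%R /\
  forall n : Z, (exp (- (A * IZR n ^ 2) + B * Rabs (IZR n)) <= K / (1 + IZR n ^ 2))%R.
Proof.
intros HA; exists (4 * exp ((Rabs B + 1) ^ 2 / (4 * A)))%R; split.
- apply Rmult_lt_0_compat; [lra | apply exp_pos].
- intros n; apply gauss_majorant, HA.
Qed.

(** Uniform for [u] in a disc. The weight [exp (D |u - n|)] is there to absorb the exponential in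
    the Taylor remainder. *)
Lemma gs_bound (sg : C) (rho D : R) : (0 < Im sg)%R -> (0 <= rho)%R -> (0 <= D)%R ->
  exists K, (0 < K)%R /\ forall (u : C) (n : Z), (Cmod u <= rho)%R ->
  (Cmod (gs sg (u - IZR n)) * exp (D * Cmod (u - IZR n)) <= K / (1 + IZR n ^ 2))%R.
Proof.
intros HT Hr HD; assert (Hp := PI_RGT_0).
destruct (exp_abs_majorant (PI * Im sg) (2 * PI * Cmod sg * rho + D)) as [K [HK H]].
{ apply Rmult_lt_0_compat; lra. }
exists (exp (PI * Cmod sg * rho ^ 2 + D * rho) * K)%R; split.
{ apply Rmult_lt_0_compat; [apply exp_pos | exact HK]. }
intros u n Hu.
unfold Rdiv; rewrite Rmult_assoc.
eapply Rle_trans; [| apply Rmult_le_compat_l; [left; apply exp_pos | apply H]].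
rewrite Cmod_gs, <- !exp_plus; apply exp_le.
assert (Hs := Cmod_ge_0 sg).
assert (h1 : (Cmod (u - IZR n) <= rho + Rabs (IZR n))%R).
{ unfold Cminus; eapply Rle_trans; [apply Cmod_triangle |].
  rewrite Cmod_opp, Cmod_R; lra. }
replace (sg * (u - IZR n) ^ 2) with (sg * IZR n ^ 2 + (- 2 * IZR n * (sg * u) + sg * u ^ 2)) by ring.
replace (Im (sg * IZR n ^ 2 + (- 2 * IZR n * (sg * u) + sg * u ^ 2)))
  with (Im sg * IZR n ^ 2 + (- 2 * IZR n * Im (sg * u) + Im (sg * u ^ 2)))%R
  by (destruct sg, u; cbn; ring).
assert (h2 := im_le_Cmod (sg * u)); rewrite Cmod_mult in h2.
assert (h3 := im_le_Cmod (sg * u ^ 2)); rewrite Cmod_mult, Cmod_pow in h3.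
assert (hu := Cmod_ge_0 u).
assert (h2' : (Rabs (Im (sg * u)) <= Cmod sg * rho)%R)
  by (eapply Rle_trans; [exact h2 | apply Rmult_le_compat_l; lra]).
assert (h3' : (Rabs (Im (sg * u ^ 2)) <= Cmod sg * rho ^ 2)%R).
{ eapply Rle_trans; [exact h3 |]; apply Rmult_le_compat_l; [lra |]; apply pow_incr; lra. }
assert (hn := Rabs_pos (IZR n)).
assert (h4 : (IZR n * Im (sg * u) <= Rabs (IZR n) * (Cmod sg * rho))%R).
{ eapply Rle_trans; [apply Rle_abs |]; rewrite Rabs_mult.
  apply Rmult_le_compat_l; assumption. }
assert (h5 : (- Im (sg * u ^ 2) <= Cmod sg * rho ^ 2)%R).
{ eapply Rle_trans; [apply Rle_abs |]; rewrite Rabs_Ropp; exact h3'. }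
assert (h6 : (D * Cmod (u - IZR n) <= D * (rho + Rabs (IZR n)))%R)
  by (apply Rmult_le_compat_l; assumption).
apply Rmult_le_compat_l with (r := PI) in h4; [| lra].
apply Rmult_le_compat_l with (r := PI) in h5; [| lra].
nra.
Qed.

Lemma gs_bound0 (sg : C) (rho : R) : (0 < Im sg)%R -> (0 <= rho)%R ->
  exists K, (0 < K)%R /\ forall u : C, (Cmod u <= rho)%R -> bd K (fun n => gs sg (u - IZR n)).
Proof.
intros HT Hr; destruct (gs_bound sg rho 0 HT Hr (Rle_refl 0)) as [K [HK H]].
exists K; split; [exact HK |]; intros u Hu n.
specialize (H u n Hu); rewrite Rmult_0_l, exp_0, Rmult_1_r in H; exact H.
Qed.

Lemma gs_bd (sg u : C) : (0 < Im sg)%R -> exists K, bd K (fun n => gs sg (u - IZR n)).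
Proof.
intros HT; destruct (gs_bound0 sg (Cmod u) HT (Cmod_ge_0 u)) as [K [_ H]].
exists K; apply H, Rle_refl.
Qed.

Lemma exp_ge_1 (x : R) : (0 <= x -> 1 <= exp x)%R.
Proof. intros H; assert (h := exp_ineq1_le x); lra. Qed.

Definition gs' (sg x : C) : C := 2 * PI * Ci * sg * x * gs sg x.

Lemma sq_le_exp (t : R) : (0 <= t -> t ^ 2 <= 4 * exp t)%R.
Proof. intros H; assert (h := quad_le_exp t); rewrite Rabs_pos_eq in h by exact H; lra. Qed.

(** The quotient [gs (x + e) / gs x] is [Cexp w] with [w = 2 pi i sg (x e + e^2 / 2)], so the
    remainder is that of [Cexp] at [w] plus the quadratic part of [w]. The majorant is summable in
    [n] and uniform in [u] and [e]. *)
Lemma gs_taylor (sg : C) (rho : R) : (0 < Im sg)%R -> (0 <= rho)%R ->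
  exists K, (0 < K)%R /\ forall (u e : C) (n : Z), (Cmod u <= rho)%R -> (Cmod e <= rho)%R ->
  (Cmod (gs sg (u + e - IZR n) - gs sg (u - IZR n) - e * gs' sg (u - IZR n))
    <= Cmod e ^ 2 * (K / (1 + IZR n ^ 2)))%R.
Proof.
intros HT Hr; assert (Hp := PI_RGT_0); assert (Hs := Cmod_ge_0 sg).
set (S := (2 * PI * Cmod sg)%R).
assert (HS : (0 <= S)%R) by (unfold S; apply Rmult_le_pos; lra).
(* The weight covers [exp |w|], by [|w| <= S rho (|x| + rho)], and one further [exp (|x| + rho)],
   which bounds the square of [|x| + rho] up to the factor 4. *)
destruct (gs_bound sg rho (S * rho + 1) HT Hr) as [K [HK H]].
{ assert (0 <= S * rho)%R by (apply Rmult_le_pos; lra); lra. }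
set (E := exp ((S * rho + 1) * rho)).
assert (HE : (1 <= E)%R).
{ unfold E; apply exp_ge_1, Rmult_le_pos; [| exact Hr].
  assert (0 <= S * rho)%R by (apply Rmult_le_pos; lra); lra. }
exists ((20 * S ^ 2 + S + 1) * E * K)%R; split.
{ assert (0 <= S ^ 2)%R by apply pow2_ge_0.
  repeat apply Rmult_lt_0_compat; lra. }
intros u e n Hu He; specialize (H u n Hu).
set (x := u - IZR n) in *.
replace (u + e - IZR n) with (x + e) by (unfold x; ring).
set (w := 2 * PI * Ci * (sg * (x * e + e ^ 2 / 2))).
assert (E1 : gs sg (x + e) = gs sg x * Cexp w).
{ unfold gs, e2pi, w; rewrite <- Cexp_plus; f_equal; field. }
replace (gs sg (x + e) - gs sg x - e * gs' sg x)
  with (gs sg x * ((Cexp w - 1 - w) + 2 * PI * Ci * (sg * (e ^ 2 / 2))))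
  by (rewrite E1; unfold gs', w; field).
rewrite Cmod_mult.
assert (He0 := Cmod_ge_0 e); assert (Hx0 := Cmod_ge_0 x).
assert (Hci : Cmod (2 * PI * Ci) = (2 * PI)%R).
{ rewrite !Cmod_mult, Cmod_Ci, !Cmod_R, !Rabs_pos_eq by lra; ring. }
assert (He2 : (Cmod (e ^ 2 / 2) <= Cmod e ^ 2)%R).
{ rewrite Cmod_div, Cmod_pow, Cmod_R, Rabs_pos_eq by (try lra; apply RtoC_neq0; lra).
  assert (0 <= Cmod e ^ 2)%R by apply pow2_ge_0; lra. }
assert (Hw : (Cmod w <= S * Cmod e * (Cmod x + rho))%R).
{ unfold w; rewrite Cmod_mult, Hci, Cmod_mult; unfold S.
  assert (h : (Cmod (x * e + e ^ 2 / 2) <= Cmod e * (Cmod x + rho))%R).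
  { eapply Rle_trans; [apply Cmod_triangle |]; rewrite Cmod_mult; nra. }
  apply Rmult_le_compat_l with (r := (2 * PI * Cmod sg)%R) in h; [nra | exact HS]. }
assert (Hw0 := Cmod_ge_0 w).
assert (Hwe : (Cmod w <= S * rho * (Cmod x + rho))%R).
{ eapply Rle_trans; [exact Hw |]; apply Rmult_le_compat_r; [lra |].
  apply Rmult_le_compat_l; assumption. }
assert (Hw2 : (Cmod w ^ 2 <= S ^ 2 * Cmod e ^ 2 * (4 * exp (Cmod x + rho)))%R).
{ apply Rle_trans with ((S * Cmod e * (Cmod x + rho)) ^ 2)%R; [apply pow_incr; lra |].
  rewrite !Rpow_mult_distr; apply Rmult_le_compat_l;
    [apply Rmult_le_pos; apply pow2_ge_0 | apply sq_le_exp; lra]. }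
assert (Hexp : (exp (Cmod x + rho) * exp (Cmod w) <= E * exp ((S * rho + 1) * Cmod x))%R).
{ unfold E; rewrite <- !exp_plus; apply exp_le; lra. }
assert (Hex1 : (1 <= exp ((S * rho + 1) * Cmod x))%R).
{ apply exp_ge_1, Rmult_le_pos; [| exact Hx0].
  assert (0 <= S * rho)%R by (apply Rmult_le_pos; lra); lra. }
assert (HT2 := Cexp_taylor2 w).
set (X := exp ((S * rho + 1) * Cmod x)) in *.
assert (Hmain : (Cmod (Cexp w - 1 - w + 2 * PI * Ci * (sg * (e ^ 2 / 2)))
  <= Cmod e ^ 2 * ((20 * S ^ 2 + S + 1) * E * X))%R).
{ eapply Rle_trans; [apply Cmod_triangle |].
  assert (A1 : (Cmod (Cexp w - 1 - w) <= Cmod e ^ 2 * (20 * S ^ 2 * (E * X)))%R).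
  { eapply Rle_trans; [exact HT2 |].
    apply Rle_trans with (5 * (S ^ 2 * Cmod e ^ 2 * (4 * exp (Cmod x + rho))) * exp (Cmod w))%R.
    - apply Rmult_le_compat_r; [left; apply exp_pos | lra].
    - replace (5 * (S ^ 2 * Cmod e ^ 2 * (4 * exp (Cmod x + rho))) * exp (Cmod w))%R
        with ((Cmod e ^ 2 * (20 * S ^ 2)) * (exp (Cmod x + rho) * exp (Cmod w)))%R by ring.
      replace (Cmod e ^ 2 * (20 * S ^ 2 * (E * X)))%R
        with ((Cmod e ^ 2 * (20 * S ^ 2)) * (E * X))%R by ring.
      apply Rmult_le_compat_l; [| exact Hexp].
      apply Rmult_le_pos; [apply pow2_ge_0 |]; assert (h := pow2_ge_0 S); lra. }
  assert (A2 : (Cmod (2 * PI * Ci * (sg * (e ^ 2 / 2))) <= Cmod e ^ 2 * (S * (E * X)))%R).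
  { rewrite Cmod_mult, Hci, Cmod_mult, <- Rmult_assoc; fold S.
    apply Rle_trans with (S * Cmod e ^ 2)%R; [apply Rmult_le_compat_l; assumption |].
    assert (1 <= E * X)%R by nra.
    assert (0 <= S * Cmod e ^ 2)%R by (apply Rmult_le_pos; [exact HS | apply pow2_ge_0]); nra. }
  assert (0 <= Cmod e ^ 2 * (E * X))%R by (apply Rmult_le_pos; [apply pow2_ge_0 | nra]).
  lra. }
apply Rle_trans with (Cmod (gs sg x) * (Cmod e ^ 2 * ((20 * S ^ 2 + S + 1) * E * X)))%R.
{ apply Rmult_le_compat_l; [apply Cmod_ge_0 | exact Hmain]. }
replace (Cmod (gs sg x) * (Cmod e ^ 2 * ((20 * S ^ 2 + S + 1) * E * X)))%R
  with (Cmod e ^ 2 * ((20 * S ^ 2 + S + 1) * E) * (Cmod (gs sg x) * X))%R by ring.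
replace (Cmod e ^ 2 * ((20 * S ^ 2 + S + 1) * E * K / (1 + IZR n ^ 2)))%R
  with (Cmod e ^ 2 * ((20 * S ^ 2 + S + 1) * E) * (K / (1 + IZR n ^ 2)))%R by (unfold Rdiv; ring).
apply Rmult_le_compat_l; [| exact H].
assert (0 <= S ^ 2)%R by apply pow2_ge_0.
apply Rmult_le_pos; [apply pow2_ge_0 | apply Rmult_le_pos; lra].
Qed.

Lemma gs'_bd (sg u : C) : (0 < Im sg)%R -> exists K, bd K (fun n => gs' sg (u - IZR n)).
Proof.
intros HT; destruct (gs_bound sg (Cmod u) 1 HT (Cmod_ge_0 u) Rle_0_1) as [K [HK H]].
exists (Cmod (2 * PI * Ci * sg) * K)%R; intros n; unfold gs'.
set (x := u - IZR n); rewrite !Cmod_mult, <- !Cmod_mult; rewrite (Cmod_mult _ (gs sg x)), (Cmod_mult _ x).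
unfold Rdiv; rewrite !Rmult_assoc; apply Rmult_le_compat_l; [apply Cmod_ge_0 |].
eapply Rle_trans; [| apply (H u n (Rle_refl _))]; fold x.
rewrite Rmult_comm; apply Rmult_le_compat_l; [apply Cmod_ge_0 |].
rewrite Rmult_1_l; assert (h := exp_ineq1_le (Cmod x)); lra.
Qed.

Lemma gsum_taylor (sg : C) (rho : R) : (0 < Im sg)%R -> (0 <= rho)%R ->
  exists K, (0 < K)%R /\ forall u e : C, (Cmod u <= rho)%R -> (Cmod e <= rho)%R ->
  (Cmod (gsum sg (u + e) - gsum sg u - e * CSumZ (fun n => gs' sg (u - IZR n)))
    <= K * Cmod e ^ 2)%R.
Proof.
intros HT Hr; destruct (gs_taylor sg rho HT Hr) as [K [HK H]].
exists (6 * K)%R; split; [lra |]; intros u e Hu He.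
destruct (gs_bd sg u HT) as [K1 B1]; destruct (gs_bd sg (u + e) HT) as [K2 B2].
destruct (gs'_bd sg u HT) as [K3 B3].
unfold gsum; rewrite <- (CSumZ_scal _ _ _ B3), <- (CSumZ_minus _ _ _ _ B2 B1).
assert (Bm : bd (K2 + Cmod (- (1)) * K1) (fun n => gs sg (u + e - IZR n) - gs sg (u - IZR n))).
{ apply bd_ext with (2 := bd_plus _ _ _ _ B2 (bd_scal _ (- (1)) _ B1)); intros; ring. }
rewrite <- (CSumZ_minus _ _ _ _ Bm (bd_scal _ e _ B3)).
eapply Rle_trans; [apply (CSumZ_bound (Cmod e ^ 2 * K)) | right; ring].
intros n; eapply Rle_trans; [apply H; assumption | right; unfold Rdiv; ring].
Qed.

Lemma gsum_bound (sg : C) (rho : R) : (0 < Im sg)%R -> (0 <= rho)%R ->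
  exists K, (0 < K)%R /\ forall u : C, (Cmod u <= rho)%R -> (Cmod (gsum sg u) <= K)%R.
Proof.
intros HT Hr; destruct (gs_bound0 sg rho HT Hr) as [K [HK H]].
exists (6 * K)%R; split; [lra |]; intros u Hu; apply CSumZ_bound, H, Hu.
Qed.

Lemma gsum_period (sg u : C) : (0 < Im sg)%R -> gsum sg (u + 1) = gsum sg u.
Proof.
intros HT; destruct (gs_bd sg (u + 1) HT) as [K B].
unfold gsum; rewrite <- (CSumZ_shift _ _ 1 B).
apply CSumZ_ext; intros n; f_equal; push_RtoC; ring.
Qed.

Lemma gsum_quasi (sg u : C) (k : Z) : (0 < Im sg)%R ->
  gsum sg (u + IZR k * (- (1) / sg)) = e2pi (IZR k ^ 2 / (2 * sg) - IZR k * u) * gsum sg u.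
Proof.
intros HT; destruct (gs_bd sg u HT) as [K B].
assert (Hs : sg <> 0) by (intros E; rewrite E in HT; cbn in HT; lra).
unfold gsum; rewrite <- (CSumZ_scal _ _ _ B); apply CSumZ_ext; intros n; unfold gs.
rewrite <- (Cmult_1_r (e2pi _)), <- e2pi_plus.
transitivity (e2pi (IZR k ^ 2 / (2 * sg) - IZR k * u + sg * (u - IZR n) ^ 2 / 2) * e2pi (IZR (k * n))).
- rewrite <- e2pi_plus, Cmult_1_r; f_equal; push_RtoC; field; exact Hs.
- rewrite e2pi_Z; ring.
Qed.

Lemma Ccv_lim_eq (u : nat -> C) (l m : C) : l = m -> Ccv u l -> Ccv u m.
Proof. intros ->; auto. Qed.

(** The Riemann sum on [N] nodes for the integral over [[0, 1]] of [gsum (z - t) e2pi (k t)], that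
    is, for the whole term [c_k e2pi (k z)] of the Fourier series, not for the coefficient [c_k]
    alone. *)
Definition dft (sg : C) (N : nat) (k : Z) (z : C) : C :=
  / INR N * csum (fun j => gsum sg (z - INR j / INR N) * e2pi (IZR k * INR j / INR N)) N.

Lemma INR_C_neq0 (N : nat) : (0 < N)%nat -> RtoC (INR N) <> 0.
Proof. intros H; apply RtoC_neq0, not_0_INR; lia. Qed.

Lemma csum_telescope (g : nat -> C) (N : nat) :
  csum (fun j => g (S j) - g j) N = g N - g O.
Proof. induction N as [|N IH]; cbn [csum]; [ring | rewrite IH; ring]. Qed.

(** Translating by one mesh permutes the nodes cyclically, by the period 1 of [gsum]. Thus [dft] is
    an eigenvector of translation, and differences in [z] act on it as scalars. *)
Lemma dft_shift (sg : C) (N : nat) (k : Z) (z : C) : (0 < Im sg)%R -> (0 < N)%nat ->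
  dft sg N k (z - 1 / INR N) = e2pi (- (IZR k / INR N)) * dft sg N k z.
Proof.
intros HT HN; assert (hN := INR_C_neq0 N HN).
set (g := fun j => gsum sg (z - INR j / INR N) * e2pi (IZR k * INR j / INR N)).
assert (Hg : g N = g O).
{ unfold g; replace (z - INR N / INR N) with (z - 1) by (field; exact hN).
  rewrite <- (gsum_period sg (z - 1)) by exact HT.
  replace (IZR k * INR N / INR N) with (RtoC (IZR k)) by (field; exact hN).
  replace (IZR k * INR 0 / INR N) with (RtoC 0) by (cbn [INR]; field; exact hN).
  rewrite e2pi_Z, e2pi_0; f_equal; f_equal; cbn [INR]; field; exact hN. }
assert (Ht := csum_telescope g N); rewrite Hg in Ht.
rewrite (csum_ext _ (fun j => g (S j) + (- (1)) * g j)), csum_plus, csum_scal in Ht by (intros; ring).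
unfold dft; fold g.
replace (csum g N) with (csum (fun j => g (S j)) N).
2:{ replace (csum (fun j => g (S j)) N) with (csum (fun j => g (S j)) N + - (1) * csum g N + csum g N) by ring.
  rewrite Ht; ring. }
rewrite Cmult_assoc, (Cmult_comm (e2pi _)), <- Cmult_assoc; f_equal.
rewrite <- csum_scal; apply csum_ext; intros j _; unfold g.
rewrite (Cmult_comm (e2pi (- _))), <- Cmult_assoc, <- e2pi_plus; f_equal; f_equal;
  push_RtoC; field; exact hN.
Qed.

Lemma dft_shift' (sg : C) (N : nat) (k : Z) (z : C) : (0 < Im sg)%R -> (0 < N)%nat ->
  dft sg N k (z + 1 / INR N) = e2pi (IZR k / INR N) * dft sg N k z.
Proof.
intros HT HN; replace z with (z + 1 / INR N - 1 / INR N) at 2 by ring.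
rewrite dft_shift, e2pi_opp by assumption; field; auto using e2pi_neq0.
Qed.

Lemma Cmod_e2pi_R (x : R) : Cmod (e2pi x) = 1%R.
Proof. rewrite Cmod_e2pi; cbn; rewrite Rmult_0_r, Ropp_0; apply exp_0. Qed.

Lemma Cmod_e2pi_frac (k : Z) (j N : nat) : (0 < N)%nat -> Cmod (e2pi (IZR k * INR j / INR N)) = 1%R.
Proof.
intros HN; rewrite <- RtoC_mult, <- RtoC_div by (apply not_0_INR; lia); apply Cmod_e2pi_R.
Qed.

Lemma Cmod_avg (f : nat -> C) (N : nat) (B : R) : (0 < N)%nat ->
  (forall j, (j < N)%nat -> (Cmod (f j) <= B)%R) -> (Cmod (/ INR N * csum f N) <= B)%R.
Proof.
intros HN H; rewrite Cmod_mult, Cmod_inv, Cmod_R by (apply INR_C_neq0, HN).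
assert (hp : (0 < INR N)%R) by (apply lt_0_INR, HN).
rewrite Rabs_pos_eq by lra.
apply Rle_trans with (/ INR N * (INR N * B))%R; [| right; field; lra].
apply Rmult_le_compat_l; [left; apply Rinv_0_lt_compat, hp |].
apply (csum_Cmod f), H.
Qed.

Lemma node_bound (z : C) (j N : nat) : (j < N)%nat -> (Cmod (z - INR j / INR N) <= Cmod z + 1)%R.
Proof.
intros Hj; unfold Cminus; eapply Rle_trans; [apply Cmod_triangle |].
assert (hp : (0 < INR N)%R) by (apply lt_0_INR; lia).
rewrite Cmod_opp, <- RtoC_div, Cmod_R by lra.
assert (hj := pos_INR j); assert (hjn : (INR j <= INR N)%R) by (apply le_INR; lia).
rewrite Rabs_pos_eq by (apply Rmult_le_pos; [lra | left; apply Rinv_0_lt_compat, hp]).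
assert (INR j / INR N <= 1)%R; [| lra].
apply Rmult_le_reg_r with (INR N); [exact hp |]; unfold Rdiv; rewrite Rmult_assoc, Rinv_l; lra.
Qed.

Lemma dft_bound (sg z : C) : (0 < Im sg)%R -> exists K, (0 < K)%R /\
  forall N k, (0 < N)%nat -> (Cmod (dft sg N k z) <= K)%R.
Proof.
intros HT; assert (hz := Cmod_ge_0 z).
destruct (gsum_bound sg (Cmod z + 1) HT ltac:(lra)) as [K [HK H]].
exists K; split; [exact HK |]; intros N k HN; apply Cmod_avg; [exact HN |].
intros j Hj; rewrite Cmod_mult, Cmod_e2pi_frac, Rmult_1_r by exact HN.
apply H, node_bound, Hj.
Qed.

Lemma inv_INR_le1 (N : nat) : (0 < N)%nat -> (0 < / INR N <= 1)%R.
Proof.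
intros HN; assert (h : (1 <= INR N)%R) by (apply (le_INR 1); lia).
split; [apply Rinv_0_lt_compat; lra | rewrite <- Rinv_1; apply Rinv_le_contravar; lra].
Qed.

Lemma Cmod_inv_INR (N : nat) : (0 < N)%nat -> Cmod (1 / INR N) = (/ INR N)%R.
Proof.
intros HN; assert (h := inv_INR_le1 N HN); rewrite Cmod_div, Cmod_1, Cmod_R by (apply INR_C_neq0, HN).
rewrite Rabs_pos_eq by apply pos_INR; unfold Rdiv; ring.
Qed.

Lemma sin_lower (t : R) : (0 <= t <= 2 -> t / 3 <= sin t)%R.
Proof.
intros [h0 h2]; destruct (pre_sin_bound t 0 h0 ltac:(lra)) as [H _].
eapply Rle_trans; [| exact H].
replace (sin_approx t (2 * 0 + 1)) with (t - t * (t * t) / 6)%R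
  by (unfold sin_approx, sin_term; cbn; field).
assert (h : (t * t <= 4)%R) by nra; assert (h' : (0 <= t * (4 - t * t))%R) by (apply Rmult_le_pos; lra).
lra.
Qed.

(* [2 - 2 cos (2 pi x) = 4 sin (pi x)^2 >= 4 x^2] for [|x| <= 1/2]. *)
Lemma root_of_unity_gap (x : R) : (Rabs x <= 1 / 2)%R ->
  (4 * x ^ 2 <= Cmod (e2pi x + e2pi (- x) - 2))%R.
Proof.
intros Hx; rewrite e2pi_R; replace (- x) with (RtoC (- x)) by (rewrite RtoC_opp; reflexivity).
rewrite e2pi_R; replace (2 * PI * - x)%R with (- (2 * PI * x))%R by ring; rewrite cos_neg, sin_neg.
set (y := (PI * Rabs x)%R).
assert (Hp := PI_4); assert (Hp0 := PI2_3_2); assert (hx0 := Rabs_pos x).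
assert (Hc : cos (2 * PI * x) = (1 - 2 * sin y * sin y)%R).
{ rewrite <- cos_2a_sin; unfold y, Rabs; destruct (Rcase_abs x);
  [rewrite <- cos_neg; f_equal; ring | f_equal; ring]. }
replace ((cos (2 * PI * x), sin (2 * PI * x)) + (cos (2 * PI * x), - sin (2 * PI * x))%R - 2)
  with (RtoC (- (4 * sin y ^ 2))) by (rewrite Hc; apply C_eq; cbn; ring).
rewrite Cmod_R, Rabs_Ropp, Rabs_pos_eq by (assert (h := pow2_ge_0 (sin y)); lra).
assert (Hs : (y / 3 <= sin y)%R) by (apply sin_lower; unfold y; nra).
assert (Hy : (Rabs x <= y / 3)%R) by (unfold y; unfold PI2 in Hp0; nra).
assert (h2 : (Rabs x ^ 2 <= sin y ^ 2)%R) by (apply pow_incr; lra).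
rewrite pow2_abs in h2; lra.
Qed.

(** The second difference in [z] with step [1 / N] multiplies [dft] by a number of modulus at least
    [4 k^2 / N^2], while the second differences of [gsum] are at most [2 K1 / N^2]. The quotient is
    a bound of order [1 / k^2] independent of [N]. The range of [k] keeps [k / N] within 1/2, as
    [root_of_unity_gap] requires. *)
Lemma dft_decay (sg z : C) : (0 < Im sg)%R -> exists K, (0 < K)%R /\
  forall M k, (- Z.of_nat M <= k < Z.of_nat M)%Z ->
  (Cmod (dft sg (2 * M) k z) <= K / (1 + IZR k ^ 2))%R.
Proof.
intros HT; assert (hz := Cmod_ge_0 z).
destruct (gsum_taylor sg (Cmod z + 1) HT ltac:(lra)) as [K1 [HK1 H1]].
destruct (dft_bound sg z HT) as [K0 [HK0 H0]].
exists (K0 + K1)%R; split; [lra |]; intros M k Hk.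
set (N := (2 * M)%nat); assert (HN : (0 < N)%nat) by (unfold N; lia).
assert (hN : (0 < INR N)%R) by (apply lt_0_INR, HN).
destruct (Z.eq_dec k 0) as [-> | Hk0].
{ eapply Rle_trans; [apply H0, HN |]; replace (1 + 0 ^ 2)%R with 1%R by ring; lra. }
assert (Hk1 : (1 <= IZR k ^ 2)%R).
{ rewrite <- (pow2_abs (IZR k)), <- abs_IZR; assert (h : (1 <= IZR (Z.abs k))%R) by (apply IZR_le; lia); nra. }
set (x := (IZR k / INR N)%R).
assert (Hx : (Rabs x <= 1 / 2)%R).
{ unfold x; rewrite Rabs_div, (Rabs_pos_eq (INR N)), <- abs_IZR by lra.
  apply Rmult_le_reg_r with (INR N); [exact hN |].
  replace (IZR (Z.abs k) / INR N * INR N)%R with (IZR (Z.abs k)) by (field; lra).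
  unfold N; rewrite mult_INR, (INR_IZR_INZ M); change (INR 2) with 2%R.
  assert (h : (IZR (Z.abs k) <= IZR (Z.of_nat M))%R) by (apply IZR_le; lia); lra. }
assert (E : dft sg N k z * (e2pi x + e2pi (- x) - 2) =
  dft sg N k (z + 1 / INR N) + dft sg N k (z - 1 / INR N) - 2 * dft sg N k z).
{ rewrite dft_shift, dft_shift' by assumption; unfold x; rewrite RtoC_div by lra; ring. }
assert (HB : (Cmod (dft sg N k (z + 1 / INR N) + dft sg N k (z - 1 / INR N) - 2 * dft sg N k z)
  <= 2 * K1 * / INR N ^ 2)%R).
{ unfold dft.
  replace (/ INR N * csum (fun j => gsum sg (z + 1 / INR N - INR j / INR N) * e2pi (IZR k * INR j / INR N)) N
    + / INR N * csum (fun j => gsum sg (z - 1 / INR N - INR j / INR N) * e2pi (IZR k * INR j / INR N)) N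
    - 2 * (/ INR N * csum (fun j => gsum sg (z - INR j / INR N) * e2pi (IZR k * INR j / INR N)) N))
  with (/ INR N * csum (fun j =>
    ((gsum sg (z + 1 / INR N - INR j / INR N) * e2pi (IZR k * INR j / INR N)
    + gsum sg (z - 1 / INR N - INR j / INR N) * e2pi (IZR k * INR j / INR N))
    + (- (2)) * (gsum sg (z - INR j / INR N) * e2pi (IZR k * INR j / INR N)))) N)
  by (rewrite !csum_plus, csum_scal; ring).
  apply Cmod_avg; [exact HN |]; intros j Hj.
  set (u := z - INR j / INR N).
  replace (z + 1 / INR N - INR j / INR N) with (u + 1 / INR N) by (unfold u; ring).
  replace (z - 1 / INR N - INR j / INR N) with (u + - (1 / INR N)) by (unfold u; ring).
  set (d := CSumZ (fun n => gs' sg (u - IZR n))).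
  assert (Hu := node_bound z j N Hj); fold u in Hu.
  assert (hi := inv_INR_le1 N HN).
  assert (T1 := H1 u (1 / INR N) Hu ltac:(rewrite Cmod_inv_INR by exact HN; lra)).
  assert (T2 := H1 u (- (1 / INR N)) Hu ltac:(rewrite Cmod_opp, Cmod_inv_INR by exact HN; lra)).
  fold d in T1, T2; rewrite Cmod_opp in T2; rewrite Cmod_inv_INR in T1, T2 by exact HN.
  match goal with |- (Cmod ?a <= _)%R => replace a with (e2pi (IZR k * INR j / INR N) *
    ((gsum sg (u + 1 / INR N) - gsum sg u - 1 / INR N * d)
    + (gsum sg (u + - (1 / INR N)) - gsum sg u - - (1 / INR N) * d))) by ring end.
  rewrite Cmod_mult, Cmod_e2pi_frac, Rmult_1_l by exact HN.
  eapply Rle_trans; [apply Cmod_triangle |].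
  rewrite <- pow_inv; lra. }
rewrite <- E, Cmod_mult in HB.
assert (HG := root_of_unity_gap x Hx).
assert (hd := Cmod_ge_0 (dft sg N k z)).
assert (HC : (Cmod (dft sg N k z) * (4 * x ^ 2) <= 2 * K1 * / INR N ^ 2)%R)
  by (eapply Rle_trans; [apply Rmult_le_compat_l; [exact hd | exact HG] | exact HB]).
apply Rmult_le_reg_r with (1 + IZR k ^ 2)%R; [lra |].
replace ((K0 + K1) / (1 + IZR k ^ 2) * (1 + IZR k ^ 2))%R with (K0 + K1)%R by (field; lra).
apply Rmult_le_compat_r with (r := (INR N ^ 2)%R) in HC; [| apply pow2_ge_0].
replace (Cmod (dft sg N k z) * (4 * x ^ 2) * INR N ^ 2)%R
  with (Cmod (dft sg N k z) * (4 * IZR k ^ 2))%R in HC by (unfold x; field; lra).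
replace (2 * K1 * / INR N ^ 2 * INR N ^ 2)%R with (2 * K1)%R in HC by (field; lra).
nra.
Qed.

Lemma geom_root (N j : nat) : (0 < j < N)%nat -> csum (fun i => e2pi (INR i * INR j / INR N)) N = 0.
Proof.
intros Hj; assert (hN := INR_C_neq0 N ltac:(lia)).
set (r := e2pi (INR j / INR N)).
assert (Hr : r <> 1).
{ intros E; destruct (e2pi_eq1 _ E) as [m Hm].
  rewrite <- RtoC_div in Hm by (apply not_0_INR; lia); apply RtoC_inj in Hm.
  assert (hp : (0 < INR N)%R) by (apply lt_0_INR; lia).
  assert (hm : (INR j = IZR m * INR N)%R) by (rewrite <- Hm; field; lra).
  rewrite !INR_IZR_INZ, <- mult_IZR in hm; apply eq_IZR in hm.
  assert (m <= 0 \/ 1 <= m)%Z as [h | h] by lia; nia. }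
assert (Hs := csum_telescope (fun i => e2pi (INR i * INR j / INR N)) N); cbv beta in Hs.
rewrite (csum_ext _ (fun i => (r - 1) * e2pi (INR i * INR j / INR N))), csum_scal in Hs.
2:{ intros i _; unfold r; replace (INR (S i) * INR j / INR N) with (INR j / INR N + INR i * INR j / INR N)
    by (push_RtoC; field; exact hN); rewrite e2pi_plus; ring. }
replace (INR N * INR j / INR N) with (RtoC (INR j)) in Hs by (field; exact hN).
replace (INR 0 * INR j / INR N) with (RtoC 0) in Hs by (cbn [INR]; field; exact hN).
rewrite e2pi_nat, e2pi_0 in Hs.
assert (Hr1 : r - 1 <> 0) by (intros E; apply Hr; replace r with (1 + (r - 1)) by ring; rewrite E; ring).
transitivity (/ (r - 1) * ((r - 1) * csum (fun i => e2pi (INR i * INR j / INR N)) N)).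
- field; exact Hr1.
- rewrite Hs; ring.
Qed.

Lemma csum_0 (N : nat) (f : nat -> C) : (forall j, (j < N)%nat -> f j = 0) -> csum f N = 0.
Proof.
induction N as [|N IH]; intros H; cbn [csum]; [reflexivity |]; rewrite IH, H by auto; ring.
Qed.

(** Exact for every [M]: the window [[- M, M)] is a full set of residues modulo [2 M], so by
    orthogonality of the roots of unity only the node [j = 0] contributes. *)
Lemma dft_inversion (sg z : C) (M : nat) : (0 < M)%nat ->
  psum M (fun k => dft sg (2 * M) k z) = gsum sg z.
Proof.
intros HM; rewrite psum_csum; set (N := (2 * M)%nat).
assert (hN := INR_C_neq0 N ltac:(unfold N; lia)); unfold dft.
rewrite csum_scal, csum_exchange.
set (F := fun j => gsum sg (z - INR j / INR N) * (e2pi (- (INR M * INR j / INR N))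
  * csum (fun i => e2pi (INR i * INR j / INR N)) N)).
rewrite (csum_ext _ F).
- assert (hF : csum F N = F O).
  { replace (csum F N) with (csum F (S (N - 1))) by (f_equal; unfold N; lia).
    rewrite csum_S_l, csum_0; [ring |].
    intros j Hj; unfold F; rewrite geom_root by (unfold N in *; lia); ring. }
  rewrite hF; unfold F; rewrite (csum_ext _ (fun _ => 1)).
  2:{ intros i _; rewrite <- e2pi_0; f_equal; cbn [INR]; field; exact hN. }
  assert (h1 : forall n, csum (fun _ => 1) n = INR n).
  { induction n as [|n IH]; cbn [csum]; [reflexivity | rewrite IH; push_RtoC; reflexivity]. }
  rewrite h1.
  replace (- (INR M * INR 0 / INR N)) with (RtoC 0) by (cbn [INR]; field; exact hN).
  replace (z - INR 0 / INR N) with z by (cbn [INR]; field; exact hN).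
  rewrite e2pi_0; field; exact hN.
- intros j _; unfold F; rewrite <- !csum_scal; apply csum_ext; intros i _.
  rewrite <- e2pi_plus; f_equal; f_equal; rewrite minus_IZR, <- !INR_IZR_INZ; push_RtoC; field; exact hN.
Qed.

(** The quasi-periodicity of [gsum] reduces all frequencies to frequency 0 at a translated point.
    With [tau = - 1 / sg] the exponential factor is the [k]-th term of [theta 0 0 tau z], so the
    theta series appears without evaluating an integral. *)
Lemma dft_quasi (sg z : C) (N : nat) (k : Z) : (0 < Im sg)%R -> (0 < N)%nat ->
  dft sg N k z = e2pi (IZR k * z - IZR k ^ 2 / (2 * sg)) * dft sg N 0 (z + IZR k * (- (1) / sg)).
Proof.
intros HT HN; assert (hN := INR_C_neq0 N HN).
assert (Hs : sg <> 0) by (intros E; rewrite E in HT; cbn in HT; lra).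
unfold dft; rewrite Cmult_assoc, (Cmult_comm (e2pi _)), <- Cmult_assoc; f_equal.
rewrite <- csum_scal; apply csum_ext; intros j _.
replace (z + IZR k * (- (1) / sg) - INR j / INR N) with (z - INR j / INR N + IZR k * (- (1) / sg)) by ring.
rewrite gsum_quasi by exact HT.
replace (0 * INR j / INR N) with (RtoC 0) by (field; exact hN); rewrite e2pi_0.
transitivity (gsum sg (z - INR j / INR N) * (e2pi (IZR k * z - IZR k ^ 2 / (2 * sg)) *
  e2pi (IZR k ^ 2 / (2 * sg) - IZR k * (z - INR j / INR N)))); [| ring].
rewrite <- e2pi_plus; f_equal; f_equal; field; auto.
Qed.

(* The mean over a period changes by O(1/N) under a translation: a complex step is
   compared with a real one, which leaves the mean unchanged. *)
Lemma dft0_const (sg w : C) : (0 < Im sg)%R -> exists K, (0 < K)%R /\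
  forall N, (0 < N)%nat -> (Cmod (dft sg N 0 w - dft sg N 0 0) <= K * / INR N)%R.
Proof.
intros HT; assert (hw := Cmod_ge_0 w).
destruct (gsum_taylor sg (Cmod w + 1) HT ltac:(lra)) as [K1 [HK1 H1]].
set (K := (K1 * (Cmod w ^ 2 + Cmod w) + 1)%R).
assert (HK : (0 < K)%R).
{ unfold K; assert (0 <= Cmod w ^ 2)%R by apply pow2_ge_0.
  assert (0 <= K1 * (Cmod w ^ 2 + Cmod w))%R by (apply Rmult_le_pos; lra); lra. }
exists K; split; [exact HK |]; intros N HN.
assert (hN := INR_C_neq0 N HN); assert (hi := inv_INR_le1 N HN).
assert (hNp : (0 < INR N)%R) by (apply lt_0_INR, HN).
(* The difference for the real step [1 / N] is zero, so [w] times it may be subtracted; the linear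
   Taylor terms then cancel. An error of order [1 / N^2] remains per step, and [N] steps lead from 0
   to [w]. *)
assert (Hstep : forall v, (Cmod v <= Cmod w)%R ->
  (Cmod (dft sg N 0 (v + w / INR N) - dft sg N 0 v) <= K * / INR N ^ 2)%R).
{ intros v Hv.
  assert (Hp := dft_shift' sg N 0 v HT HN).
  replace (0 / INR N) with (RtoC 0) in Hp by (field; exact hN); rewrite e2pi_0, Cmult_1_l in Hp.
  replace (dft sg N 0 (v + w / INR N) - dft sg N 0 v) with
    (dft sg N 0 (v + w / INR N) - dft sg N 0 v - w * (dft sg N 0 (v + 1 / INR N) - dft sg N 0 v))
    by (rewrite Hp; ring).
  unfold dft.
  match goal with |- (Cmod ?a <= _)%R => replace a with (/ INR N * csum (fun j =>
    (gsum sg (v + w / INR N - INR j / INR N) * e2pi (0 * INR j / INR N)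
     + (- (1)) * (gsum sg (v - INR j / INR N) * e2pi (0 * INR j / INR N)))
    + (- w) * (gsum sg (v + 1 / INR N - INR j / INR N) * e2pi (0 * INR j / INR N)
     + (- (1)) * (gsum sg (v - INR j / INR N) * e2pi (0 * INR j / INR N)))) N)
    by (rewrite !csum_plus, !csum_scal, !csum_plus, !csum_scal; ring) end.
  apply Cmod_avg; [exact HN |]; intros j Hj.
  replace (0 * INR j / INR N) with (RtoC 0) by (field; exact hN); rewrite e2pi_0.
  set (u := v - INR j / INR N).
  replace (v + 1 / INR N - INR j / INR N) with (u + 1 / INR N) by (unfold u; ring).
  replace (v + w / INR N - INR j / INR N) with (u + w / INR N) by (unfold u; ring).
  assert (Hu := node_bound v j N Hj); fold u in Hu.
  assert (hwN : Cmod (w / INR N) = (Cmod w * / INR N)%R).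
  { rewrite Cmod_div, Cmod_R, Rabs_pos_eq by (try exact hN; lra); reflexivity. }
  set (d := CSumZ (fun n => gs' sg (u - IZR n))).
  assert (T1 := H1 u (1 / INR N) ltac:(lra) ltac:(rewrite Cmod_inv_INR by exact HN; lra)).
  assert (T2 := H1 u (w / INR N) ltac:(lra) ltac:(rewrite hwN; nra)).
  fold d in T1, T2; rewrite hwN in T2; rewrite Cmod_inv_INR in T1 by exact HN.
  match goal with |- (Cmod ?a <= _)%R => replace a with
    ((gsum sg (u + w / INR N) - gsum sg u - w / INR N * d)
    + (- w) * (gsum sg (u + 1 / INR N) - gsum sg u - 1 / INR N * d)) by (field; exact hN) end.
  eapply Rle_trans; [apply Cmod_triangle |]; rewrite Cmod_mult, Cmod_opp.
  rewrite <- pow_inv.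
  apply Rmult_le_compat_l with (r := Cmod w) in T1; [| exact hw].
  assert (h3 : (0 <= (/ INR N) ^ 2)%R) by apply pow2_ge_0.
  unfold K; nra. }
assert (Hind : forall i, (i <= N)%nat ->
  (Cmod (dft sg N 0 (INR i * (w / INR N)) - dft sg N 0 0) <= INR i * (K * / INR N ^ 2))%R).
{ induction i as [|i IH]; intros Hi.
  - replace (INR 0 * (w / INR N)) with (RtoC 0) by (cbn [INR]; ring).
    replace (dft sg N 0 0 - dft sg N 0 0) with (RtoC 0) by ring; rewrite Cmod_0; cbn; lra.
  - specialize (IH ltac:(lia)).
    assert (hv : (Cmod (INR i * (w / INR N)) <= Cmod w)%R).
    { rewrite Cmod_mult, Cmod_div, !Cmod_R, !Rabs_pos_eq by (try exact hN; apply pos_INR).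
      assert (h : (INR i <= INR N)%R) by (apply le_INR; lia).
      replace (Cmod w) with (INR N * (Cmod w / INR N))%R at 2 by (field; lra).
      apply Rmult_le_compat_r; [apply Rmult_le_pos; lra | exact h]. }
    assert (Hs := Hstep _ hv).
    replace (INR (S i) * (w / INR N)) with (INR i * (w / INR N) + w / INR N) by (push_RtoC; ring).
    match goal with |- (Cmod ?a <= _)%R => replace a with
      ((dft sg N 0 (INR i * (w / INR N) + w / INR N) - dft sg N 0 (INR i * (w / INR N)))
       + (dft sg N 0 (INR i * (w / INR N)) - dft sg N 0 0)) by ring end.
    eapply Rle_trans; [apply Cmod_triangle |]; rewrite S_INR; lra. }
specialize (Hind N (Nat.le_refl N)).
replace (INR N * (w / INR N)) with w in Hind by (field; exact hN).
eapply Rle_trans; [exact Hind | right; field; lra].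
Qed.

(* In fact [Gauss tau] is the branch of [sqrt (- i tau)] with positive real part. *)
Definition Gauss (tau : C) : C := theta 0 0 (- (1) / tau) 0 / theta 0 0 tau 0.

Lemma Im_neg_inv (tau : C) : (0 < Im tau)%R -> (0 < Im (- (1) / tau))%R.
Proof.
intros H; destruct tau as [x y]; cbn in *.
assert (h : (0 < x * (x * 1) + y * (y * 1))%R) by nra.
match goal with |- (0 < ?a)%R => replace a with (y / (x * (x * 1) + y * (y * 1)))%R by (field; lra) end.
apply Rdiv_lt_0_compat; assumption.
Qed.

Lemma theta00_0_neq0 (tau : C) : (0 < Im tau)%R -> theta 0 0 tau 0 <> 0.
Proof.
intros HT; rewrite theta00_J by exact HT; apply J_neq0'; [exact HT |].
intros n E; destruct (e2pi_eq1 _ E) as [k Hk].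
apply (f_equal Im) in Hk.
replace (Im (0 + tau / 2 + 1 / 2 + IZR n * tau)) with (Im tau / 2 + IZR n * Im tau)%R in Hk
  by (destruct tau; cbn; field).
rewrite im_RtoC in Hk.
assert (h : ((2 * IZR n + 1) * Im tau = 0)%R) by lra.
apply Rmult_integral in h; destruct h as [h | h]; [| lra].
assert (h' : IZR (2 * n + 1) = 0%R) by (rewrite plus_IZR, mult_IZR; lra).
apply eq_IZR in h'; lia.
Qed.

Lemma Im_pos_neq0 (tau : C) : (0 < Im tau)%R -> tau <> 0.
Proof. intros H E; rewrite E in H; cbn in H; lra. Qed.

(** By inversion [gsum] is the sum of the [dft] terms; by [dft_quasi] and [dft0_const] each is
    asymptotically the theta term times the same mean, and [dft_decay] dominates. Convergence of the
    mean itself then follows from the case [z = 0], where the theta constant is not zero. *)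
Lemma poisson_limit (tau z : C) : (0 < Im tau)%R ->
  Ccv (fun M => dft (- (1) / tau) (2 * M) 0 0 * theta 0 0 tau z) (gsum (- (1) / tau) z).
Proof.
intros HT; set (sg := - (1) / tau); assert (Hsg := Im_neg_inv tau HT); fold sg in Hsg.
assert (Ht0 := Im_pos_neq0 tau HT).
assert (Esg : - (1) / sg = tau).
{ unfold sg; field; exact Ht0. }
assert (Einv : forall k : Z, IZR k ^ 2 / (2 * sg) = - (tau * IZR k ^ 2 / 2)).
{ intros k; rewrite <- Esg; field; apply Im_pos_neq0, Hsg. }
set (e := fun k : Z => e2pi (tau * IZR k ^ 2 / 2 + IZR k * z)).
destruct (theta00_bd tau z HT) as [Ke HKe]; fold e in HKe.
destruct (dft_bound sg 0 Hsg) as [K0 [HK0 H0]].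
destruct (dft_decay sg z Hsg) as [K1 [HK1 H1]].
(* For [M = 0] there are no nodes and the mesh is meaningless, hence the separate value. *)
set (v := fun M k => match M with O => RtoC 0 | _ => dft sg (2 * M) k z - dft sg (2 * M) 0 0 * e k end).
assert (Hv : Ccv (fun M => psum M (v M)) (CSumZ (fun _ => 0))).
{ apply psum_tannery with (K1 + K0 * Ke)%R.
  - intros [|M] k Hk; [lia |]; cbn [v]; unfold Cminus.
    eapply Rle_trans; [apply Cmod_triangle |]; rewrite Cmod_opp.
    unfold Rdiv; rewrite Rmult_plus_distr_r; apply Rplus_le_compat; [apply H1, Hk |].
    rewrite Rmult_assoc; apply Cmod_mult_le; [apply H0; lia | apply HKe].
  - intros k.
    destruct (dft0_const sg (z + IZR k * tau) Hsg) as [K [HK H]].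
    apply Ccv_ext_loc with (N0 := 1%nat) (u := fun M =>
      e k * (dft sg (2 * M) 0 (z + IZR k * tau) - dft sg (2 * M) 0 0)).
    + intros [|M] HM; [lia |]; cbn [v].
      rewrite (dft_quasi sg z (2 * S M) k), Esg, Einv by (auto; lia).
      unfold e; replace (IZR k * z - - (tau * IZR k ^ 2 / 2)) with (tau * IZR k ^ 2 / 2 + IZR k * z) by ring.
      ring.
    + apply (Ccv_lim_eq _ (e k * 0)); [ring |]; apply Ccv_scal.
      apply Ccv_eps; intros eps He.
      assert (hl := lim_inv_succ K); apply is_lim_seq_spec in hl.
      destruct (hl (mkposreal eps He)) as [N0 HN0]; exists (S N0); intros M HM.
      match goal with |- (Cmod ?a < _)%R => replace a with
        (dft sg (2 * M) 0 (z + IZR k * tau) - dft sg (2 * M) 0 0) by ring end.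
      eapply Rle_lt_trans; [apply H; lia |].
      specialize (HN0 (2 * M - 1)%nat ltac:(lia)); cbn -[INR Nat.mul] in HN0.
      rewrite Rminus_0_r, <- S_INR in HN0; replace (S (2 * M - 1)) with (2 * M)%nat in HN0 by lia.
      eapply Rle_lt_trans; [| exact HN0]; apply Rle_abs. }
assert (Hz : CSumZ (fun _ => 0) = 0).
{ apply CSumZ_unique with (K := 0%R).
  - intros n; rewrite Cmod_0; unfold Rdiv; rewrite Rmult_0_l; lra.
  - apply Ccv_ext with (fun _ => 0); [| apply Ccv_const].
    intros n; induction n as [|n IH]; cbn [psum]; [reflexivity | rewrite <- IH; ring]. }
rewrite Hz in Hv.
assert (Hth : Ccv (fun M => dft sg (2 * M) 0 0 * (theta 0 0 tau z - psum M e)) 0).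
{ assert (h : Ccv (fun M => theta 0 0 tau z - psum M e) 0).
  { apply (Ccv_lim_eq _ (theta 0 0 tau z - theta 0 0 tau z)); [ring |].
    apply Ccv_minus; [apply Ccv_const |]; rewrite theta00_e2pi; apply CSumZ_cv with (1 := HKe). }
  apply Ccv_eps; intros eps He.
  destruct (proj1 (Ccv_eps _ _) h (eps / (K0 + 1))%R) as [N0 HN0].
  { apply Rdiv_lt_0_compat; lra. }
  exists (S N0); intros M HM; specialize (HN0 M ltac:(lia)); specialize (H0 (2 * M)%nat 0%Z ltac:(lia)).
  replace (theta 0 0 tau z - psum M e - 0) with (theta 0 0 tau z - psum M e) in HN0 by ring.
  replace (dft sg (2 * M) 0 0 * (theta 0 0 tau z - psum M e) - 0)
    with (dft sg (2 * M) 0 0 * (theta 0 0 tau z - psum M e)) by ring.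
  rewrite Cmod_mult.
  assert (hm := Cmod_ge_0 (theta 0 0 tau z - psum M e)); assert (hd := Cmod_ge_0 (dft sg (2 * M) 0 0)).
  apply Rle_lt_trans with (K0 * Cmod (theta 0 0 tau z - psum M e))%R; [apply Rmult_le_compat_r; assumption |].
  apply Rmult_lt_compat_r with (r := (K0 + 1)%R) in HN0; [| lra].
  replace (eps / (K0 + 1) * (K0 + 1))%R with eps in HN0 by (field; lra); nra. }
apply Ccv_ext_loc with (N0 := 1%nat) (u := fun M =>
  gsum sg z - psum M (v M) + dft sg (2 * M) 0 0 * (theta 0 0 tau z - psum M e)).
- intros [|M] HM; [lia |].
  replace (psum (S M) (v (S M))) with (gsum sg z - dft sg (2 * S M) 0 0 * psum (S M) e); [ring |].
  rewrite <- (dft_inversion sg z (S M)) by lia.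
  rewrite (psum_ext (S M) (v (S M)) (fun k => dft sg (2 * S M) k z + (- dft sg (2 * S M) 0 0) * e k))
    by (intros; cbn [v]; ring).
  rewrite psum_plus, psum_scal; ring.
- apply (Ccv_lim_eq _ (gsum sg z - 0 + 0)); [ring |].
  apply Ccv_plus; [apply Ccv_minus; [apply Ccv_const | exact Hv] | exact Hth].
Qed.

Lemma gsum_0 (sg : C) : gsum sg 0 = theta 0 0 sg 0.
Proof.
rewrite theta00_e2pi; unfold gsum; apply CSumZ_ext; intros n; unfold gs; f_equal; field.
Qed.

Lemma Gauss_limit (tau : C) : (0 < Im tau)%R ->
  Ccv (fun M => dft (- (1) / tau) (2 * M) 0 0) (Gauss tau).
Proof.
intros HT; assert (h := theta00_0_neq0 tau HT).
assert (H := poisson_limit tau 0 HT); rewrite gsum_0 in H.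
apply Ccv_ext with (fun M => / theta 0 0 tau 0 * (dft (- (1) / tau) (2 * M) 0 0 * theta 0 0 tau 0)).
- intros M; field; exact h.
- replace (Gauss tau) with (/ theta 0 0 tau 0 * theta 0 0 (- (1) / tau) 0) by (unfold Gauss; field; exact h).
  apply Ccv_scal, H.
Qed.

Lemma poisson (tau z : C) : (0 < Im tau)%R ->
  gsum (- (1) / tau) z = Gauss tau * theta 0 0 tau z.
Proof.
intros HT; apply Ccv_unique with (1 := poisson_limit tau z HT).
apply Ccv_mult; [apply Gauss_limit, HT | apply Ccv_const].
Qed.

Lemma theta00_S (tau z : C) : (0 < Im tau)%R ->
  theta 0 0 (- (1) / tau) (z / tau) = e2pi (z ^ 2 / (2 * tau)) * (Gauss tau * theta 0 0 tau z).
Proof.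
intros HT; assert (Ht0 := Im_pos_neq0 tau HT); rewrite <- poisson, theta00_e2pi by exact HT.
destruct (gs_bd (- (1) / tau) z (Im_neg_inv tau HT)) as [K HK].
unfold gsum; rewrite <- (CSumZ_scal _ _ _ HK); apply CSumZ_ext; intros n; unfold gs.
rewrite <- e2pi_plus; f_equal; field; exact Ht0.
Qed.

Lemma Gauss_neq0 (tau : C) : (0 < Im tau)%R -> Gauss tau <> 0.
Proof.
intros HT E; apply (theta00_0_neq0 _ (Im_neg_inv tau HT)).
assert (h := theta00_0_neq0 tau HT).
replace (theta 0 0 (- (1) / tau) 0) with (Gauss tau * theta 0 0 tau 0) by (unfold Gauss; field; exact h).
rewrite E; ring.
Qed.

Lemma Gauss_S (tau : C) : (0 < Im tau)%R -> Gauss (- (1) / tau) * Gauss tau = 1.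
Proof.
intros HT; unfold Gauss; assert (Ht0 := Im_pos_neq0 tau HT).
replace (- (1) / (- (1) / tau)) with tau.
- field; split; [apply theta00_0_neq0, HT | apply theta00_0_neq0, Im_neg_inv, HT].
- field; exact Ht0.
Qed.

(** * Homogeneity of the weight factor *)

Lemma bd_gs_div (sg : C) (c : R) : (0 < Im sg)%R -> (0 < c)%R ->
  exists K, bd K (fun m => gs sg (IZR m / c)).
Proof.
intros HT Hc; assert (hc : RtoC c <> 0) by (apply RtoC_neq0; lra).
apply (bd_gauss (sg / 2 / (c * c)) 0 0).
- replace (Im (sg / 2 / (c * c))) with (Im sg / (2 * (c * c)))%R by (destruct sg; cbn; field; lra).
  apply Rdiv_lt_0_compat; nra.
- intros n; unfold gs; f_equal; field; exact hc.
Qed.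

(** Unfolding the periodization with [m = N n + j] gives a Riemann sum over the whole line, whose
    dependence on the mesh is explicit. *)
Lemma dft00 (sg : C) (N : nat) : (0 < Im sg)%R -> (0 < N)%nat ->
  dft sg N 0 0 = / INR N * CSumZ (fun m => gs sg (IZR m / INR N)).
Proof.
intros HT HN; assert (hN := INR_C_neq0 N HN); assert (hp : (0 < INR N)%R) by (apply lt_0_INR, HN).
destruct (bd_gs_div sg (INR N) HT hp) as [K HK].
unfold dft; rewrite (CSumZ_split _ N _ HN HK); f_equal; apply csum_ext; intros j _.
replace (0 * INR j / INR N) with (RtoC 0) by (field; exact hN); rewrite e2pi_0, Cmult_1_r.
apply CSumZ_ext; intros n; unfold gs; f_equal; push_RtoC; rewrite <- !INR_IZR_INZ; field; exact hN.
Qed.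

(** The Riemann sum for [a^2 tau] with mesh [1 / (2 M)] has the same terms as the one for [tau] with
    mesh [1 / (2 a M)]. The prefactors differ by [a], and the finer meshes form a subsequence. *)
Lemma Gauss_mul_sqr (tau : C) (a : nat) : (0 < Im tau)%R -> (0 < a)%nat ->
  Gauss (INR a ^ 2 * tau) = INR a * Gauss tau.
Proof.
intros HT Ha; assert (ha := INR_C_neq0 a Ha); assert (Ht0 := Im_pos_neq0 tau HT).
assert (hp : (0 < INR a)%R) by (apply lt_0_INR, Ha).
assert (HT2 : (0 < Im (INR a ^ 2 * tau))%R).
{ rewrite <- RtoC_pow; replace (Im ((INR a ^ 2)%R * tau)) with (INR a ^ 2 * Im tau)%R by (destruct tau; cbn; ring).
  apply Rmult_lt_0_compat; [apply pow2_gt_0; lra | exact HT]. }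
apply Ccv_unique with (1 := Gauss_limit _ HT2).
apply Ccv_ext_loc with (N0 := 1%nat) (u := fun M => INR a * dft (- (1) / tau) (2 * (a * M)) 0 0).
- intros M HM; assert (hM := INR_C_neq0 (2 * M) ltac:(lia)).
  rewrite !dft00 by (try apply Im_neg_inv; first [assumption | nia]).
  replace (2 * (a * M))%nat with (a * (2 * M))%nat by lia; rewrite mult_INR, RtoC_mult.
  rewrite (CSumZ_ext _ (fun m => gs (- (1) / (INR a ^ 2 * tau)) (IZR m / INR (2 * M)))).
  + field; auto.
  + intros m; unfold gs; f_equal; field; auto.
- apply Ccv_scal, (Ccv_subseq (fun M => dft (- (1) / tau) (2 * M) 0 0) _ (fun M => a * M)%nat);
    [intros; nia | apply Gauss_limit, HT].
Qed.

Lemma Ccv_RtoC (r : nat -> R) (l : R) : is_lim_seq r l -> Ccv (fun n => RtoC (r n)) l.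
Proof.
intros H; apply is_lim_seq_ext with (fun n => Rabs (r n - l)).
- intros n; rewrite <- RtoC_minus, Cmod_R; reflexivity.
- apply -> is_lim_seq_abs_0; replace (Finite 0) with (Finite (l - l)) by (f_equal; ring).
  apply is_lim_seq_minus'; [exact H | apply is_lim_seq_const].
Qed.

Lemma Ccv_e2pi (u : nat -> C) (l : C) : Ccv u l -> Ccv (fun n => e2pi (u n)) (e2pi l).
Proof.
intros H; set (f := fun x : R => (Cmod (e2pi l) * (5 * x ^ 2 * exp x + x))%R).
apply Ccv_squeeze with (fun n => f (Cmod (2 * PI * Ci) * Cmod (u n - l))%R).
- intros n; rewrite <- Cmod_mult; set (w := 2 * PI * Ci * (u n - l)).
  replace (e2pi (u n) - e2pi l) with (e2pi l * ((Cexp w - 1 - w) + w)).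
  + unfold f; rewrite Cmod_mult; apply Rmult_le_compat_l; [apply Cmod_ge_0 |].
    eapply Rle_trans; [apply Cmod_triangle |]; apply Rplus_le_compat_r, Cexp_taylor2.
  + change (Cexp w) with (e2pi (u n - l)); rewrite e2pi_minus; field; apply e2pi_neq0.
- replace (Finite 0) with (Finite (f 0%R)) by (unfold f; f_equal; ring).
  apply is_lim_seq_continuous; [unfold f; reg |].
  replace 0%R with (Cmod (2 * PI * Ci) * 0)%R by ring.
  apply is_lim_seq_mult'; [apply is_lim_seq_const | exact H].
Qed.

Lemma theta00_ray_cv (tau : C) (r : nat -> R) (l d : R) :
  (0 < Im tau)%R -> (0 < d)%R -> (forall n, (d <= r n)%R) -> is_lim_seq r l ->
  Ccv (fun n => theta 0 0 (r n * tau) 0) (theta 0 0 (l * tau) 0).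
Proof.
intros HT Hd Hr Hl.
assert (HTd : (0 < Im (d * tau))%R).
{ replace (Im (d * tau)) with (d * Im tau)%R by (destruct tau; cbn; ring).
  apply Rmult_lt_0_compat; assumption. }
destruct (theta00_bd (d * tau) 0 HTd) as [K HK].
apply Ccv_ext with (1 := fun n => eq_sym (theta00_e2pi (r n * tau) 0)); rewrite theta00_e2pi.
apply CSumZ_tannery with K.
- intros N n; eapply Rle_trans; [| apply HK]; rewrite !Cmod_e2pi; apply exp_le.
  assert (h : forall x : R, Im (x * tau * IZR n ^ 2 / 2 + IZR n * 0) = (x * (Im tau * IZR n ^ 2) / 2)%R)
    by (intros x; destruct tau; cbn; field).
  rewrite !h; assert (hp := PI_RGT_0); assert (h2 := pow2_ge_0 (IZR n)).
  assert (h3 : (d * (Im tau * IZR n ^ 2) <= r N * (Im tau * IZR n ^ 2))%R)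
    by (apply Rmult_le_compat_r; [apply Rmult_le_pos; lra | apply Hr]).
  nra.
- intros n; apply Ccv_e2pi, Ccv_plus; [| apply Ccv_const].
  apply Ccv_mult; [| apply Ccv_const]; apply Ccv_mult; [| apply Ccv_const].
  apply Ccv_mult; [apply Ccv_RtoC, Hl | apply Ccv_const].
Qed.

(* Exact for integers, hence for rationals; the rest is continuity along the ray. *)
Lemma Gauss_scale (tau : C) (la : R) : (0 < Im tau)%R -> (0 < la)%R ->
  Gauss (la ^ 2 * tau) = la * Gauss tau.
Proof.
intros HT Hla; assert (Ht0 := Im_pos_neq0 tau HT).
(* The rationals [r n = a n / (n + 1)] tend to [la] from above and stay below [la + 1]; these two
   bounds dominate the theta series at [r n ^ 2 * tau] and at its image under inversion. *)
set (a := fun n : nat => Z.to_nat (up (la * INR (S n)))).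
assert (Ha : forall n, (la * INR (S n) < INR (a n) <= la * INR (S n) + 1)%R).
{ intros n; unfold a; destruct (archimed (la * INR (S n))) as [h1 h2].
  assert (h4 : (0 <= la * INR (S n))%R) by (apply Rmult_le_pos; [lra | apply pos_INR]).
  assert (h5 : (0 <= up (la * INR (S n)))%Z) by (apply le_IZR; lra).
  rewrite (INR_IZR_INZ (Z.to_nat _)), Z2Nat.id by exact h5; lra. }
set (r := fun n => (INR (a n) / INR (S n))%R).
assert (Hr : forall n, (la <= r n <= la + 1 / (INR n + 1))%R).
{ intros n; specialize (Ha n); assert (hn : (0 < INR (S n))%R) by (apply lt_0_INR; lia).
  rewrite <- S_INR; unfold r; split; apply Rmult_le_reg_r with (INR (S n)); try exact hn.
  - replace (INR (a n) / INR (S n) * INR (S n))%R with (INR (a n)) by (field; lra); lra.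
  - replace (INR (a n) / INR (S n) * INR (S n))%R with (INR (a n)) by (field; lra).
    replace ((la + 1 / INR (S n)) * INR (S n))%R with (la * INR (S n) + 1)%R by (field; lra); lra. }
assert (Hl : is_lim_seq r la).
{ apply is_lim_seq_le_le with (fun _ => la) (fun n => (la + 1 / (INR n + 1))%R);
    [exact Hr | apply is_lim_seq_const |].
  replace (Finite la) with (Finite (la + 0)) by (f_equal; ring).
  apply is_lim_seq_plus'; [apply is_lim_seq_const | apply lim_inv_succ]. }
assert (HTr : forall x : R, (0 < x)%R -> (0 < Im (x ^ 2 * tau))%R).
{ intros x Hx; rewrite <- RtoC_pow; replace (Im ((x ^ 2)%R * tau)) with (x ^ 2 * Im tau)%R by (destruct tau; cbn; ring).
  apply Rmult_lt_0_compat; [apply pow2_gt_0; lra | exact HT]. }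
assert (Hq : forall n, Gauss (r n ^ 2 * tau) = r n * Gauss tau).
{ intros n; destruct (Hr n) as [h _]; assert (hn := INR_C_neq0 (S n) ltac:(lia)).
  assert (ha : (0 < a n)%nat).
  { apply INR_lt; cbn [INR]; destruct (Ha n) as [h1 _]; assert (h2 := pos_INR (S n)); nra. }
  assert (E : RtoC (r n) = INR (a n) / INR (S n)) by (unfold r; apply RtoC_div, not_0_INR; lia).
  transitivity (/ INR (S n) * (INR (S n) * Gauss (r n ^ 2 * tau))); [field; exact hn |].
  rewrite <- Gauss_mul_sqr by (try lia; apply HTr; lra).
  replace (INR (S n) ^ 2 * (r n ^ 2 * tau)) with (INR (a n) ^ 2 * tau) by (rewrite E; field; exact hn).
  rewrite Gauss_mul_sqr, E by assumption; field; exact hn. }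
assert (hl2 : (0 < la ^ 2)%R) by (apply pow2_gt_0; lra).
assert (Hr2 : is_lim_seq (fun n => r n ^ 2)%R (la ^ 2)%R).
{ cbn [pow]; repeat apply is_lim_seq_mult'; auto using is_lim_seq_const. }
assert (Hinv : is_lim_seq (fun n => / r n ^ 2)%R (/ la ^ 2)%R).
{ apply (is_lim_seq_inv _ (la ^ 2)%R); [exact Hr2 | intros E; injection E; lra]. }
apply Ccv_unique with (u := fun n => Gauss (r n ^ 2 * tau)).
- unfold Gauss, Cdiv; apply Ccv_mult; [| apply Ccv_inv; [apply theta00_0_neq0, HTr, Hla |]].
  + assert (hB : forall n, (/ (la + 1) ^ 2 <= / r n ^ 2)%R).
    { intros n; destruct (Hr n) as [h1 h2].
      assert (h3 : (1 / (INR n + 1) <= 1)%R).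
      { unfold Rdiv; rewrite Rmult_1_l, <- Rinv_1; apply Rinv_le_contravar; [lra |].
        assert (h := pos_INR n); lra. }
      apply Rinv_le_contravar; [apply pow2_gt_0; lra | apply pow_incr; lra]. }
    assert (h := theta00_ray_cv (- (1) / tau) _ _ _ (Im_neg_inv tau HT)
      (Rinv_0_lt_compat _ (pow2_gt_0 (la + 1) ltac:(lra))) hB Hinv).
    assert (hi : forall x : R, (la <= x)%R -> (/ x ^ 2)%R * (- (1) / tau) = - (1) * / (x ^ 2 * tau)).
    { intros x Hx; rewrite RtoC_inv, RtoC_pow by (apply pow_nonzero; lra); field.
      split; [exact Ht0 | apply RtoC_neq0; lra]. }
    rewrite hi in h by lra; eapply Ccv_ext; [| exact h]; intros n; cbv beta; rewrite hi by apply Hr; reflexivity.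
  + rewrite <- RtoC_pow; eapply Ccv_ext; [| apply (theta00_ray_cv tau (fun n => r n ^ 2)%R (la ^ 2) (la ^ 2) HT hl2)].
    * intros n; cbv beta; rewrite RtoC_pow; reflexivity.
    * intros n; apply pow_incr; destruct (Hr n); lra.
    * exact Hr2.
- apply Ccv_ext with (fun n => r n * Gauss tau); [intros n; symmetry; apply Hq |].
  apply Ccv_mult; [apply Ccv_RtoC, Hl | apply Ccv_const].
Qed.

(** * The transformation of eta *)

Lemma e2pi_add_Z (w : C) (k : Z) : e2pi (w + IZR k) = e2pi w.
Proof. rewrite e2pi_plus, e2pi_Z; ring. Qed.

Lemma Im_triple (T : C) : (0 < Im T)%R -> (0 < Im (3 * T))%R.
Proof. destruct T as [x y]; cbn; lra. Qed.

(* Euler's pentagonal number theorem. *)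
Lemma eta_theta (tau : C) : (0 < Im tau)%R ->
  eta tau = e2pi (tau / 24) * theta 0 0 (3 * tau) (- tau / 2 - 1 / 2).
Proof.
intros HT; rewrite eta_Q, theta00_J by (try apply Im_triple; exact HT); f_equal.
replace (- tau / 2 - 1 / 2 + 3 * tau / 2 + 1 / 2) with tau by field.
unfold J, Q; rewrite (poch_split3 (e2pi tau)) by (apply Cmod_e2pi_lt1, HT).
replace (e2pi (3 * tau)) with (e2pi tau ^ 3) by (rewrite e2pi_pow; f_equal; replace (INR 3) with 3%R by (cbn; ring); ring).
replace (e2pi (3 * tau - tau)) with (e2pi tau * e2pi tau) by (rewrite <- e2pi_plus; f_equal; ring).
replace (e2pi tau * e2pi tau ^ 2) with (e2pi tau ^ 3) by ring; ring.
Qed.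

Lemma eta_series (tau : C) : (0 < Im tau)%R ->
  eta tau = CSumZ (fun n => e2pi (tau * (6 * IZR n + 1) ^ 2 / 24 + IZR n / 2)).
Proof.
intros HT; rewrite eta_theta, theta00_e2pi by exact HT.
destruct (theta00_bd (3 * tau) (- tau / 2 - 1 / 2) (Im_triple _ HT)) as [K HK].
rewrite <- (CSumZ_opp _ _ HK), <- (CSumZ_scal _ _ _ (bd_opp _ _ HK)).
apply CSumZ_ext; intros n; rewrite <- e2pi_plus; f_equal; push_RtoC; field.
Qed.

Lemma CSumZ_odd (K : R) (u : Z -> C) : bd K u -> (forall n, u (- n - 1)%Z = - u n) -> CSumZ u = 0.
Proof.
intros B H.
assert (E : CSumZ u = - CSumZ u).
{ rewrite <- (CSumZ_opp _ _ B) at 1; rewrite <- (CSumZ_shift _ _ 1 (bd_opp _ _ B)).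
  replace (- CSumZ u) with (- (1) * CSumZ u) by ring; rewrite <- (CSumZ_scal _ _ _ B).
  apply CSumZ_ext; intros n; replace (- (n + 1))%Z with (- n - 1)%Z by lia; rewrite H; ring. }
replace (CSumZ u) with ((CSumZ u - - CSumZ u) / 2) by field.
rewrite <- E; field.
Qed.

Lemma e2pi_twelfth : e2pi (- (1 / 12)) + e2pi (1 / 12) = sqrt 3.
Proof.
replace (- (1 / 12)) with (RtoC (- (1 / 12))) by (rewrite RtoC_opp, RtoC_div by lra; reflexivity).
replace (1 / 12) with (RtoC (1 / 12)) by (rewrite RtoC_div by lra; reflexivity).
rewrite !e2pi_R.
replace (2 * PI * - (1 / 12))%R with (- (PI / 6))%R by field.
replace (2 * PI * (1 / 12))%R with (PI / 6)%R by field.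
rewrite cos_neg, sin_neg, cos_PI6; apply C_eq; cbn; field.
Qed.

(** By the pentagonal series, eta at [- 1 / tau] is a theta function of modulus [- 1 / (tau / 3)].
    After inversion the series of modulus [tau / 3] is split modulo 3: two classes are [eta tau]
    times [e2pi] of minus and plus 1/12, which add up to [sqrt 3], and the third vanishes.
    Homogeneity later absorbs the [sqrt 3]. *)
Lemma eta_S_third (tau : C) : (0 < Im tau)%R ->
  eta (- (1) / tau) = sqrt 3 * Gauss (tau / 3) * eta tau.
Proof.
intros HT; assert (Ht0 := Im_pos_neq0 tau HT).
assert (HT3 : (0 < Im (tau / 3))%R) by (replace (Im (tau / 3)) with (Im tau / 3)%R by (destruct tau; cbn; field); lra).
rewrite eta_theta by (apply Im_neg_inv, HT).
replace (3 * (- (1) / tau)) with (- (1) / (tau / 3)) by (field; exact Ht0).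
replace (- (- (1) / tau) / 2 - 1 / 2) with ((1 - tau) / 6 / (tau / 3)) by (field; exact Ht0).
rewrite theta00_S by exact HT3.
replace (((1 - tau) / 6) ^ 2 / (2 * (tau / 3))) with (- (- (1) / tau / 24) + (- (1 / 12) + tau / 24)) by (field; exact Ht0).
rewrite e2pi_plus, e2pi_opp.
assert (Hsum : e2pi (- (1 / 12) + tau / 24) * theta 0 0 (tau / 3) ((1 - tau) / 6) = sqrt 3 * eta tau).
{ rewrite theta00_e2pi.
  destruct (theta00_bd (tau / 3) ((1 - tau) / 6) HT3) as [K HK].
  rewrite <- (CSumZ_scal _ _ _ HK).
  set (u := fun n : Z => e2pi (- (1 / 12) + tau / 24) * e2pi (tau / 3 * IZR n ^ 2 / 2 + IZR n * ((1 - tau) / 6))).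
  assert (Bu := bd_scal _ (e2pi (- (1 / 12) + tau / 24)) _ HK); fold u in Bu.
  rewrite (CSumZ_split _ 3 u ltac:(lia) Bu); cbn [csum].
  assert (Hr : forall j (n : Z), u (Z.of_nat 3 * n + Z.of_nat j)%Z =
    e2pi (tau * (6 * IZR n + 2 * INR j - 1) ^ 2 / 24 + IZR n / 2 + (INR j / 6 - 1 / 12))).
  { intros j n; unfold u; rewrite <- e2pi_plus; f_equal; push_RtoC.
    rewrite <- !INR_IZR_INZ; replace (INR 3) with 3%R by (cbn; ring); field. }
  (* In this class the square is [(6 n + 3)^2], invariant under the exchange of [n] and [- n - 1],
     whereas the sign [e2pi (n / 2)] changes. *)
  assert (E2 : CSumZ (fun n => u (Z.of_nat 3 * n + Z.of_nat 2)%Z) = 0).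
  { apply (CSumZ_odd _ (fun n => u (Z.of_nat 3 * n + Z.of_nat 2)%Z) (bd_mul _ u 3 2 ltac:(lia) Bu)); intros n.
    cbv beta; rewrite !Hr.
    replace (tau * (6 * IZR (- n - 1) + 2 * INR 2 - 1) ^ 2 / 24 + IZR (- n - 1) / 2 + (INR 2 / 6 - 1 / 12))
      with (tau * (6 * IZR n + 2 * INR 2 - 1) ^ 2 / 24 + IZR n / 2 + (INR 2 / 6 - 1 / 12) + 1 / 2 + IZR (- n - 1))
      by (cbn [INR]; push_RtoC; field).
    rewrite e2pi_add_Z, (e2pi_plus _ (1 / 2)), e2pi_half; ring. }
  assert (Be : exists K', bd K' (fun n => e2pi (tau * (6 * IZR n + 1) ^ 2 / 24 + IZR n / 2))).
  { apply (bd_gauss (tau * (3 / 2)) (tau / 2 + 1 / 2) (tau / 24)).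
    - replace (Im (tau * (3 / 2))) with (Im tau * (3 / 2))%R by (destruct tau; cbn; field); lra.
    - intros n; f_equal; field. }
  destruct Be as [K' HK'].
  assert (E1 : CSumZ (fun n => u (Z.of_nat 3 * n + Z.of_nat 1)%Z) = e2pi (1 / 12) * eta tau).
  { rewrite eta_series, <- (CSumZ_scal _ _ _ HK') by exact HT.
    apply CSumZ_ext; intros n; rewrite Hr, <- e2pi_plus; f_equal; cbn [INR]; field. }
  assert (E0 : CSumZ (fun n => u (Z.of_nat 3 * n + Z.of_nat 0)%Z) = e2pi (- (1 / 12)) * eta tau).
  { rewrite eta_series, <- (CSumZ_opp _ _ HK'), <- (CSumZ_scal _ _ _ (bd_opp _ _ HK')) by exact HT.
    apply CSumZ_ext; intros n; rewrite Hr, <- e2pi_plus, <- (e2pi_add_Z (_ + (_ + _)) n); f_equal.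
    cbn [INR]; push_RtoC; field. }
  rewrite E0, E1, E2, <- e2pi_twelfth; ring. }
transitivity (Gauss (tau / 3) * (e2pi (- (1 / 12) + tau / 24) * theta 0 0 (tau / 3) ((1 - tau) / 6))).
- field; apply e2pi_neq0.
- rewrite Hsum; ring.
Qed.

Lemma Gauss_scale_sqrt (tau : C) (x : R) : (0 < Im tau)%R -> (0 < x)%R ->
  Gauss (x * tau) = sqrt x * Gauss tau.
Proof.
intros HT Hx; rewrite <- Gauss_scale by (auto using sqrt_lt_R0).
rewrite <- RtoC_pow, pow2_sqrt by lra; reflexivity.
Qed.

Lemma eta_S (tau : C) : (0 < Im tau)%R -> eta (- (1) / tau) = Gauss tau * eta tau.
Proof.
intros HT; rewrite eta_S_third by exact HT.
assert (HT3 : (0 < Im (tau / 3))%R) by (replace (Im (tau / 3)) with (Im tau / 3)%R by (destruct tau; cbn; field); lra).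
rewrite <- Gauss_scale_sqrt by (try assumption; lra).
replace (3 * (tau / 3)) with tau by field; reflexivity.
Qed.

(** * Transformation of [a0], [a1] and of the eta quotients *)

Lemma theta00_half (tau z : C) : (0 < Im tau)%R ->
  theta 0 0 (tau / 2) (z / 2) = a0 tau z + a1 tau z.
Proof.
intros HT; unfold a0, a1; rewrite !theta00_e2pi, theta10_e2pi.
destruct (theta00_bd (tau / 2) (z / 2) (Im_half _ HT)) as [K HK].
rewrite (CSumZ_split _ 2 _ ltac:(lia) HK); cbn [csum]; rewrite Cplus_0_l.
f_equal; apply CSumZ_ext; intros n; f_equal.
- replace (Z.of_nat 2 * n + Z.of_nat 0)%Z with (2 * n)%Z by lia; push_RtoC; field.
- replace (Z.of_nat 2 * n + Z.of_nat 1)%Z with (2 * n + 1)%Z by lia; push_RtoC; field.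
Qed.

Lemma sqrt2_sqr : RtoC (sqrt 2) * sqrt 2 = 2.
Proof. rewrite <- RtoC_mult, sqrt_sqrt by lra; reflexivity. Qed.

Lemma Gauss_double (tau : C) : (0 < Im tau)%R -> Gauss (2 * tau) = sqrt 2 * Gauss tau.
Proof. intros; apply Gauss_scale_sqrt; auto; lra. Qed.

Lemma Gauss_half (tau : C) : (0 < Im tau)%R -> Gauss tau = sqrt 2 * Gauss (tau / 2).
Proof.
intros H; rewrite <- Gauss_double by (apply Im_half, H); f_equal; field.
Qed.

(** The modulus [2 (- 1 / tau)] is the inversion of [tau / 2]; splitting the inverted series by
    parity returns to modulus [2 tau]. *)
Lemma a0_S (tau z : C) : (0 < Im tau)%R -> a0 (- (1) / tau) (z / tau) =
  e2pi (z ^ 2 / (4 * tau)) * (Gauss (tau / 2) * (a0 tau z + a1 tau z)).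
Proof.
intros HT; assert (Ht0 := Im_pos_neq0 tau HT); unfold a0 at 1.
replace (2 * (- (1) / tau)) with (- (1) / (tau / 2)) by (field; exact Ht0).
replace (z / tau) with (z / 2 / (tau / 2)) by (field; exact Ht0).
rewrite theta00_S, theta00_half by (try apply Im_half; exact HT).
do 2 f_equal; field; exact Ht0.
Qed.

Lemma a_sub1 (tau z : C) : (0 < Im tau)%R ->
  a0 tau (z - 1) = a0 tau z /\ a1 tau (z - 1) = - a1 tau z.
Proof.
intros HT; destruct (theta_add1 (2 * tau) (z - 1) (Im_double _ HT)) as [h1 h2].
replace (z - 1 + 1) with z in h1, h2 by ring; unfold a0, a1; rewrite h1, h2; split; ring.
Qed.

(** The half-period that relates [theta 1 0] to [theta 0 0] becomes the translation [z - 1] after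
    inversion, and this changes the sign of [a1]. *)
Lemma a1_S (tau z : C) : (0 < Im tau)%R -> a1 (- (1) / tau) (z / tau) =
  e2pi (z ^ 2 / (4 * tau)) * (Gauss (tau / 2) * (a0 tau z - a1 tau z)).
Proof.
intros HT; assert (Ht0 := Im_pos_neq0 tau HT); unfold a1 at 1.
rewrite theta10_00 by (apply Im_double, Im_neg_inv, HT).
replace (z / tau + 2 * (- (1) / tau) / 2) with ((z - 1) / 2 / (tau / 2)) by (field; exact Ht0).
replace (2 * (- (1) / tau)) with (- (1) / (tau / 2)) by (field; exact Ht0).
rewrite theta00_S, theta00_half by (try apply Im_half; exact HT).
destruct (a_sub1 tau z HT) as [-> ->].
rewrite Cmult_assoc, <- e2pi_plus; replace (a0 tau z + - a1 tau z) with (a0 tau z - a1 tau z) by ring.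
do 2 f_equal; field; exact Ht0.
Qed.

(** Inversion interchanges the arguments [tau / 2] and [2 tau], hence [w1] and [w2], while [w3] is
    symmetric in them. Every quotient has one eta more than two in the denominator balance, or two
    in it, so the common weight factor is [Gauss^(-2)]. *)
Lemma w_S (tau : C) : (0 < Im tau)%R ->
  w1 (- (1) / tau) = sqrt 2 / Gauss tau ^ 2 * w2 tau /\
  w2 (- (1) / tau) = / (sqrt 2 * Gauss tau ^ 2) * w1 tau /\
  w3 (- (1) / tau) = / Gauss tau ^ 2 * w3 tau.
Proof.
intros HT; assert (Ht0 := Im_pos_neq0 tau HT).
destruct (eta_triple_neq0 tau HT) as [e [e2 e3]].
assert (hg := Gauss_neq0 tau HT); assert (hs := sqrt2_neq0).
assert (hh := Gauss_half tau HT).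
assert (hg2 : Gauss (tau / 2) = Gauss tau / sqrt 2) by (rewrite hh; field; exact hs).
unfold w1, w2, w3.
replace (- (1) / tau / 2) with (- (1) / (2 * tau)) by (field; exact Ht0).
replace (2 * (- (1) / tau)) with (- (1) / (tau / 2)) by (field; exact Ht0).
rewrite !eta_S, Gauss_double, hg2 by (try apply Im_double; try apply Im_half; exact HT).
repeat split; field; repeat split; assumption.
Qed.

Lemma Im_add1 (tau : C) : Im (tau + 1) = Im tau.
Proof. destruct tau; cbn; ring. Qed.

Lemma eta_T (tau : C) : (0 < Im tau)%R -> eta (tau + 1) = e2pi (1 / 24) * eta tau.
Proof.
intros HT; rewrite !eta_Q by (try rewrite Im_add1; exact HT); unfold Q.
rewrite (e2pi_plus tau 1), e2pi_1, Cmult_1_r, Cmult_assoc, <- e2pi_plus; do 2 f_equal; field.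
Qed.

(** Translation takes [tau / 2] to [(tau + 1) / 2], that is, [p = e2pi (tau / 2)] to [- p]. Since
    [(p; p^2) (- p; p^2) = (p^2; p^4)], the new eta function is expressed by the old ones; this is
    what interchanges [w1] and [w3] up to constants. *)
Lemma eta_T_half (tau : C) : (0 < Im tau)%R ->
  eta ((tau + 1) / 2) * (eta (tau / 2) * eta (2 * tau)) = e2pi (1 / 48) * eta tau ^ 3.
Proof.
intros HT; assert (HT1 : (0 < Im (tau + 1))%R) by (rewrite Im_add1; exact HT).
rewrite !eta_Q by (try apply Im_half; try apply Im_double; assumption); unfold Q.
set (p := e2pi (tau / 2)).
assert (Hp : (Cmod p < 1)%R) by (apply Cmod_e2pi_lt1, Im_half, HT).
assert (Hp2 : (Cmod (p ^ 2) < 1)%R) by (apply Cmod_pow_lt1; auto).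
replace (e2pi ((tau + 1) / 2)) with (- p).
2:{ replace ((tau + 1) / 2) with (tau / 2 + 1 / 2) by field; rewrite e2pi_plus, e2pi_half; fold p; ring. }
replace (e2pi tau) with (p ^ 2) by (unfold p; rewrite <- e2pi_double; f_equal; field).
replace (e2pi (2 * tau)) with ((p ^ 2) ^ 2).
2:{ unfold p; rewrite <- !e2pi_double; f_equal; field. }
assert (Hm : (Cmod (- p) < 1)%R) by (rewrite Cmod_opp; exact Hp).
rewrite (poch_split2 (- p) (- p)) by exact Hm; rewrite (poch_split2 p p) by exact Hp.
replace ((- p) ^ 2) with (p ^ 2) by ring; replace (- p * - p) with (p ^ 2) by ring.
replace (p * p) with (p ^ 2) by ring.
assert (h1 := poch_sqr p (p ^ 2) Hp2).
assert (h2 := poch_split2 (p ^ 2) (p ^ 2) Hp2); replace (p ^ 2 * p ^ 2) with ((p ^ 2) ^ 2) in h2 by ring.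
set (X := poch (p ^ 2) (p ^ 2)) in *.
transitivity (e2pi ((tau + 1) / 2 / 24) * e2pi (tau / 2 / 24) * e2pi (2 * tau / 24) * (X ^ 2 *
  ((poch p (p ^ 2) * poch (- p) (p ^ 2)) * poch ((p ^ 2) ^ 2) ((p ^ 2) ^ 2)))); [ring |].
rewrite <- h1, <- h2, <- !e2pi_plus.
transitivity (e2pi (1 / 48) * (e2pi (tau / 24) * e2pi (tau / 24) * e2pi (tau / 24)) * X ^ 3); [| ring].
rewrite <- !e2pi_plus.
replace ((tau + 1) / 2 / 24 + tau / 2 / 24 + 2 * tau / 24)
  with (1 / 48 + (tau / 24 + tau / 24 + tau / 24)) by field; ring.
Qed.

Lemma w_T (tau : C) : (0 < Im tau)%R ->
  w1 (tau + 1) = e2pi (1 / 48) / e2pi (1 / 24) ^ 3 * w3 tau /\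
  w2 (tau + 1) = / e2pi (1 / 24) * w2 tau /\
  w3 (tau + 1) = / (e2pi (1 / 48) * e2pi (1 / 24) ^ 2) * w1 tau.
Proof.
intros HT; assert (HT1 : (0 < Im (tau + 1))%R) by (rewrite Im_add1; exact HT).
destruct (eta_triple_neq0 tau HT) as [e [e2 e3]].
assert (E1 : eta ((tau + 1) / 2) = e2pi (1 / 48) * eta tau ^ 3 / (eta (tau / 2) * eta (2 * tau)))
  by (rewrite <- eta_T_half by exact HT; field; auto).
assert (E2 : eta (2 * (tau + 1)) = e2pi (1 / 24) ^ 2 * eta (2 * tau)).
{ replace (2 * (tau + 1)) with (2 * tau + 1 + 1) by ring.
  rewrite !eta_T by (try rewrite Im_add1; apply Im_double, HT); ring. }
unfold w1, w2, w3; rewrite E1, E2, eta_T by exact HT.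
repeat split; field; repeat split; auto using e2pi_neq0.
Qed.

Lemma a0_T (tau z : C) : a0 (tau + 1) z = a0 tau z.
Proof.
unfold a0; rewrite !theta00_e2pi; apply CSumZ_ext; intros n.
rewrite <- (e2pi_add_Z (2 * tau * IZR n ^ 2 / 2 + IZR n * z) (n * n)); f_equal; push_RtoC; field.
Qed.

Lemma a1_T (tau z : C) : (0 < Im tau)%R -> a1 (tau + 1) z = Ci * a1 tau z.
Proof.
intros HT; unfold a1; rewrite !theta10_e2pi.
destruct (theta10_bd (2 * tau) z (Im_double _ HT)) as [K HK].
rewrite <- (CSumZ_scal _ _ _ HK); apply CSumZ_ext; intros n.
rewrite <- e2pi_quarter, <- e2pi_plus, <- (e2pi_add_Z (1 / 4 + _) (n * n + n)); f_equal; push_RtoC; field.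
Qed.

(** * Coordinates on the span of the six functions *)

Definition model (c1 c2 c3 c4 c5 c6 : C) : fn := fun tau z =>
  c1 * (w1 tau * (a0 tau z * a1 tau z)) + c2 * (w1 tau * (a0 tau z ^ 2 + a1 tau z ^ 2))
  + c3 * (w3 tau * (a0 tau z * a1 tau z)) + c4 * (w3 tau * (a0 tau z ^ 2 - a1 tau z ^ 2))
  + c5 * (w2 tau * a1 tau z ^ 2) + c6 * (w2 tau * a0 tau z ^ 2).

Definition in_model (f : fn) : Prop :=
  exists c1 c2 c3 c4 c5 c6, fn_eq f (model c1 c2 c3 c4 c5 c6).

Lemma Ci_sqr : Ci * Ci = - (1).
Proof. apply C_eq; cbn; ring. Qed.

Lemma span_six (f : fn) : span six_functions f <-> in_model f.
Proof.
split.
- intros [cs [Hl H]]; unfold six_functions in *; cbn [length] in Hl.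
  destruct cs as [|d1 [|d2 [|d3 [|d4 [|d5 [|d6 [|]]]]]]]; try discriminate Hl.
  exists (- Ci * d2), (- Ci * d4), (Ci * d1), (- d3), (Ci * sqrt 2 * d5), (Ci * sqrt 2 * d6).
  intros tau z Hd; rewrite (H tau z Hd).
  cbn [lincomb]; unfold fn_plus, fn_scal, fn_zero, model.
  rewrite ch_plus_1, ch_minus_1, ch_plus_02, ch_minus_02, ch_tw_plus_1, ch_tw_minus_1 by exact Hd; ring.
- intros [c1 [c2 [c3 [c4 [c5 [c6 H]]]]]].
  assert (hs := sqrt2_neq0).
  (* The inverse of the change of coordinates above, with [- Ci] for [/ Ci]. *)
  exists (- Ci * c3 :: Ci * c1 :: - c4 :: Ci * c2 :: - Ci * c5 / sqrt 2 :: - Ci * c6 / sqrt 2 :: nil).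
  split; [reflexivity |]; intros tau z Hd; rewrite (H tau z Hd).
  unfold six_functions; cbn [lincomb map]; unfold fn_plus, fn_scal, fn_zero, model.
  rewrite ch_plus_1, ch_minus_1, ch_plus_02, ch_minus_02, ch_tw_plus_1, ch_tw_minus_1 by exact Hd.
  set (x1 := w1 tau * (a0 tau z * a1 tau z)); set (x2 := w1 tau * (a0 tau z ^ 2 + a1 tau z ^ 2)).
  set (x3 := w3 tau * (a0 tau z * a1 tau z)); set (x4 := w3 tau * (a0 tau z ^ 2 - a1 tau z ^ 2)).
  set (x5 := w2 tau * a1 tau z ^ 2); set (x6 := w2 tau * a0 tau z ^ 2).
  transitivity (- (Ci * Ci) * (c1 * x1 + c2 * x2 + c3 * x3 + c5 * x5 + c6 * x6) + c4 * x4);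
    [rewrite Ci_sqr; ring | field; exact hs].
Qed.

(** * The action of the modular group *)

Lemma dom_add1 (tau z : C) : dom tau z -> dom (tau + 1) z.
Proof.
intros H; assert (h := dom_slash 1 1 0 1 tau z eq_refl H).
replace ((1 * tau + 1) / (0 * tau + 1)) with (tau + 1) in h by field.
replace (z / (0 * tau + 1)) with z in h by field; exact h.
Qed.

Lemma dom_sub1 (tau z : C) : dom tau z -> dom (tau - 1) z.
Proof.
intros H; assert (h := dom_slash 1 (-1) 0 1 tau z eq_refl H).
replace ((1 * tau + -1) / (0 * tau + 1)) with (tau - 1) in h by field.
replace (z / (0 * tau + 1)) with z in h by field; exact h.
Qed.

Lemma dom_S (tau z : C) : dom tau z -> dom (- (1) / tau) (z / tau).
Proof.
intros H; assert (h0 := Im_pos_neq0 tau (proj1 H)).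
assert (h := dom_slash 0 (-1) 1 0 tau z eq_refl H).
replace ((0 * tau + -1) / (1 * tau + 0)) with (- (1) / tau) in h by (field; exact h0).
replace (z / (1 * tau + 0)) with (z / tau) in h by (field; exact h0); exact h.
Qed.

Lemma slash_translation (b : Z) (f : fn) (tau z : C) : slash 1 b 0 1 f tau z = f (tau + IZR b) z.
Proof.
unfold slash.
replace (- (PI * Ci * 0 * z ^ 2 / (0 * tau + 1))) with (RtoC 0) by field.
replace ((1 * tau + IZR b) / (0 * tau + 1)) with (tau + IZR b) by field.
replace (z / (0 * tau + 1)) with z by field; rewrite Cexp_0; ring.
Qed.

Lemma slash_S (f : fn) (tau z : C) : tau <> 0 ->
  slash 0 (-1) 1 0 f tau z = e2pi (- (z ^ 2 / (2 * tau))) * f (- (1) / tau) (z / tau).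
Proof.
intros h0; unfold slash, e2pi.
replace ((0 * tau + -1) / (1 * tau + 0)) with (- (1) / tau) by (field; exact h0).
replace (z / (1 * tau + 0)) with (z / tau) by (field; exact h0).
do 2 f_equal; field; exact h0.
Qed.

(** [slash] is a right action, so the matrix of the inner action stands on the left in the product.
    The exponents combine by the cocycle relation for the lower rows, where the determinant of the
    outer matrix enters. *)
Lemma slash_slash (x1 y1 u1 v1 x2 y2 u2 v2 : Z) (f : fn) (tau z : C) :
  (x1 * v1 - y1 * u1 = 1)%Z -> (x2 * v2 - y2 * u2 = 1)%Z -> (0 < Im tau)%R ->
  slash x2 y2 u2 v2 (slash x1 y1 u1 v1 f) tau z =
  slash (x1 * x2 + y1 * u2) (x1 * y2 + y1 * v2) (u1 * x2 + v1 * u2) (u1 * y2 + v1 * v2) f tau z.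
Proof.
intros D1 D2 HT; unfold slash.
assert (h2 : IZR u2 * tau + IZR v2 <> 0).
{ apply J_neq0; [exact HT |]; destruct (Z.eq_dec u2 0); destruct (Z.eq_dec v2 0); subst; lia. }
assert (h12 : IZR (u1 * x2 + v1 * u2) * tau + IZR (u1 * y2 + v1 * v2) <> 0).
{ apply J_neq0; [exact HT |].
  destruct (Z.eq_dec (u1 * x2 + v1 * u2) 0) as [E1 |]; [| left; assumption].
  destruct (Z.eq_dec (u1 * y2 + v1 * v2) 0) as [E2 |]; [| right; assumption].
  exfalso.
  assert (e1 : (u1 = (u1 * x2 + v1 * u2) * v2 - (u1 * y2 + v1 * v2) * u2)%Z)
    by (transitivity (u1 * (x2 * v2 - y2 * u2))%Z; [rewrite D2; ring | ring]).
  assert (e2 : (v1 = (u1 * y2 + v1 * v2) * x2 - (u1 * x2 + v1 * u2) * y2)%Z)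
    by (transitivity (v1 * (x2 * v2 - y2 * u2))%Z; [rewrite D2; ring | ring]).
  rewrite E1, E2 in e1, e2; lia. }
rewrite Cmult_assoc, <- Cexp_plus.
assert (D2' : IZR x2 * IZR v2 - IZR y2 * IZR u2 = 1)
  by (rewrite <- !RtoC_mult, <- !mult_IZR, <- RtoC_minus, <- minus_IZR, D2; reflexivity).
rewrite !plus_IZR, !mult_IZR, !RtoC_plus, !RtoC_mult in *.
set (J2 := IZR u2 * tau + IZR v2) in *.
set (J12 := (IZR u1 * IZR x2 + IZR v1 * IZR u2) * tau + (IZR u1 * IZR y2 + IZR v1 * IZR v2)) in *.
assert (EJ : IZR u1 * ((IZR x2 * tau + IZR y2) / J2) + IZR v1 = J12 / J2)
  by (unfold J12, J2; field; exact h2).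
rewrite EJ; f_equal; [f_equal | f_equal].
- transitivity (- (PI * Ci * z ^ 2 / (J2 * J12)) * (IZR u2 * J12 + IZR u1)); [field; auto |].
  replace (IZR u2 * J12 + IZR u1) with ((IZR u1 * IZR x2 + IZR v1 * IZR u2) * J2); [field; auto |].
  rewrite <- (Cmult_1_r (IZR u1)) at 2; rewrite <- D2'; unfold J12, J2; ring.
- transitivity ((IZR x1 * (IZR x2 * tau + IZR y2) + IZR y1 * J2) / J12); [field; auto |].
  unfold J2; field; exact h12.
- field; auto.
Qed.

Definition stable (W : fn -> Prop) (x y u v : Z) : Prop :=
  forall f, W f -> W (slash x y u v f).

(** The entries of the product are free variables subject to equations, so that each use leaves only
    integer arithmetic. Closure under [fn_eq] is required because the composition law for [slash]
    holds only where [tau] is in the upper half-plane. *)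
Lemma stable_mul (W : fn -> Prop) (x1 y1 u1 v1 x2 y2 u2 v2 x y u v : Z) :
  (forall f g, fn_eq f g -> W f -> W g) ->
  (x1 * v1 - y1 * u1 = 1)%Z -> (x2 * v2 - y2 * u2 = 1)%Z ->
  stable W x1 y1 u1 v1 -> stable W x2 y2 u2 v2 ->
  x = (x1 * x2 + y1 * u2)%Z -> y = (x1 * y2 + y1 * v2)%Z ->
  u = (u1 * x2 + v1 * u2)%Z -> v = (u1 * y2 + v1 * v2)%Z ->
  stable W x y u v.
Proof.
intros HW D1 D2 H1 H2 -> -> -> -> f Hf.
apply HW with (slash x2 y2 u2 v2 (slash x1 y1 u1 v1 f)); [| apply H2, H1, Hf].
intros tau z Hd; apply slash_slash; auto; apply Hd.
Qed.

(** Euclid's algorithm on the first column, by induction on [|c|]. The inverse translation is a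
    separate hypothesis because [stable] is an inclusion in one direction; minus the identity is the
    square of the inversion. *)
Lemma SL2Z_generated (W : fn -> Prop) :
  (forall f g, fn_eq f g -> W f -> W g) ->
  stable W 0 (-1) 1 0 -> stable W 1 1 0 1 -> stable W 1 (-1) 0 1 -> SL2Z_invariant W.
Proof.
intros HW HS HT HT'.
assert (H1 : stable W 1 0 0 1).
{ apply (stable_mul W 1 1 0 1 1 (-1) 0 1); auto. }
assert (Hn : forall n : nat, stable W 1 (Z.of_nat n) 0 1 /\ stable W 1 (- Z.of_nat n) 0 1).
{ induction n as [|n [IH1 IH2]]; [split; exact H1 |]; split.
  - apply (stable_mul W 1 1 0 1 1 (Z.of_nat n) 0 1); auto; lia.
  - apply (stable_mul W 1 (-1) 0 1 1 (- Z.of_nat n) 0 1); auto; lia. }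
assert (HTb : forall b, stable W 1 b 0 1).
{ intros b; destruct (Z_le_gt_dec 0 b) as [h | h].
  - rewrite <- (Z2Nat.id b h); apply Hn.
  - replace b with (- Z.of_nat (Z.to_nat (- b)))%Z by lia; apply Hn. }
assert (Hm : stable W (-1) 0 0 (-1)).
{ apply (stable_mul W 0 (-1) 1 0 0 (-1) 1 0); auto. }
assert (H : forall n : nat, forall a b c d : Z, (Z.abs_nat c <= n)%nat -> (a * d - b * c = 1)%Z ->
  stable W a b c d).
{ assert (H0 : forall a b d : Z, (a * d = 1)%Z -> stable W a b 0 d).
  { intros a b d Had; destruct (Z.mul_eq_1 a d Had) as [-> | ->].
    - replace d with 1%Z by lia; apply HTb.
    - replace d with (-1)%Z by lia.
      apply (stable_mul W (-1) 0 0 (-1) 1 (- b) 0 1); auto; lia. }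
  induction n as [|n IH]; intros a b c d Hc Hdet.
  - replace c with 0%Z in * by lia; apply H0; lia.
  - destruct (Z.eq_dec c 0) as [-> | Hc0]; [apply H0; lia |].
    (* Taking out [k] translations leaves the remainder of [a] modulo [c] in the corner; an
       inversion moves it, up to sign, to the lower left entry. *)
    set (k := (a / c)%Z).
    assert (Hk : (Z.abs (a - k * c) < Z.abs c)%Z).
    { replace (a - k * c)%Z with (a mod c)%Z by (unfold k; rewrite Z.mod_eq by exact Hc0; lia).
      apply Z.mod_bound_abs; exact Hc0. }
    assert (Hr : stable W c d (- (a - k * c)) (- (b - k * d))).
    { apply IH; [lia | nia]. }
    assert (Hs : stable W (a - k * c) (b - k * d) c d).
    { apply (stable_mul W 0 (-1) 1 0 c d (- (a - k * c)) (- (b - k * d))); auto; nia. }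
    apply (stable_mul W 1 k 0 1 (a - k * c) (b - k * d) c d); auto; nia. }
intros a b c d Hdet; exact (H _ a b c d (Nat.le_refl _) Hdet).
Qed.

Lemma in_model_ext (f g : fn) : fn_eq f g -> in_model f -> in_model g.
Proof.
intros E [c1 [c2 [c3 [c4 [c5 [c6 H]]]]]]; exists c1, c2, c3, c4, c5, c6.
intros tau z Hd; rewrite <- E by exact Hd; apply H, Hd.
Qed.

Lemma model_T (c1 c2 c3 c4 c5 c6 tau z : C) : (0 < Im tau)%R ->
  model c1 c2 c3 c4 c5 c6 (tau + 1) z =
  let c := e2pi (1 / 48) / e2pi (1 / 24) ^ 3 in
  let d := / (e2pi (1 / 48) * e2pi (1 / 24) ^ 2) in
  model (d * Ci * c3) (d * c4) (c * Ci * c1) (c * c2) (- / e2pi (1 / 24) * c5) (/ e2pi (1 / 24) * c6) tau z.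
Proof.
intros HT; unfold model; destruct (w_T tau HT) as [-> [-> ->]].
rewrite a0_T, a1_T by exact HT; cbv zeta.
replace ((Ci * a1 tau z) ^ 2) with (Ci * Ci * a1 tau z ^ 2) by ring; rewrite Ci_sqr.
field; repeat split; apply e2pi_neq0.
Qed.

(** Total weight 0 and index matching the factor of the action: the two copies of
    [e2pi (z^2 / (4 tau))] cancel the exponential, and [Gauss (tau / 2)^2 = Gauss tau ^ 2 / 2]
    cancels the weight of the eta quotients. *)
Lemma model_S (c1 c2 c3 c4 c5 c6 tau z : C) : (0 < Im tau)%R ->
  e2pi (- (z ^ 2 / (2 * tau))) * model c1 c2 c3 c4 c5 c6 (- (1) / tau) (z / tau) =
  model ((c6 - c5) / sqrt 2) ((c5 + c6) / (2 * sqrt 2)) (2 * c4) (c3 / 2)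
    (sqrt 2 * c2 - c1 / sqrt 2) (sqrt 2 * c2 + c1 / sqrt 2) tau z.
Proof.
intros HT; unfold model; destruct (w_S tau HT) as [-> [-> ->]].
rewrite a0_S, a1_S by exact HT.
assert (hs := sqrt2_neq0); assert (hg := Gauss_neq0 tau HT); assert (hh := Gauss_half tau HT).
assert (hg2 : Gauss (tau / 2) = Gauss tau / sqrt 2) by (rewrite hh; field; exact hs).
rewrite hg2.
replace (z ^ 2 / (2 * tau)) with (z ^ 2 / (4 * tau) + z ^ 2 / (4 * tau))
  by (field; apply Im_pos_neq0, HT).
set (s := RtoC (sqrt 2)) in *; assert (hss : s * s = 2) by apply sqrt2_sqr.
rewrite e2pi_opp, e2pi_plus; set (e := e2pi (z ^ 2 / (4 * tau))).
assert (he : e <> 0) by apply e2pi_neq0.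
set (g := Gauss tau) in *; set (x := a0 tau z); set (y := a1 tau z).
set (v1 := w1 tau); set (v2 := w2 tau); set (v3 := w3 tau).
replace (e * (g / s * (x + y))) with (e * g / s * (x + y)) by (field; exact hs).
replace (e * (g / s * (x - y))) with (e * g / s * (x - y)) by (field; exact hs).
transitivity (c1 / s * (v2 * (x ^ 2 - y ^ 2)) + c2 * 2 / s * (v2 * (x ^ 2 + y ^ 2))
  + c3 / (s * s) * (v3 * (x ^ 2 - y ^ 2)) + c4 * 4 / (s * s) * (v3 * (x * y))
  + c5 / (s * s * s) * (v1 * (x - y) ^ 2) + c6 / (s * s * s) * (v1 * (x + y) ^ 2)).
- field; auto.
- rewrite hss; replace (c2 * 2 / s) with (c2 * s) by (rewrite <- hss; field; exact hs); field; exact hs.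
Qed.

Lemma in_model_SL2Z : SL2Z_invariant in_model.
Proof.
apply SL2Z_generated; [exact in_model_ext | | |];
  intros f [c1 [c2 [c3 [c4 [c5 [c6 H]]]]]].
- do 6 eexists; intros tau z Hd.
  rewrite slash_S by (apply Im_pos_neq0, (proj1 Hd)).
  rewrite (H _ _ (dom_S _ _ Hd)), model_S by apply Hd; reflexivity.
- do 6 eexists; intros tau z Hd.
  rewrite slash_translation, (H _ _ (dom_add1 _ _ Hd)), model_T by apply Hd; reflexivity.
- set (c := e2pi (1 / 48) / e2pi (1 / 24) ^ 3).
  set (d := / (e2pi (1 / 48) * e2pi (1 / 24) ^ 2)).
  (* These coordinates come from solving the relations in [model_T], again with [- Ci] as the
     inverse of [Ci]. *)
  exists (- Ci * c3 / c), (c4 / c), (- Ci * c1 / d), (c2 / d),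
    (- e2pi (1 / 24) * c5), (e2pi (1 / 24) * c6).
  intros tau z Hd; rewrite slash_translation.
  assert (Hd' := dom_sub1 _ _ Hd).
  replace (tau + -1) with (tau - 1) by ring.
  rewrite (H _ _ Hd').
  replace tau with (tau - 1 + 1) at 2 by ring.
  rewrite model_T by apply Hd'; cbv zeta; fold c d.
  assert (hc : c <> 0) by (apply Cdiv_neq0; [| apply Cpow_nz]; apply e2pi_neq0).
  assert (hd : d <> 0)
    by (apply Cinv_neq0, Cmult_neq_0; [| apply Cpow_nz]; apply e2pi_neq0).
  replace (d * Ci * (- Ci * c1 / d)) with c1.
  2:{ transitivity (- (Ci * Ci) * c1); [rewrite Ci_sqr; ring | field; exact hd]. }
  replace (d * (c2 / d)) with c2 by (field; exact hd).
  replace (c * Ci * (- Ci * c3 / c)) with c3.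
  2:{ transitivity (- (Ci * Ci) * c3); [rewrite Ci_sqr; ring | field; exact hc]. }
  replace (c * (c4 / c)) with c4 by (field; exact hc).
  replace (- / e2pi (1 / 24) * (- e2pi (1 / 24) * c5)) with c5 by (field; apply e2pi_neq0).
  replace (/ e2pi (1 / 24) * (e2pi (1 / 24) * c6)) with c6 by (field; apply e2pi_neq0).
  reflexivity.
Qed.

(** * Periodicity of the honest characters *)

(** The exponent changes by [24 (n + a / 2)^2 = 24 n^2 + 24 n a + 6 a^2], an integer. *)
Lemma theta_period (a b : nat) (tau z : C) : theta a b (tau + 48) z = theta a b tau z.
Proof.
rewrite !theta_e2pi; apply CSumZ_ext; intros n.
rewrite <- (e2pi_add_Z (tau * _ ^ 2 / 2 + _)
  (24 * n * n + 24 * n * Z.of_nat a + 6 * Z.of_nat a * Z.of_nat a)).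
f_equal; push_RtoC; rewrite <- !INR_IZR_INZ; field.
Qed.

Lemma CLim_seq_ext (u v : nat -> C) : (forall n, u n = v n) -> CLim_seq u = CLim_seq v.
Proof.
intros H; unfold CLim_seq; f_equal; f_equal; apply Lim_seq_ext; intros n; rewrite H; reflexivity.
Qed.

Lemma eta_period (tau : C) (k : Z) : eta (tau + 24 * IZR k) = eta tau.
Proof.
unfold eta; f_equal.
- rewrite <- (e2pi_add_Z (tau / 24) k); f_equal; field.
- apply CLim_seq_ext; intros n; apply Cprod_ext; intros j _; f_equal.
  rewrite <- (e2pi_add_Z (INR (S j) * tau) (Z.of_nat (S j) * 24 * k)); f_equal.
  rewrite INR_IZR_INZ, !mult_IZR, !RtoC_mult; ring.
Qed.

(** Shifts of the first three arguments are by even integers because [s] is half an integer and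
    multiplies both the modulus and [z1] or [z2]. *)
Lemma Phi_period (m2 : nat) (T z1 z2 t : C) (l k1 k2 kt : Z) :
  Phi 1 (s_of m2) (T + 2 * IZR l) (z1 + 2 * IZR k1) (z2 + 2 * IZR k2) (t + IZR kt)
  = Phi 1 (s_of m2) T z1 z2 t.
Proof.
rewrite !Phi_terms.
assert (Es : RtoC (s_of m2) = (INR m2 + 1) / 2).
{ unfold s_of; rewrite RtoC_div, RtoC_plus by lra; reflexivity. }
replace (- (t + IZR kt)) with (- t + IZR (- kt)) by (push_RtoC; ring); rewrite e2pi_add_Z.
set (m := Z.of_nat m2); assert (Em : RtoC (INR m2) = IZR m) by (rewrite INR_IZR_INZ; reflexivity).
f_equal; f_equal; apply CSumZ_ext; intros n; unfold phi1_term, phi2_term;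
  rewrite Es, Em, <- !e2pi_plus.
- f_equal.
  + rewrite <- (e2pi_add_Z (1 * IZR n * (z1 + z2) + _ + _)
      (2 * n * (k1 + k2) + (m + 1) * k1 + 2 * l * n * n + (m + 1) * l * n)).
    f_equal; push_RtoC; field.
  + f_equal; rewrite <- (e2pi_add_Z (z1 + IZR n * T) (2 * k1 + 2 * n * l)).
    f_equal; push_RtoC; ring.
- f_equal.
  + rewrite <- (e2pi_add_Z (- (1 * IZR n * (z1 + z2)) - _ + _)
      (- (2 * n * (k1 + k2)) - (m + 1) * k2 + 2 * l * n * n + (m + 1) * l * n)).
    f_equal; push_RtoC; field.
  + f_equal; rewrite <- (e2pi_add_Z (- z2 + IZR n * T) (- (2 * k2) + 2 * n * l)).
    f_equal; push_RtoC; ring.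
Qed.

(** Demanded at every [tau] and [z], not only on [dom]: the identities behind it are equalities of
    the defining series and products term by term, so linear combinations need no side condition. *)
Definition periodic48 (f : fn) : Prop := forall tau z, f (tau + 48) z = f tau z.

Lemma eta_period48 (tau : C) : eta (tau + 48) = eta tau /\
  eta ((tau + 48) / 2) = eta (tau / 2) /\ eta (2 * (tau + 48)) = eta (2 * tau).
Proof.
repeat split.
- rewrite <- (eta_period tau 2); f_equal; ring.
- rewrite <- (eta_period (tau / 2) 1); f_equal; field.
- rewrite <- (eta_period (2 * tau) 4); f_equal; ring.
Qed.

Lemma characters_periodic (m2 : nat) : periodic48 (ch_plus m2) /\ periodic48 (ch_minus m2)
  /\ periodic48 (ch_tw_sigma_plus m2) /\ periodic48 (ch_tw_sigma_minus m2).
Proof.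
repeat split; intros tau z; destruct (eta_period48 tau) as [e1 [e2 e3]];
  unfold ch_plus, ch_minus, ch_tw_sigma_plus, ch_tw_sigma_minus, R_plus, R_minus, R_tw;
  rewrite ?e1, ?e2, ?e3, !theta_period; f_equal.
- rewrite <- (Phi_period m2 (2 * tau) (z + tau / 2 - 1 / 2) (z - tau / 2 + 1 / 2) (tau / 8) 48 12 (-12) 6).
  f_equal; field.
- rewrite <- (Phi_period m2 (2 * tau) (z + tau / 2) (z - tau / 2) (tau / 8) 48 12 (-12) 6).
  f_equal; field.
- rewrite <- (Phi_period m2 (2 * tau) (z + tau - 1 / 2) (z - tau + 1 / 2) (tau / 2) 48 24 (-24) 24).
  f_equal; field.
- rewrite <- (Phi_period m2 (2 * tau) (z - 1 / 2) (z + 1 / 2) 0 48 0 0 0).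
  f_equal; field.
Qed.

Lemma lincomb_periodic (cs : list C) (fs : list fn) :
  List.Forall periodic48 fs -> periodic48 (lincomb cs fs).
Proof.
intros H; revert cs; induction H as [|f fs Hf Hfs IH]; intros [|c cs] tau z; try reflexivity.
cbn [lincomb]; unfold fn_plus, fn_scal; rewrite Hf, IH; reflexivity.
Qed.

Lemma honest_periodic : List.Forall periodic48 honest_characters.
Proof.
unfold honest_characters; cbn [flat_map app];
  destruct (characters_periodic 0) as [h1 [h2 [h3 h4]]];
  destruct (characters_periodic 1) as [h5 [h6 [h7 h8]]];
  destruct (characters_periodic 2) as [h9 [h10 [h11 h12]]];
  repeat (constructor; [assumption |]); constructor.
Qed.

Lemma dom_add48 (tau z : C) : dom tau z -> dom (tau + 48) z.
Proof.
intros H; assert (h := dom_slash 1 48 0 1 tau z eq_refl H).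
replace ((1 * tau + 48) / (0 * tau + 1)) with (tau + 48) in h by field.
replace (z / (0 * tau + 1)) with z in h by field; exact h.
Qed.

Definition difference : fn := fun tau z => ch_minus 0 tau z - ch_minus 2 tau z.

Lemma difference_in_span : span honest_characters difference.
Proof.
exists (map RtoC (0 :: 1 :: 0 :: 0 :: 0 :: 0 :: 0 :: 0 :: 0 :: -1 :: 0 :: 0 :: nil)%R).
split; [reflexivity |]; intros tau z _; unfold honest_characters; cbn [flat_map app lincomb map].
unfold fn_plus, fn_scal, fn_zero, difference; ring.
Qed.

(* The weight of the difference is [-1/2]: a single factor [Gauss tau] remains, which is
   not periodic. *)
Lemma difference_S (tau z : C) : dom tau z ->
  slash 0 (-1) 1 0 difference tau z =
  - Ci * sqrt 2 * w2 tau * theta 1 0 tau z / Gauss tau.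
Proof.
intros Hd; assert (HT := proj1 Hd); assert (Ht0 := Im_pos_neq0 tau HT).
rewrite slash_S by exact Ht0; unfold difference.
rewrite ch_minus_diff by (apply dom_S, Hd).
destruct (w_S tau HT) as [-> _]; rewrite theta01_00.
replace (z / tau + 1 / 2) with ((z + tau / 2) / tau) by (field; exact Ht0).
rewrite theta00_S, theta10_00 by exact HT.
replace ((z + tau / 2) ^ 2 / (2 * tau)) with (z ^ 2 / (2 * tau) + (tau / 8 + z / 2)) by (field; exact Ht0).
rewrite e2pi_opp, (e2pi_plus (z ^ 2 / (2 * tau))).
field; split; [apply Gauss_neq0, HT | apply e2pi_neq0].
Qed.

Lemma Cinv_eq_inv (a b : C) : a <> 0 -> b <> 0 -> / a = / b -> a = b.
Proof.
intros ha hb E; transitivity (a * (/ b * b)); [field; exact hb |].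
rewrite <- E; field; exact ha.
Qed.

Lemma Gauss_period (tau z : C) :
  span honest_characters (slash 0 (-1) 1 0 difference) -> dom tau z ->
  Gauss (tau + 48) = Gauss tau.
Proof.
intros [cs [_ Hcs]] Hd; assert (HT := proj1 Hd).
assert (Hd' := dom_add48 _ _ Hd).
assert (E := lincomb_periodic cs _ honest_periodic tau z).
rewrite <- (Hcs _ _ Hd), <- (Hcs _ _ Hd'), !difference_S in E by assumption.
destruct (eta_period48 tau) as [e1 [_ e3]].
unfold w2 in E; rewrite e1, e3, theta_period in E.
destruct (eta_triple_neq0 tau HT) as [h1 [h2 h3]].
destruct (theta_dom_neq0 tau z Hd) as [_ [_ [h4 _]]].
assert (g1 := Gauss_neq0 tau HT); assert (g2 := Gauss_neq0 _ (proj1 Hd')).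
set (c := - Ci * sqrt 2 * (eta (2 * tau) / eta tau ^ 3) * theta 1 0 tau z) in E.
assert (hc : c <> 0).
{ unfold c; apply Cmult_neq_0; [apply Cmult_neq_0; [apply Cmult_neq_0; [| apply sqrt2_neq0] |] | exact h4].
  2: apply Cdiv_neq0; [exact h3 | apply Cpow_nz, h1].
  intros E'; apply (f_equal Im) in E'; cbn in E'; lra. }
apply Cinv_eq_inv; [exact g2 | exact g1 |].
transitivity (/ c * (c / Gauss (tau + 48))); [field; auto |].
rewrite E; field; auto.
Qed.

(** A test point at which the identities of functions on [dom] may be evaluated: a half-lattice
    point with zero imaginary part is [k / 2], and this is never 1/4. *)
Lemma dom_quarter (x : Z) (y : R) : (0 < y)%R -> dom (IZR x + y * Ci) (1 / 4).
Proof.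
intros Hy; split; [cbn; lra |]; intros k l E.
assert (EI := f_equal Im E); assert (ER := f_equal Re E).
replace (1 / 4) with (RtoC (1 / 4)) in EI, ER by (rewrite RtoC_div by lra; reflexivity).
replace (IZR k / 2 + IZR l / 2 * (IZR x + y * Ci)) with
  ((IZR k / 2 + IZR l / 2 * IZR x, IZR l / 2 * y)%R : C) in EI, ER by (apply C_eq; cbn; field).
cbn in EI, ER.
assert (hl : (IZR l * y = 0)%R) by lra.
apply Rmult_integral in hl; destruct hl as [hl | hl]; [| lra].
rewrite hl in ER.
assert (h : IZR (2 * k) = 1%R) by (rewrite mult_IZR; lra).
apply eq_IZR in h; lia.
Qed.

Lemma difference_S_not_in_span :
  ~ span honest_characters (slash 0 (-1) 1 0 difference).
Proof.
intros Hinv.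
assert (hs := sqrt2_neq0).
assert (Hi : (0 < Im Ci)%R) by (cbn; lra).
assert (Hpi : (0 < Im (Ci + 1))%R) by (cbn; lra).
assert (Hmi : (0 < Im (Ci - 1))%R) by (cbn; lra).
assert (h48 : RtoC (sqrt 48) <> 0) by (apply RtoC_neq0, Rgt_not_eq, sqrt_lt_R0; lra).
assert (Hci0 := Im_pos_neq0 _ Hi).
assert (E1 : Gauss (Ci + 1) = Gauss Ci).
{ assert (h := Gauss_period (IZR 0 + 48%R * Ci) _ Hinv (dom_quarter 0 48 ltac:(lra))).
  replace (IZR 0 + 48 * Ci + 48) with (48%R * (Ci + 1)) in h by ring.
  replace (IZR 0 + 48 * Ci) with (48%R * Ci) in h by ring.
  rewrite !Gauss_scale_sqrt in h by (assumption || lra).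
  transitivity (/ sqrt 48 * (sqrt 48 * Gauss (Ci + 1))); [field; exact h48 |].
  rewrite h; field; exact h48. }
assert (E2 : Gauss (Ci - 1) = Gauss Ci).
{ assert (h := Gauss_period (IZR (-48) + 48%R * Ci) _ Hinv (dom_quarter (-48) 48 ltac:(lra))).
  replace (IZR (-48) + 48 * Ci + 48) with (48%R * Ci) in h by ring.
  replace (IZR (-48) + 48 * Ci) with (48%R * (Ci - 1)) in h by ring.
  rewrite !Gauss_scale_sqrt in h by (assumption || lra).
  transitivity (/ sqrt 48 * (sqrt 48 * Gauss (Ci - 1))); [field; exact h48 |].
  rewrite <- h; field; exact h48. }
assert (E3 := Gauss_S Ci Hi).
replace (- (1) / Ci) with Ci in E3.
2:{ transitivity (Ci * Ci / Ci); [field; exact Hci0 | rewrite Ci_sqr; reflexivity]. }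
(* The inversion of [i + 1] is half of [i - 1]. If the values at [i - 1], [i] and [i + 1] agree,
   homogeneity gives [Gauss i = sqrt 2 * Gauss ((i - 1) / 2)]; multiplied by [Gauss i], this reads
   [1 = sqrt 2]. *)
assert (E4 := Gauss_S (Ci + 1) Hpi).
replace (- (1) / (Ci + 1)) with ((Ci - 1) / 2) in E4 by (apply C_eq; cbn; field).
assert (E5 := Gauss_half (Ci - 1) Hmi).
rewrite E2 in E5; rewrite E1 in E4.
assert (E6 : RtoC (sqrt 2) = 1).
{ transitivity (sqrt 2 * (Gauss ((Ci - 1) / 2) * Gauss Ci)); [rewrite E4; ring |].
  rewrite Cmult_assoc, <- E5; exact E3. }
apply RtoC_inj in E6; assert (h := sqrt_sqrt 2 ltac:(lra)); rewrite E6 in h; lra.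
Qed.

Theorem corollary6p2 :
  SL2Z_invariant (span six_functions)
  /\ ~ SL2Z_invariant (span honest_characters)
  /\ fn_incl (span six_functions) (span honest_characters)
  /\ nontrivial_in (span six_functions) (span honest_characters).
Proof.
assert (Hsix : SL2Z_invariant (span six_functions)).
{ intros a b c d Hdet f Hf; apply span_six; apply span_six in Hf.
  exact (in_model_SL2Z a b c d Hdet f Hf). }
assert (Hincl : fn_incl (span six_functions) (span honest_characters)).
{ intros f [cs [Hl H]]; unfold six_functions in *; cbn [length] in Hl.
  destruct cs as [|d1 [|d2 [|d3 [|d4 [|d5 [|d6 [|]]]]]]]; try discriminate Hl.
  (* The coefficients [d3] and [d4] occur twice, for [m2 = 0] and for [m2 = 2], since the
     corresponding functions are sums of two characters. *)
  exists (d3 :: d4 :: RtoC 0 :: RtoC 0 :: d1 :: d2 :: d5 :: d6 :: d3 :: d4 :: RtoC 0 :: RtoC 0 :: nil).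
  split; [reflexivity |]; intros tau z Hd; rewrite (H tau z Hd).
  unfold honest_characters; cbn [flat_map app lincomb].
  unfold fn_plus, fn_scal, fn_zero; ring. }
split; [exact Hsix |]; split; [intros H; apply difference_S_not_in_span, H, difference_in_span; reflexivity |]; split; [exact Hincl |].
split.
- exists (ch_minus 1); split.
  + exists (map RtoC (0 :: 1 :: 0 :: 0 :: 0 :: 0 :: nil)%R); split; [reflexivity |].
    intros tau z _; unfold six_functions; cbn [lincomb map]; unfold fn_plus, fn_scal, fn_zero; ring.
  + intros E.
    assert (Hd := dom_quarter 0 1 ltac:(lra)); assert (HT := proj1 Hd).
    specialize (E _ _ Hd); unfold fn_zero in E; rewrite ch_minus_1 in E by exact Hd.
    destruct (eta_triple_neq0 _ HT) as [h1 [h2 _]].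
    destruct (theta_dom_neq0 _ _ Hd) as [_ [_ [_ [_ [h3 h4]]]]].
    revert E; unfold w1.
    apply Cmult_neq_0; [| apply Cmult_neq_0; [apply Cdiv_neq0 | apply Cmult_neq_0]]; auto using Cpow_nz.
    intros E; apply (f_equal Im) in E; cbn in E; lra.
(* If the difference were in the smaller span, invariance would put its image under inversion there
   too, hence among the combinations of honest characters. *)
- exists difference; split; [exact difference_in_span |]; intros Hs.
  apply difference_S_not_in_span, Hincl, Hsix, Hs; reflexivity.
Qed.
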